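(* Let $k\ge 6$ be an integer, and suppose that $\alpha\in\mathbb{R}$, $a\in\mathbb{Z}$ and $q\in\mathbb{N}$ satisfy $(a,q)=1$. Then for each $\varepsilon>0$, one has $$f_k(\alpha;X)\ll X^{1+\varepsilon}\Phi^{2^{-k}}+X^{1+\varepsilon}(\Phi/X)^{\frac{2}{3}2^{-k}},$$ where $$\Phi=(q+X^k|q\alpha-a|)^{-1}+X^{-3}+(q+X^k|q\alpha-a|)X^{-k}.$$
   Context: Write $e(z)=e^{2\pi i z}$. $X\ge 1$ is a real number (the main parameter), and $f_k(\alpha;X)=\sum_{1\le x\le X}e(\alpha x^k)$, the sum being over integers $x$. Here $\mathbb{N}$ is the set of positive integers and $(a,q)$ is the greatest common divisor. The notation $A\ll B$ means $|A|\le CB$, where the constant $C>0$ may depend on $\varepsilon$ and $k$ but not on $X$, $\alpha$, $a$ or $q$. *)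

(* Defs.v *)
From mathcomp Require Import all_boot all_order all_algebra.
From mathcomp Require Import all_classical all_reals all_analysis.
From mathcomp Require Import complex.

Set Implicit Arguments.
Unset Strict Implicit.
Unset Printing Implicit Defensive.

Import Order.TTheory GRing.Theory Num.Theory.

Local Open Scope ring_scope.
Local Open Scope complex_scope.

(* Neither the complex-number library nor the analysis library provides the
   complex exponential, hence exp(x + iy) = exp(x) (cos y + i sin y). *)
Definition cexp (R : realType) (z : R[i]) : R[i] :=
  (expR (complex.Re z))%:C * (cos (complex.Im z) +i* sin (complex.Im z)).

Definition e (R : realType) (z : R[i]) : R[i] := cexp (2 * pi%:C * 'i * z).

(* For 0 <= X, [Num.truncn X] is the floor of X, so x runs over the integers
   with 1 <= x <= X. *)
Definition weyl_sum (R : realType) (k : nat) (alpha X : R) : R[i] :=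
  \sum_(1 <= x < (Num.truncn X).+1) e (alpha * x%:R ^+ k)%:C.

Definition Phi (R : realType) (k : nat) (alpha X : R) (a : int) (q : nat) : R :=
  let D := q%:R + X ^+ k * `|q%:R * alpha - a%:~R| in
  D^-1 + X ^- 3 + D * X ^- k.

(* Main.v *)
Require Import Defs.
From mathcomp Require Import all_boot all_order all_algebra.
From mathcomp Require Import all_classical all_reals all_analysis.
From mathcomp Require Import complex ring lra zify.

Import Order.TTheory GRing.Theory Num.Theory.

Set Implicit Arguments.
Unset Strict Implicit.
Unset Printing Implicit Defensive.

Local Open Scope ring_scope.

(** Differencing the phase [alpha * x ^ k] exactly [j = k - 3] times bounds
[|f| ^ 2 ^ j] by an average of cubic exponential sums of length at most [Y],
the integer part of [X], whose leading coefficients are [n * alpha] with [n]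
of size at most about [Y ^ (k - 3)] ([weyl_differencing]).  By the divisor
bound each positive [n] occurs only [Y ^ eps] times ([sum_iter_prod_le]), so
that everything rests on the average over [n] of cubic sums with leading
coefficient [ga = n * alpha] and unknown lower coefficients.

Two bounds for one such sum [S] are combined ([cubic_dichotomy]).  Let [b / r]
be a Dirichlet approximation to [ga] of level [Y ^ 2], and put
[lam = r + Y ^ 3 * |r * ga - b|].
- If [lam < Y], the inequality of Weyl gives [S ^ 8 << Y ^ (8 + eps) / lam ^ 2],
  and [lam ^ -2] is at most a fixed sum over fractions [b / r] of spikes at
  [b / r] ([rational_majorant]).
- If [lam >= Y], a shift of the variable by [z] changes the quadratic
  coefficient by [- 3 * z * ga], and averaging over [z] shows that
  [S ^ 12 << Y ^ (2 + eps) * V ga], where [V] is the mean of the twelfth power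
  of the cubic sum over its linear and quadratic coefficients
  ([cubic_vinogradov_bound]).

Both majorants are nonnegative and can be summed over the multiples
[n * alpha].  For the spikes this is the classical estimate for
[min (H, 1 / ||n * alpha||)] ([sum_peak_rational]).  For [V], a nonnegative
trigonometric polynomial whose mean is the number of solutions of the cubic
Vinogradov system in twelve variables, the sum over multiples is at most the
mean times a sum of the same classical kind ([progression_sum_le]).  The first
contribution is [Y * Phi ^ (1 / 8)], the second [Y * (Phi / Y) ^ (1 / 12)], up
to [Y ^ eps]; extracting a root of order [2 ^ (k - 3)] turns [1 / 8] into
[2 ^ - k] and [1 / 12] into [2 / 3 * 2 ^ - k].  The condition [6 <= k] makes
the range of [n] at least as long as [Y ^ 3], the precision at which a cubic
sum sees its leading coefficient.

The number of solutions of the cubic system is [N ^ (6 + eps)]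
([cubic_vinogradov]), by efficient congruencing for the fixed prime [17]: a
hypothetical exponent [6 + s] is improved until [s] is as small as desired.
Twelfth moments in which some variables lie in one residue class modulo [p ^ a]
and the others in a different class modulo [p ^ b] are related to moments with
finer classes ([refine_two_classes], [refine_four_classes]), because the
equations force congruences modulo powers of [p]; iterating this beats the
trivial bound by a power of [N]. *)

(** * The exponential and the distance to the nearest integer *)

Local Notation cabs := (@Normc.normc _) (only parsing).

Lemma le_of_eq (R : numDomainType) (x y : R) : x = y -> x <= y.
Proof. by move->. Qed.

Section Exponential.
Variable R : realType.
Implicit Types (s t : R) (z w : R[i]).

(** The additive character [t |-> exp (2 * i * pi * t)] of the reals. *)
Definition ee t : R[i] := (cos (2 * pi * t) +i* sin (2 * pi * t))%C.

Lemma cabs_ge0 z : 0 <= cabs z.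
Proof. by case: z => a b; exact: sqrtr_ge0. Qed.

Lemma cabs_triangle z w : cabs (z + w) <= cabs z + cabs w.
Proof. exact: le_normcD. Qed.

Lemma cabs_opp z : cabs (- z) = cabs z.
Proof. exact: (@normcN _ (z : Rcomplex R)). Qed.

Lemma cabsM z w : cabs (z * w) = cabs z * cabs w.
Proof. exact: Normc.normcM. Qed.

Lemma cabs0 : cabs (0 : R[i]) = 0.
Proof. exact: Normc.normc0. Qed.

Lemma cabs1 : cabs (1 : R[i]) = 1.
Proof. exact: Normc.normc1. Qed.

Lemma cabsX z n : cabs (z ^+ n) = cabs z ^+ n.
Proof. by elim: n => [|n IH]; rewrite ?expr0 ?cabs1 // !exprS cabsM IH. Qed.

Lemma cabs_sum (I : Type) (r : seq I) (P : pred I) (F : I -> R[i]) :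
  cabs (\sum_(i <- r | P i) F i) <= \sum_(i <- r | P i) cabs (F i).
Proof.
elim/big_ind2: _ => [|z a w b hz hw|i _]; rewrite ?cabs0 //.
exact: le_trans (cabs_triangle _ _) (lerD hz hw).
Qed.

Lemma cabs_conj z : cabs (z^*)%C = cabs z.
Proof. by case: z => a b /=; rewrite sqrrN. Qed.

Lemma conjM z w : ((z * w)^*)%C = (z^*)%C * (w^*)%C.
Proof. exact: (rmorphM (@conjc R)). Qed.

Lemma conj_prod (I : finType) (F : I -> R[i]) :
  ((\prod_i F i)^* )%C = \prod_i ((F i)^*)%C.
Proof. exact: (big_morph _ conjM (conjc1 R)). Qed.

Lemma conj_sum (I : Type) (r : seq I) (P : pred I) (F : I -> R[i]) :
  ((\sum_(i <- r | P i) F i)^* )%C = \sum_(i <- r | P i) ((F i)^*)%C.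
Proof. exact: (big_morph _ (rmorphD (@conjc R)) (conjc0 R)). Qed.

Lemma cabs_real (x : R) : cabs (x%:C)%C = `|x|.
Proof. by rewrite /= expr0n /= addr0 sqrtr_sqr. Qed.

Lemma cabs_sqr z : ((cabs z ^+ 2)%:C)%C = z * (z^*)%C.
Proof.
case: z => a b /=; rewrite sqr_sqrtr ?addr_ge0 ?sqr_ge0 //.
by apply/eqP; rewrite eq_complex /=; apply/andP; split; apply/eqP; ring.
Qed.

Lemma eeD s t : ee (s + t) = ee s * ee t.
Proof.
rewrite /ee mulrDr cosD sinD; apply/eqP; rewrite eq_complex /=.
by apply/andP; split; apply/eqP; ring.
Qed.

Lemma ee0 : ee 0 = 1.
Proof. by rewrite /ee mulr0 cos0 sin0. Qed.

Lemma ee1 : ee 1 = 1.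
Proof. by rewrite /ee mulr1 mulr_natl cos2pi sin2pi. Qed.

Lemma eeN t : ee (- t) = ((ee t)^*)%C.
Proof. by rewrite /ee mulrN cosN sinN. Qed.

Lemma cabs_ee t : cabs (ee t) = 1.
Proof. by rewrite /= cos2Dsin2 sqrtr1. Qed.

Lemma ee_mulrn t n : ee (t *+ n) = ee t ^+ n.
Proof. by elim: n => [|n IH]; rewrite ?mulr0n ?ee0 // mulrS eeD IH exprS. Qed.

Lemma ee_int (m : int) : ee m%:~R = 1.
Proof.
case: m => n; first by rewrite -pmulrn ee_mulrn ee1 expr1n.
by rewrite NegzE mulrNz eeN -pmulrn ee_mulrn ee1 expr1n conjc1.
Qed.

Lemma ee_addint t (m : int) : ee (t + m%:~R) = ee t.
Proof. by rewrite eeD ee_int mulr1. Qed.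

Lemma ee_sum (I : finType) (F : I -> R) : ee (\sum_i F i) = \prod_i ee (F i).
Proof. exact: (big_morph _ eeD ee0). Qed.

End Exponential.

Arguments ee : simpl never.

Section NearestInteger.
Import numFieldNormedType.Exports.
Variable R : realType.
Implicit Types (s t x : R).

Definition dist_int t : R := `|t - (Num.floor (t + 1 / 2))%:~R|.

Lemma dist_int_ge0 t : 0 <= dist_int t.
Proof. exact: normr_ge0. Qed.

Lemma dist_int_half t : dist_int t <= 1 / 2.
Proof.
rewrite /dist_int; have /andP[] := floor_itv (t + 1 / 2); rewrite intrD1.
by move=> h1 h2; rewrite ler_norml; apply/andP; split; lra.
Qed.

Lemma dist_int_ex t : exists m : int, dist_int t = `|t - m%:~R|.
Proof. by eexists. Qed.

Lemma dist_int_le t (m : int) : dist_int t <= `|t - m%:~R|.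
Proof.
have h := dist_int_half t; rewrite /dist_int in h *.
set f := Num.floor _ in h *.
have [->//|ne] := eqVneq m f.
suff: 1 <= `|t - m%:~R| + `|t - f%:~R| by lra.
apply: le_trans (ler_normB _ _).
have -> : t - m%:~R - (t - f%:~R) = (f - m)%:~R by rewrite intrD mulrNz; ring.
by rewrite -intr_norm -[1]/(1%:~R) ler_int; lia.
Qed.

Lemma dist_int_addint t (m : int) : dist_int (t + m%:~R) = dist_int t.
Proof.
apply/eqP; rewrite eq_le; apply/andP; split.
  have [k ->] := dist_int_ex t; apply: le_trans (dist_int_le _ (k + m)) _.
  by rewrite intrD opprD addrACA subrr addr0.
have [k ->] := dist_int_ex (t + m%:~R); apply: le_trans (dist_int_le _ (k - m)) _.
by rewrite intrD mulrNz opprD opprK addrA addrAC.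
Qed.

Lemma dist_int_opp t : dist_int (- t) = dist_int t.
Proof.
suff h s : dist_int (- s) <= dist_int s by apply/le_anti/andP; split; rewrite // -{1}[t]opprK.
have [k ->] := dist_int_ex s; apply: le_trans (dist_int_le _ (- k)) _.
by rewrite mulrNz -opprD normrN.
Qed.

(** [cos] decreases on [[0, x / 2]], so that the mean value theorem gives
[sin (x / 2) >= cos (x / 2) * (x / 2)]; the duplication formulas conclude. *)
Lemma sin_ge_half x : 0 <= x <= pi / 2 -> x / 2 <= sin x.
Proof.
move=> /andP[x0 xp].
have hy : 0 <= x / 2 <= pi / 2 by apply/andP; split; lra.
have /andP[y0 yp] := hy.
have [|c] := @MVT_segment _ sin cos _ _ y0 (fun z _ => is_derive_sin z).
  exact/continuous_subspaceT/continuous_sin.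
rewrite in_itv /= sin0 !subr0 => /andP[c0 cy] e.
have cosle : cos (x / 2) <= cos c.
  have [->//|/negP ne] := eqVneq c (x / 2).
  apply/ltW; rewrite ltr_cos ?in_itv /=; first by rewrite lt_neqAle cy andbT; apply/negP.
    by apply/andP; split => //; have := pi_ge0 R; lra.
  by apply/andP; split => //; have := pi_ge0 R; lra.
have cos0' : 0 <= cos (x / 2) by apply: cos_ge0_pihalf; apply/andP; split; lra.
have sy : cos (x / 2) * (x / 2) <= sin (x / 2) by rewrite e ler_wpM2r.
have ex : x = (x / 2) *+ 2 by rewrite mulr2n; field.
rewrite [in leRHS]ex sin_mulr2n.
have : cos (x / 2) * (cos (x / 2) * (x / 2)) <= cos (x / 2) * sin (x / 2) by rewrite ler_wpM2l.
have c2 : 0 <= cos x by apply: cos_ge0_pihalf; apply/andP; split; lra.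
have e2 : cos x = 2 * cos (x / 2) ^+ 2 - 1 by rewrite [in LHS]ex cos_mulr2n mulr_natl.
have : 0 <= (2 * cos (x / 2) ^+ 2 - 1) * (x / 2) by rewrite -e2 mulr_ge0 //; lra.
by rewrite mulr2n; lra.
Qed.

(** After reduction modulo 1, [|e(u) - 1| = 2 * |sin (pi * u)|] with
[|u| <= 1 / 2], where the sine is at least half of its argument. *)
Lemma cabs_ee_sub1 t : 2 * dist_int t <= cabs (ee t - 1).
Proof.
have [m em] := dist_int_ex t; set u := t - m%:~R in em.
have -> : ee t = ee u by rewrite -[in LHS](subrK m%:~R t) ee_addint.
have hu : `|u| <= 1 / 2 by rewrite -em dist_int_half.
rewrite em.
have -> : ee u - 1 = ee (u / 2) * (0 +i* (2 * sin (pi * u)))%C.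
  have -> : 1 = ee (u / 2) * ee (- (u / 2)) by rewrite -eeD subrr ee0.
  have -> : ee u = ee (u / 2) * ee (u / 2) by rewrite -eeD; congr ee; field.
  rewrite -mulrBr; congr (_ * _); rewrite eeN /ee.
  rewrite (_ : 2 * pi * (u / 2) = pi * u); last by field.
  by apply/eqP; rewrite eq_complex /=; apply/andP; split; apply/eqP; ring.
rewrite cabsM cabs_ee mul1r /= expr0n /= add0r sqrtr_sqr normrM ger0_norm //.
rewrite ler_pM2l //.
have pi2 := pi_ge2 R.
have -> : `|sin (pi * u)| = sin (pi * `|u|).
  have [u0|u0] := leP 0 u.
    rewrite (ger0_norm u0) ger0_norm // sin_ge0_pi //; apply/andP; split; first nra.
    by move: hu; rewrite ger0_norm // => hu; nra.
  move: hu; rewrite (ltr0_norm u0) mulrN sinN => hu; rewrite ler0_norm //.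
  by rewrite -oppr_ge0 -sinN -mulrN sin_ge0_pi //; apply/andP; split; nra.
have a0 := normr_ge0 u.
apply: (le_trans _ (sin_ge_half _)); first by nra.
by apply/andP; split; nra.
Qed.

(** A smooth substitute for [min (H, 1 / ||t||)], within a factor 2 of it. *)
Definition peak H t : R := H / (1 + H * dist_int t).

Lemma peak_ge0 H t : 0 <= H -> 0 <= peak H t.
Proof. by move=> h; rewrite divr_ge0 // addr_ge0 // mulr_ge0 // dist_int_ge0. Qed.

Lemma peak_le H t : 0 <= H -> peak H t <= H.
Proof.
move=> h; have n0 := dist_int_ge0 t.
by rewrite ler_pdivrMr; [nra | rewrite ltr_pwDl // mulr_ge0].
Qed.

(** The trivial bound [n] and the closed form of the geometric sum, whose
denominator is controlled by [cabs_ee_sub1]. *)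
Lemma geometric_bound (n : nat) H t c : 0 < H -> n%:R <= H ->
  cabs (\sum_(x < n) ee (x%:R * t + c)) <= 2 * peak H t.
Proof.
move=> H0 nH; set S := \sum_(_ < _) _; have n0 := dist_int_ge0 t.
have SH : cabs S <= H.
  apply: le_trans nH; apply: le_trans (cabs_sum _ _ _) _.
  under eq_bigr do rewrite cabs_ee.
  by rewrite sumr_const card_ord.
have e1 : (ee t - 1) * S = ee c * (ee (t *+ n) - 1).
  rewrite /S; under eq_bigr => i _ do rewrite eeD mulr_natl ee_mulrn mulrC.
  by rewrite -mulr_sumr mulrCA -subrX1 ee_mulrn.
have S1 : dist_int t * cabs S <= 1.
  have : cabs ((ee t - 1) * S) <= 2.
    rewrite e1 cabsM cabs_ee mul1r; apply: le_trans (cabs_triangle _ _) _.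
    by rewrite cabs_opp cabs1 cabs_ee.
  rewrite cabsM; have := cabs_ee_sub1 t; have := cabs_ge0 S; nra.
rewrite /peak mulrA ler_pdivlMr ?ltr_pwDl ?mulr_ge0 //; last exact: ltW.
have := cabs_ge0 S; nra.
Qed.

Lemma peak_opp H t : peak H (- t) = peak H t.
Proof. by rewrite /peak dist_int_opp. Qed.

Lemma peak_addint H t (m : int) : peak H (t + m%:~R) = peak H t.
Proof. by rewrite /peak dist_int_addint. Qed.

End NearestInteger.

Arguments Normc.normc : simpl never.

(** * Reciprocal sums along arithmetic progressions *)

Section SpacedPoints.
Variable R : realType.
Implicit Types (H t al : R).

(** Grows like the logarithm; it carries all logarithmic losses below. *)
Definition harm (n : nat) : R := \sum_(j < n) (j.+1%:R)^-1.

Lemma harm_ge0 n : 0 <= harm n.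
Proof. by apply: sumr_ge0 => i _; rewrite invr_ge0. Qed.

Lemma harm_mono m n : (m <= n)%N -> harm m <= harm n.
Proof.
move=> mn; rewrite /harm (big_ord_widen _ (fun j => (j.+1%:R : R)^-1) mn).
by rewrite [leLHS]big_mkcond ler_sum // => i _; case: ifP => // _; rewrite invr_ge0.
Qed.

Lemma sum_inj_le (I J : finType) (g : I -> J) (F : J -> R) :
  injective g -> (forall j, 0 <= F j) -> \sum_i F (g i) <= \sum_j F j.
Proof.
move=> gi F0; have -> : \sum_i F (g i) = \sum_(i in [set: I]) F (g i).
  by apply: eq_bigl => i; rewrite inE.
rewrite -(big_imset F) /=; last by move=> ? ? _ _; exact: gi.
by rewrite big_mkcond /= ler_sum // => j _; case: ifP.
Qed.

(** Points at mutual distance [dl] modulo 1: at most two of them, one on each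
side of the nearest integer, have [j * dl <= ||t|| < (j + 1) * dl].  The
hypothesis on [J] makes [J] an upper bound for the possible values of [j]. *)
Lemma spaced_peak_sum (L J : nat) (t : 'I_L -> R) (dl H : R) :
  0 < dl -> 0 < H -> 1 <= 2 * dl * J%:R ->
  (forall i j, i != j -> dl <= dist_int (t i - t j)) ->
  \sum_i peak H (t i) <= 2 * (H + dl^-1 * harm J).
Proof.
move=> d0 H0 hJ sep.
pose m i := Num.floor (t i + 1 / 2); pose u i := t i - (m i)%:~R.
have un i : dist_int (t i) = `|u i| by [].
pose k i := Num.truncn (dist_int (t i) / dl).
have q0 i : 0 <= dist_int (t i) / dl by rewrite divr_ge0 ?dist_int_ge0 // ltW.
have kP i : (k i)%:R * dl <= dist_int (t i) < ((k i).+1)%:R * dl.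
  by have := truncn_itv (q0 i); rewrite ler_pdivlMr // ltr_pdivrMr.
have kJ i : (k i < J.+1)%N.
  rewrite ltnS -(ler_nat R); have /andP[h _] := kP i; have h2 := dist_int_half (t i).
  rewrite -(ler_pM2r d0); nra.
(* The point is located by its distance slot and the side of the nearest integer. *)
pose g i : 'I_J.+1 * bool := (Ordinal (kJ i), u i < 0).
have gi : injective g.
  move=> i j [] kij /esym uij; apply/eqP; apply: contraT => ne.
  have := sep i j ne; rewrite leNgt => /negP[].
  apply: le_lt_trans (dist_int_le _ (m i - m j)) _.
  have -> : t i - t j - (m i - m j)%:~R = u i - u j by rewrite /u intrD mulrNz; ring.
  have /andP[] := kP i; have /andP[] := kP j; rewrite -kij !un.
  rewrite -[in X in _ < X * _]addn1 natrD => a1 a2 a3 a4.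
  move: uij a1 a2 a3 a4; case: ltP => hj; case: ltP => hi // _;
  rewrite ?(ltr0_norm hj) ?(ltr0_norm hi) ?(ger0_norm hj) ?(ger0_norm hi) => a1 a2 a3 a4;
  rewrite ltr_norml; apply/andP; split; nra.
pose G (j : 'I_J.+1 * bool) : R := H / (1 + H * (dl * (j.1)%:R)).
have den (x : R) : 0 <= x -> 0 < 1 + H * x by move=> ?; rewrite ltr_pwDl // mulr_ge0 // ltW.
have G0 j : 0 <= G j by rewrite divr_ge0 ?ltW // den // mulr_ge0 // ltW.
apply: (@le_trans _ _ (\sum_i G (g i))).
  apply: ler_sum => i _; rewrite /peak /G /=.
  rewrite ler_pM2l // lef_pV2 ?posrE ?den ?dist_int_ge0 ?mulr_ge0 //; last exact: ltW.
  by rewrite lerD2l ler_pM2l // mulrC; have /andP[] := kP i.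
apply: le_trans (sum_inj_le gi G0) _.
rewrite -(pair_bigA _ (fun j b => G (j, b))) /=.
have -> : \sum_(j < J.+1) \sum_b G (j, b) = 2 * \sum_(j < J.+1) G (j, true).
  by rewrite mulr_sumr; apply: eq_bigr => j _; rewrite big_bool /= /G /=; ring.
rewrite ler_pM2l // big_ord_recl lerD //.
  by rewrite /G /= mulr0 mulr0 addr0 divr1.
rewrite mulr_sumr ler_sum // => j _; rewrite /G /= /bump /= add1n.
rewrite ler_pdivrMr ?den ?mulr_ge0 //; last exact: ltW.
have j0 : 0 < j.+1%:R :> R by [].
rewrite mulrDr mulr1 -mulrA.
have -> : dl^-1 * (j.+1%:R^-1 * (H * (dl * j.+1%:R))) = H.
  by field; rewrite !gt_eqF.
by rewrite lerDr mulr_ge0 ?invr_ge0 // ltW.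
Qed.

(** Cuts the progression into blocks of length [L], inside which the points
are [dl]-spaced modulo 1. *)
Lemma progression_peak_sum (N L J : nat) (al rho dl H : R) :
  (0 < L)%N -> 0 < dl -> 0 < H -> 1 <= 2 * dl * J%:R ->
  (forall d : nat, (0 < d < L)%N -> dl <= dist_int (d%:R * al)) ->
  \sum_(i < N) peak H (i%:R * al + rho)
    <= (N%:R / L%:R + 1) * (2 * (H + dl^-1 * harm J)).
Proof.
move=> L0 d0 H0 hJ sep.
have mm0 t : 0 <= peak H t by apply: peak_ge0; exact: ltW.
have one_block rho' : \sum_(i < L) peak H (i%:R * al + rho') <= 2 * (H + dl^-1 * harm J).
  apply: spaced_peak_sum => // i j ne.
  rewrite opprD addrACA subrr addr0 -mulrBl.
  wlog ij : i j ne / (i < j)%N => [hw|].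
    have [ij|ji|/val_inj eij] := ltngtP i j; first exact: hw.
      by rewrite -dist_int_opp -mulNr opprB; apply: hw; rewrite // eq_sym.
    by rewrite eij eqxx in ne.
  rewrite -dist_int_opp -mulNr opprB -natrB 1?ltnW //.
  by apply: sep; rewrite subn_gt0 ij /= (leq_ltn_trans (leq_subr _ _)).
have blocks B : \sum_(i < B * L) peak H (i%:R * al + rho) <= B%:R * (2 * (H + dl^-1 * harm J)).
  elim: B => [|B IH]; first by rewrite big_ord0 mul0r.
  rewrite mulSn addnC big_split_ord /= -[B.+1]addn1 natrD mulrDl mul1r lerD //.
  apply: le_trans (one_block ((B * L)%:R * al + rho)).
  by apply: ler_sum => i _; rewrite natrD mulrDl addrA [_ * al + _ * al]addrC.
apply: (@le_trans _ _ (\sum_(i < (N %/ L).+1 * L) peak H (i%:R * al + rho))).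
  have NB : (N <= (N %/ L).+1 * L)%N by rewrite ltnW // ltn_ceil.
  rewrite (big_ord_widen _ (fun i : nat => peak H (i%:R * al + rho)) NB).
  by rewrite [leLHS]big_mkcond ler_sum // => i _; case: ifP.
apply: le_trans (blocks _) _; rewrite ler_wpM2r //.
  by rewrite mulr_ge0 // addr_ge0 ?(ltW H0) // mulr_ge0 ?harm_ge0 // invr_ge0 ltW.
by rewrite -[_.+1]addn1 natrD lerD2r ler_pdivlMr ?ltr0n // -natrM ler_nat leq_trunc_div.
Qed.

(** Pigeonhole on the fractional parts of [0, al, ..., Q * al]; coprimality is
obtained by dividing out the common factor. *)
Lemma dirichlet (al : R) (Q : nat) : (0 < Q)%N ->
  exists (r : nat) (b : int), [/\ (0 < r <= Q)%N, coprimez b r%:Z &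
    `|r%:R * al - b%:~R| <= Q%:R^-1].
Proof.
move=> Q0; have QR : 0 < Q%:R :> R by rewrite ltr0n.
pose fr (i : nat) : R := i%:R * al - (Num.floor (i%:R * al))%:~R.
have frP i : 0 <= fr i < 1.
  by have := floor_itv (i%:R * al); rewrite intrD1 /fr => /andP[? ?]; apply/andP; split; lra.
have q0 i : 0 <= Q%:R * fr i by rewrite mulr_ge0 ?(ltW QR) //; case/andP: (frP i).
have kQ i : (Num.truncn (Q%:R * fr i) < Q)%N.
  by rewrite -(ltr_nat R); have := truncn_itv (q0 i); have := frP i; nra.
pose f (i : 'I_Q.+1) : 'I_Q := Ordinal (kQ i).
have : ~~ injectiveb f.
  apply/negP => /injectiveP fi; have := leq_card f fi.
  by rewrite !card_ord ltnn.
case/injectivePn => i [j ne fij].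
wlog ij : i j ne fij / (i < j)%N => [hw|].
  have [ij|ji|/val_inj eij] := ltngtP i j; first exact: (hw i j).
    by apply: (hw j i) => //; rewrite eq_sym.
  by rewrite eij eqxx in ne.
have /(congr1 val) /= tij := fij.
have close : `|fr j - fr i| < Q%:R^-1.
  have := truncn_itv (q0 i); have := truncn_itv (q0 j).
  rewrite -tij -[in X in _ < X]addn1 natrD => /andP[a1 a2] /andP[a3 a4].
  rewrite -(ltr_pM2l QR) divff ?gt_eqF // -[X in X * `|_|](ger0_norm (ltW QR)) -normrM.
  by rewrite ltr_norml; apply/andP; split; lra.
set r0 := (j - i)%N; set b0 := Num.floor (j%:R * al) - Num.floor (i%:R * al).
have r0gt : (0 < r0)%N by rewrite subn_gt0.
have cl0 : `|r0%:R * al - b0%:~R| < Q%:R^-1.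
  suff -> : r0%:R * al - b0%:~R = fr j - fr i by [].
  by rewrite /r0 /b0 natrB ?(ltnW ij) // intrD mulrNz /fr; ring.
pose g := gcdn r0 `|b0|%N.
have g0 : (0 < g)%N by rewrite gcdn_gt0 r0gt.
have gr : (g %| r0)%N := dvdn_gcdl _ _.
have gb : (g%:Z %| b0)%Z by rewrite dvdzE absz_nat dvdn_gcdr.
exists (r0 %/ g)%N, (b0 %/ g%:Z)%Z; split.
- rewrite divn_gt0 // dvdn_leq //=; apply: leq_trans (leq_div _ _) _.
  by rewrite /r0 (leq_trans (leq_subr _ _)) // -ltnS.
- have := gr => /dvdnP[r1 er]; have := gb => /dvdzP[b1 eb].
  rewrite er mulnK // eb mulzK ?eqz_nat -?lt0n // /coprimez /gcdz /=.
  have : gcdn r0 `|b0| = g by [].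
  rewrite er eb abszM /= -muln_gcdl => /eqP; rewrite -[X in _ == X]mul1n eqn_pmul2r //.
  by rewrite gcdnC.
apply/ltW; apply: le_lt_trans cl0.
have gR : 1 <= g%:R :> R by rewrite ler1n.
have -> : r0%:R * al - b0%:~R = g%:R * ((r0 %/ g)%:R * al - (b0 %/ g%:Z)%Z%:~R).
  rewrite mulrBr mulrA -natrM mulnC divnK //.
  by rewrite [g%:R in RHS]pmulrn -[X in _ = _ - X]intrM [g%:Z * _]mulrC divzK.
by rewrite normrM ger0_norm // ler_peMl.
Qed.

(** Two distinct fractions [a / q] and [m / d] differ by at least
[1 / (d * q)], so a number close to the first is far from the second. *)
Lemma dist_frac (al : R) (a : int) (q d : nat) (m : int) :
  d%:Z * a - q%:Z * m != 0 ->
  1 - d%:R * `|q%:R * al - a%:~R| <= q%:R * `|d%:R * al - m%:~R|.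
Proof.
move=> ne.
have -> : q%:R * `|d%:R * al - m%:~R| = `|(d%:Z * a - q%:Z * m)%:~R + d%:R * (q%:R * al - a%:~R)|.
  rewrite -[X in X * `|_|](ger0_norm (ler0n _ q)) -normrM intrD mulrNz !intrM -!pmulrn.
  by congr `|_|; ring.
have h1 : 1 <= `|(d%:Z * a - q%:Z * m)%:~R| :> R.
  by rewrite -intr_norm -[1]/(1%:~R) ler_int; lia.
rewrite -[X in 1 - X * _](ger0_norm (ler0n _ d)) -normrM.
set x := _ * _; set y := _%:~R in h1 *.
have := ler_normB (y + x) x; rewrite addrK; lra.
Qed.

Lemma coprime_sub_neq0 (a m : int) (q d : nat) :
  coprimez a q%:Z -> ~~ (q %| d)%N -> d%:Z * a - q%:Z * m != 0.
Proof.
move=> cop; apply: contra; rewrite subr_eq0 => /eqP e.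
have : (q%:Z %| d%:Z * a)%Z by rewrite e dvdz_mulr.
by rewrite mulrC Gauss_dvdzr // coprimez_sym.
Qed.

Lemma half_facts (q : nat) : (0 < q)%N ->
  [/\ (0 < (q.+1)./2)%N, (q <= 2 * (q.+1)./2)%N &
      forall d, (d < (q.+1)./2)%N -> (2 * d < q)%N].
Proof. by move=> q0; split => [||d]; lia. Qed.

(** The case of an approximation [a / q] that is good at its own level,
[q * |q * al - a| <= 1]: the multiples of [al] are then spaced either like
multiples of [1 / q] or, on longer ranges, by the error [|q * al - a|]. *)
Lemma sum_peak_close (N J : nat) (al rho H : R) (a : int) (q : nat) :
  (0 < q)%N -> coprimez a q%:Z -> 0 < H -> N%:R * H <= J%:R ->
  let D : R := `|q%:R * al - a%:~R| in let lam : R := q%:R + N%:R * H * D in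
  q%:R * D <= 1 -> lam <= N%:R * H ->
  \sum_(i < N) peak H (i%:R * al + rho)
    <= 8 * (1 + harm J) * (N%:R * H / lam + N%:R + H + lam).
Proof.
move=> q0 cop H0 NJ D lam qD lamNH.
have D0 : 0 <= D := normr_ge0 _.
have q1 : 1 <= q%:R :> R by rewrite ler1n.
have N0 : 0 <= N%:R :> R by [].
have NHD0 : 0 <= N%:R * H * D by rewrite !mulr_ge0 // ltW.
have lam1 : 1 <= lam by rewrite /lam; lra.
have NH1 : 1 <= N%:R * H by apply: le_trans lamNH.
have h0 := harm_ge0 J; set h := harm J in h0 *.
have hJ1 : h <= 1 + h by lra.
have far (d : nat) (m : int) : d%:Z * a - q%:Z * m != 0 -> d%:R * D <= 1 / 2 ->
    (2 * q%:R)^-1 <= `|d%:R * al - m%:~R|.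
  move=> ne dD; have := dist_frac al ne; rewrite -/D => hh.
  rewrite -(ler_pM2l (_ : 0 < 2 * q%:R)); last lra.
  rewrite divff ?gt_eqF //; last lra.
  by nra.
have ilam : 0 < lam^-1 by rewrite invr_gt0; lra.
have T1 : 0 <= N%:R * H / lam by rewrite mulr_ge0 ?ltW //; lra.
have [le|gt] := leP (N%:R * H * D) q%:R.
  (* The error is negligible: the first q / 2 multiples of al are 1 / (2 q)-spaced. *)
  have := half_facts q0; set L := (q.+1)./2 => -[L0 Lq Ld].
  have {}Lq : q%:R <= 2 * L%:R :> R by rewrite -natrM ler_nat.
  have sep d : (0 < d < L)%N -> (2 * q%:R)^-1 <= dist_int (d%:R * al).
    move=> /andP[d0 dL]; have [m ->] := dist_int_ex (d%:R * al).
    have d2 := Ld _ dL.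
    apply: far.
      apply: coprime_sub_neq0 => //; apply/negP => /(dvdn_leq d0); apply/negP.
      by rewrite -ltnNge (leq_trans _ d2) // ltnS leq_pmull.
    have : 2 * d%:R <= q%:R :> R by rewrite -natrM ler_nat ltnW.
    by nra.
  have dl0 : 0 < (2 * q%:R)^-1 :> R by rewrite invr_gt0; lra.
  have qJ : 1 <= 2 * (2 * q%:R)^-1 * J%:R :> R.
    rewrite invfM mulrA divff ?mul1r // mulrC ler_pdivlMr ?mul1r; last lra.
    by apply: le_trans NJ; apply: le_trans lamNH; rewrite /lam; lra.
  apply: le_trans (progression_peak_sum N rho L0 dl0 H0 qJ sep) _.
  rewrite invrK -/h.
  have i1 : N%:R / L%:R <= 2 * (N%:R / q%:R) :> R.
    have L1 : 0 < L%:R :> R by rewrite ltr0n.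
    rewrite [leRHS]mulrCA ler_wpM2l // -[leLHS]div1r ler_pdivrMr // mulrAC.
    by rewrite ler_pdivlMr; lra.
  have i2 : q%:R^-1 <= 2 * lam^-1.
    rewrite -[leLHS]div1r ler_pdivrMr; last lra.
    rewrite mulrAC ler_pdivlMr ?mul1r; last lra.
    by rewrite /lam; lra.
  have i3 : N%:R / q%:R * q%:R = N%:R :> R by rewrite divfK // gt_eqF //; lra.
  have iq : 0 <= N%:R / q%:R :> R by rewrite divr_ge0 //; lra.
  have i4 : N%:R * H / q%:R <= 2 * (N%:R * H / lam).
    have -> : 2 * (N%:R * H / lam) = N%:R * H * (2 * lam^-1) by ring.
    by rewrite ler_wpM2l //; lra.
  have qlam : q%:R <= lam by rewrite /lam; lra.
  apply: (@le_trans _ _ ((2 * (N%:R / q%:R) + 1) * (2 * (H + 2 * q%:R * h)))).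
    by apply: ler_wpM2r; [nra | lra].
  have -> : (2 * (N%:R / q%:R) + 1) * (2 * (H + 2 * q%:R * h))
    = 4 * (N%:R * H / q%:R) + 8 * (N%:R / q%:R * q%:R) * h + 2 * H + 4 * q%:R * h by ring.
  rewrite i3.
  have : 0 <= h * (N%:R * H / lam) by rewrite mulr_ge0.
  nra.
(* The error dominates: up to length 1 / (2 D) the multiples of al are spaced by D / 2,
   the multiples of q included, since k q al is at distance k D from k a. *)
have Dpos : 0 < D.
  rewrite lt_neqAle D0 andbT eq_sym; apply/eqP => e; move: gt; rewrite e mulr0; lra.
pose L := (Num.truncn (2 * D)^-1).+1.
have iD : 0 < (2 * D)^-1 by rewrite invr_gt0; lra.
have LD : (2 * D)^-1 < L%:R by have /andP[] := truncn_itv (ltW iD).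
have sep d : (0 < d < L)%N -> D / 2 <= dist_int (d%:R * al).
  move=> /andP[d0 dL]; have [m ->] := dist_int_ex (d%:R * al).
  have dD : d%:R * D <= 1 / 2.
    have : d%:R <= (2 * D)^-1.
      have /andP[] := truncn_itv (ltW iD) => hh _; apply: le_trans hh.
      by rewrite ler_nat -ltnS.
    rewrite -[_^-1]div1r ler_pdivlMr; lra.
  have Dq : D / 2 <= (2 * q%:R)^-1.
    rewrite -[leRHS]div1r ler_pdivlMr; nra.
  have [qd|qd] := boolP (q %| d)%N; last first.
    by apply: le_trans Dq _; apply: far => //; apply: coprime_sub_neq0.
  have [e|ne] := eqVneq (d%:Z * a - q%:Z * m) 0; last first.
    by apply: le_trans Dq _; apply: far.
  have /dvdnP[k ek] := qd.
  have km : m = k%:Z * a.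
    apply: (@mulfI _ q%:Z); first by rewrite eqz_nat -lt0n.
    by apply/esym/eqP; rewrite -subr_eq0 -[X in _ == X]e ek PoszM; apply/eqP; ring.
  have k0 : (0 < k)%N by case: k ek {km} => // ek; rewrite ek in d0.
  have -> : d%:R * al - m%:~R = k%:R * (q%:R * al - a%:~R).
    by rewrite km ek natrM intrM -pmulrn; ring.
  rewrite normrM -/D (ger0_norm (ler0n _ _)).
  have : 1 <= k%:R :> R by rewrite ler1n.
  by nra.
have dl0 : 0 < D / 2 by lra.
have DJ : 1 <= 2 * (D / 2) * J%:R.
  have : 1 <= D * (N%:R * H) by nra.
  by have : D * (N%:R * H) <= D * J%:R by [rewrite ler_pM2l|]; lra.
apply: le_trans (progression_peak_sum N rho (ltn0Sn _) dl0 H0 DJ sep) _.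
rewrite -/L -/h.
have i1 : N%:R / L%:R <= 2 * (N%:R * D).
  have L1 : 0 < L%:R :> R by rewrite ltr0n.
  rewrite [leRHS]mulrCA ler_wpM2l // -[leLHS]div1r ler_pdivrMr //.
  by move: LD; rewrite -[_^-1]div1r ltr_pdivrMr; nra.
have i2 : D^-1 <= 2 * (N%:R * H / lam).
  rewrite mulrA ler_pdivlMr; last lra.
  rewrite mulrC ler_pdivrMr //; rewrite /lam; lra.
have iD2 : (D / 2)^-1 = 2 * D^-1 by rewrite invfM invrK mulrC.
rewrite iD2.
have iD0 : 0 <= D^-1 by rewrite invr_ge0.
apply: (@le_trans _ _ ((2 * (N%:R * D) + 1) * (2 * (H + 2 * D^-1 * h)))).
  by apply: ler_wpM2r; [nra | lra].
have -> : (2 * (N%:R * D) + 1) * (2 * (H + 2 * D^-1 * h))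
    = 4 * (N%:R * H * D) + 8 * N%:R * (D * D^-1) * h + 2 * H + 4 * D^-1 * h by ring.
rewrite divff ?gt_eqF //.
have q0' : N%:R * H * D <= lam by rewrite /lam; lra.
nra.
Qed.

(** The weighted form of the estimate of
[\sum_i min (H, 1 / ||i * al + rho||)].  When [a / q] is not a good
approximation at its own level, it is exchanged for a Dirichlet approximation
[b / r] with [r <= 2 * q], whose own quantity [lam'] satisfies [lam' <= 2 * lam]
and [N * H / lam' <= 2 * lam]. *)
Lemma sum_peak_rational (N J : nat) (al rho H lam : R) (a : int) (q : nat) :
  (0 < q)%N -> coprimez a q%:Z -> 0 < H -> N%:R * H <= J%:R ->
  lam = q%:R + N%:R * H * `|q%:R * al - a%:~R| ->
  \sum_(i < N) peak H (i%:R * al + rho)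
    <= 32 * (1 + harm J) * (N%:R * H / lam + N%:R + H + lam).
Proof.
move=> q0 cop H0 NJ {lam}->; set D : R := `|_|; set lam := q%:R + _.
have D0 : 0 <= D := normr_ge0 _.
have q1 : 1 <= q%:R :> R by rewrite ler1n.
have N0 : 0 <= N%:R :> R by [].
have NHD0 : 0 <= N%:R * H * D by rewrite !mulr_ge0 // ltW.
have lam1 : 1 <= lam by rewrite /lam; lra.
have h0 := harm_ge0 J; set h := harm J in h0 *.
have ilam : 0 < lam^-1 by rewrite invr_gt0; lra.
have T1 : 0 <= N%:R * H / lam by rewrite !mulr_ge0 // ltW.
set T := (X in _ * X).
have T0 : 0 <= T by rewrite /T; lra.
have hT : 0 <= h * T by rewrite mulr_ge0.
have [lamNH|lamNH] := leP lam (N%:R * H); last first.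
  apply: (@le_trans _ _ (N%:R * H)).
    have -> : N%:R * H = \sum_(i < N) H by rewrite sumr_const card_ord mulr_natl.
    by apply: ler_sum => i _; apply: peak_le; exact: ltW.
  rewrite (_ : _ * T = 32 * T + 32 * (h * T)); last ring.
  by rewrite {1}/T; lra.
have [qD|qD] := leP (q%:R * D) 1.
  apply: le_trans (sum_peak_close rho q0 cop H0 NJ qD lamNH) _.
  rewrite -/h -/D -/lam -/T; nra.
have [|r [b [/andP[r0 r2q] copb hD']]] := @dirichlet al (2 * q); first by rewrite muln_gt0.
set D' : R := `|_| in hD'.
have D'0 : 0 <= D' := normr_ge0 _.
have r1 : 1 <= r%:R :> R by rewrite ler1n.
have r2 : r%:R <= 2 * q%:R :> R by rewrite -natrM ler_nat.
have qD' : 2 * q%:R * D' <= 1.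
  move: hD'; rewrite natrM -[_^-1]div1r ler_pdivlMr; nra.
have rD' : r%:R * D' <= 1 by nra.
have ne : r%:Z * a - q%:Z * b != 0.
  apply/eqP => e; have : r%:Z * a = b * q%:Z by apply/eqP; rewrite -subr_eq0 [b * _]mulrC e.
  move=> e2.
  have rq : (r %| q)%N.
    rewrite -[(r %| q)%N]/(r%:Z %| q%:Z)%Z -(@Gauss_dvdzr _ b) ?[coprimez r _]coprimez_sym //.
    by rewrite -e2 dvdz_mulr.
  have qr : (q %| r)%N.
    rewrite -[(q %| r)%N]/(q%:Z %| r%:Z)%Z -(@Gauss_dvdzl _ _ a) ?[coprimez q _]coprimez_sym //.
    by rewrite e2 dvdz_mull.
  have erq : r = q by apply/eqP; rewrite eqn_dvd rq qr.
  have eab : a = b.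
    apply: (@mulfI _ q%:Z); first by rewrite eqz_nat -lt0n.
    by rewrite -{1}erq e2 mulrC.
  by move: qD qD'; rewrite /D /D' erq eab; lra.
have rD : 1 <= 2 * r%:R * D.
  have := dist_frac (r%:R * al / r%:R) ne.
  rewrite [r%:R * al]mulrC mulfK ?gt_eqF //; last lra.
  rewrite -/D -/D' => hh; lra.
set lam' := r%:R + N%:R * H * D'.
have NH0 : 0 <= N%:R * H by rewrite mulr_ge0 // ltW.
have D'D : 2 * D' <= D by nra.
have lam'le : lam' <= 2 * lam.
  rewrite /lam' /lam; have : N%:R * H * D' <= N%:R * H * D by rewrite ler_wpM2l //; lra.
  lra.
have lam'1 : 1 <= lam'.
  by rewrite /lam'; have : 0 <= N%:R * H * D' by [rewrite mulr_ge0|]; lra.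
have ilam' : lam'^-1 <= 2 * D.
  rewrite -[leLHS]div1r ler_pdivrMr; last lra.
  apply: (le_trans rD); rewrite /lam'.
  have : 0 <= 2 * D * (N%:R * H * D') by rewrite !mulr_ge0 // ltW.
  nra.
have NHl : N%:R * H / lam' <= 2 * lam.
  apply: (@le_trans _ _ (N%:R * H * (2 * D))); first by rewrite ler_wpM2l.
  by rewrite /lam; lra.
have [lamNH'|lamNH'] := leP lam' (N%:R * H).
  apply: le_trans (sum_peak_close rho r0 copb H0 NJ rD' lamNH') _.
  rewrite -/h -/D' -/lam'.
  have : N%:R * H / lam' + N%:R + H + lam' <= 4 * T by rewrite /T; lra.
  nra.
apply: (@le_trans _ _ (N%:R * H)).
  have -> : N%:R * H = \sum_(i < N) H by rewrite sumr_const card_ord mulr_natl.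
  by apply: ler_sum => i _; apply: peak_le; exact: ltW.
rewrite (_ : _ * T = 32 * T + 32 * (h * T)); last ring.
by rewrite {1}/T; lra.
Qed.

End SpacedPoints.

(** * Power means and Weyl differencing *)

Section PowerMeans.
Variable R : realType.
Implicit Types (a x : R).

(** Convexity: the graph of [x ^ (k + 1)] lies above its tangent at [a]. *)
Lemma tangent_pow (k : nat) a x : 0 <= a -> 0 <= x ->
  k.+1%:R * a ^+ k * x <= x ^+ k.+1 + k%:R * a ^+ k.+1.
Proof.
move=> a0 x0; elim: k => [|k IH]; first by rewrite expr0 mul0r addr0 expr1 !mul1r.
have h2 := ler_wpM2l x0 IH.
have h1 : 0 <= k.+1%:R * a ^+ k * (x - a) ^+ 2.
  by rewrite mulr_ge0 ?sqr_ge0 // mulr_ge0 ?exprn_ge0.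
have e2 : k.+2%:R = k%:R + 2 :> R by rewrite -addn2 natrD.
have e1 : k.+1%:R = k%:R + 1 :> R by rewrite -addn1 natrD.
rewrite (exprS x k.+1) !(exprS a) e1 e2 in h1 h2 *.
have -> : (k%:R + 2) * (a * a ^+ k) * x = x * ((k%:R + 1) * a ^+ k * x)
    + ((k%:R + 1) * (a * (a * a ^+ k)) - x * (k%:R * (a * a ^+ k)))
    - (k%:R + 1) * a ^+ k * (x - a) ^+ 2 by ring.
lra.
Qed.

Lemma jensen_pow (I : finType) (k : nat) (w x : I -> R) :
  (forall i, 0 <= w i) -> (forall i, 0 <= x i) ->
  (\sum_i w i * x i) ^+ k.+1 <= (\sum_i w i) ^+ k * \sum_i w i * x i ^+ k.+1.
Proof.
move=> w0 x0; set W := \sum_i w i.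
have W0 : 0 <= W by apply: sumr_ge0.
have [e|ne] := eqVneq W 0.
  have wz i : w i = 0.
    by apply: (psumr_eq0P _ e).
  rewrite !big1 ?mulr0 ?expr0n //= => i _; rewrite wz mul0r //.
have Wp : 0 < W by rewrite lt_neqAle eq_sym ne.
pose a := (\sum_i w i * x i) / W.
have a0 : 0 <= a by rewrite divr_ge0 // sumr_ge0 // => i _; rewrite mulr_ge0.
have e1 : \sum_i w i * x i = W * a by rewrite /a mulrC divfK.
clearbody a.
have : \sum_i w i * (k.+1%:R * a ^+ k * x i) <= \sum_i w i * (x i ^+ k.+1 + k%:R * a ^+ k.+1).
  by apply: ler_sum => i _; rewrite ler_wpM2l // tangent_pow.
have -> : \sum_i w i * (k.+1%:R * a ^+ k * x i) = k.+1%:R * a ^+ k * (W * a).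
  by rewrite -e1 mulr_sumr; apply: eq_bigr => i _; rewrite mulrCA.
have -> : \sum_i w i * (x i ^+ k.+1 + k%:R * a ^+ k.+1) =
    \sum_i w i * x i ^+ k.+1 + W * (k%:R * a ^+ k.+1).
  by rewrite /W mulr_suml -big_split; apply: eq_bigr => i _; rewrite mulrDr.
rewrite e1 [in X in _ -> X]exprMn !exprS => h.
have -> : W * W ^+ k * (a * a ^+ k) = W ^+ k * (W * (a * a ^+ k)) by ring.
rewrite ler_wpM2l ?exprn_ge0 //.
have ek : k.+1%:R = k%:R + 1 :> R by rewrite -addn1 natrD.
rewrite ek in h; lra.
Qed.

Lemma power_mean (n k : nat) (x : 'I_n -> R) : (forall i, 0 <= x i) ->
  (\sum_i x i) ^+ k.+1 <= n%:R ^+ k * \sum_i x i ^+ k.+1.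
Proof.
move=> x0; have := @jensen_pow 'I_n k (fun=> 1) x (fun=> ler01) x0.
rewrite sumr_const card_ord.
by under eq_bigr do rewrite mul1r; under [in X in _ <= X -> _]eq_bigr do rewrite mul1r.
Qed.

End PowerMeans.

Section WeylDifferencing.
Variable R : realType.
Implicit Types (f : nat -> R) (P Q : {poly R}).

(** Expanding the square gives a sum over pairs; grouping them by the
difference [h] of the two indices counts each [h > 0] twice, by conjugation. *)
Lemma van_der_corput (Y : nat) f :
  cabs (\sum_(x < Y) ee (f x)) ^+ 2
    <= 2 * \sum_(h < Y) cabs (\sum_(x < Y - h) ee (f (x + h)%N - f x)).
Proof.
pose S n := \sum_(x < n) ee (f x).
pose D h n := \sum_(x < n - h) ee (f (x + h)%N - f x).
pose E n := \sum_(h < n) D h n.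
have ES n : E n.+1 = E n + ee (f n) * ((S n.+1)^*)%C.
  rewrite /E.
  have DS (h : 'I_n.+1) : D h n.+1 = D h n + ee (f n - f (n - h)%N).
    rewrite /D subSn -1?ltnS // big_ord_recr /= subnK // -ltnS //.
  under eq_bigr => h _ do rewrite DS.
  rewrite big_split /=; congr (_ + _).
    by rewrite big_ord_recr /= {2}/D subnn big_ord0 addr0.
  rewrite /S rmorph_sum mulr_sumr (reindex_inj rev_ord_inj) /=.
  by apply: eq_bigr => h _; rewrite subSS subKn -1?ltnS // eeD eeN.
have key n : S n * ((S n)^*)%C + n%:R = E n + ((E n)^*)%C.
  elim: n => [|n IH]; first by rewrite /S /E !big_ord0 mul0r addr0 conjc0 addr0.
  have Sn : S n.+1 = S n + ee (f n) by rewrite /S big_ord_recr.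
  rewrite ES rmorphD /= rmorphM /= conjcK Sn rmorphD /= -[n.+1]addn1 natrD.
  have a1 : ee (f n) * ((ee (f n))^*)%C = 1 by rewrite -eeN -eeD subrr ee0.
  have alg : forall s s' a a' e e' m : R[i], a * a' = 1 -> s * s' + m = e + e' ->
     (s + a) * (s' + a') + (m + 1) = e + a * (s' + a') + (e' + a' * (s + a)).
    move=> s s' a a' e e' m h1 h2.
    have -> : (s + a) * (s' + a') + (m + 1) = (s * s' + m) + s * a' + a * (s' + a') + 1 by ring.
    by rewrite h2 -h1; ring.
  exact: alg.
have n0 : (Y%:R : R[i]) = ((Y%:R : R)%:C)%C by rewrite rmorph_nat.
have h1 : cabs (S Y) ^+ 2 <= cabs (S Y * ((S Y)^*)%C + Y%:R).
  rewrite -cabs_sqr n0 -rmorphD /= cabs_real ger0_norm; first by rewrite lerDl.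
  by rewrite addr_ge0 // exprn_ge0 // cabs_ge0.
apply: le_trans h1 _; rewrite key; apply: le_trans (cabs_triangle _ _) _.
have -> : cabs (E Y) + cabs ((E Y)^*)%C = 2 * cabs (E Y) by rewrite cabs_conj; ring.
rewrite ler_pM2l //.
exact: cabs_sum.
Qed.

Definition pdiff (h : R) P := P \Po ('X + h%:P) - P.

Lemma pdiffE (h : R) P x : (pdiff h P).[x] = P.[x + h] - P.[x].
Proof. by rewrite /pdiff hornerD hornerN horner_comp !hornerE. Qed.

Lemma coef_shift (h : R) P k m : (size P <= m)%N ->
  (P \Po ('X + h%:P))`_k = \sum_(i < m) P`_i * (h ^+ (i - k) *+ 'C(i, k)).
Proof.
move=> sP; rewrite comp_polyE (big_ord_widen _ (fun i => P`_i *: ('X + h%:P) ^+ i) sP).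
rewrite coef_sum big_mkcond /=; apply: eq_bigr => i _.
case: ltnP => ip; last by rewrite (nth_default _ ip) mul0r.
rewrite coefZ; congr (_ * _); rewrite addrC exprDn coef_sum.
have [ki|ki] := leqP k i; last first.
  rewrite bin_small // mulr0n big1 // => j _.
  by rewrite -polyC_exp mul_polyC coefMn coefZ coefXn gtn_eqF ?mulr0 ?mul0rn // (leq_ltn_trans _ ki) // -ltnS.
rewrite (bigD1 (Ordinal (ki : (k < i.+1)%N))) //= big1 ?addr0 => [|j jk].
  by rewrite -polyC_exp mul_polyC coefMn coefZ coefXn eqxx mulr1.
rewrite -polyC_exp mul_polyC coefMn coefZ coefXn.
by rewrite eq_sym -(inj_eq val_inj) /= in jk; rewrite (negbTE jk) mulr0 mul0rn.
Qed.

Lemma size_pdiff (h : R) P m : (size P <= m.+2)%N -> (size (pdiff h P) <= m.+1)%N.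
Proof.
move=> sP; apply/leq_sizeP => k mk; rewrite /pdiff coefB (coef_shift _ _ sP) big_ord_recr /=.
rewrite big1 ?add0r => [|i _]; last by rewrite bin_small ?mulr0n ?mulr0 // (leq_trans (ltn_ord i)).
have [->|ne] := eqVneq k m.+1; first by rewrite subnn expr0 binn mulr1 subrr.
rewrite bin_small ?mulr0n ?mulr0 ?sub0r ?nth_default ?oppr0 //.
  by rewrite (leq_trans sP) // ltn_neqAle eq_sym ne.
by rewrite ltn_neqAle eq_sym ne.
Qed.

Lemma coef_pdiff (h : R) P m : (size P <= m.+2)%N ->
  (pdiff h P)`_m = P`_m.+1 * (h *+ m.+1).
Proof.
move=> sP; rewrite /pdiff coefB (coef_shift _ _ sP) !big_ord_recr /=.
rewrite big1 ?add0r => [|i _]; last by rewrite bin_small ?mulr0n ?mulr0.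
by rewrite subnn expr0 binn mulr1 subSn // subnn expr1 binSn [P`_m + _]addrC addrK.
Qed.

(** Differencing a polynomial of degree [d + j] by [h] multiplies its leading
coefficient by [(d + j) * h].  If [T n] bounds the sums of degree [d] with
leading coefficient [al * n], this is what [j] differencing steps leave to be
summed, starting from the leading coefficient [al * c]. *)
Fixpoint iter_diff_sum (d Y j : nat) (T : nat -> R) (c : nat) : R :=
  if j is j'.+1 then \sum_(h < Y) iter_diff_sum d Y j' T (c * (d + j) * h)
  else T c.

(** Induction on the number of steps: one application of [van_der_corput],
then the power mean inequality to raise the sum over [h] to the power
[2 ^ j]. *)
Lemma weyl_differencing (d Y : nat) (T : nat -> R) (al : R) :
  (forall n Q Z, (Z <= Y)%N -> (size Q <= d.+1)%N -> Q`_d = al * n%:R ->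
     cabs (\sum_(x < Z) ee Q.[x%:R]) <= T n) ->
  forall j c P Z, (Z <= Y)%N -> (size P <= (d + j).+1)%N -> P`_(d + j) = al * c%:R ->
  cabs (\sum_(x < Z) ee P.[x%:R]) ^+ (2 ^ j)
    <= 2 ^+ (2 ^ j) * Y%:R ^+ (2 ^ j - j - 1) * iter_diff_sum d Y j T c.
Proof.
move=> hT; elim=> [|j IH] c P Z ZY sP cP.
  rewrite expn0 !expr1 expr0 mulr1 /=; rewrite addn0 in sP cP.
  have := hT _ _ _ ZY sP cP; have := cabs_ge0 (\sum_(x < Z) ee P.[x%:R]); lra.
rewrite addnS in sP cP.
have vdc := @van_der_corput Z (fun x => P.[x%:R]).
pose U (h : 'I_Y) := cabs (\sum_(x < Z - h) ee (P.[(x + h)%:R] - P.[x%:R])).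
have U0 h : 0 <= U h by exact: cabs_ge0.
have v2 : cabs (\sum_(x < Z) ee P.[x%:R]) ^+ 2 <= 2 * \sum_(h < Y) U h.
  apply: le_trans vdc _; rewrite ler_pM2l //.
  rewrite (big_ord_widen Y (fun h => cabs (\sum_(x < Z - h) ee (P.[(x + h)%:R] - P.[x%:R])))) //.
  by rewrite [leLHS]big_mkcond ler_sum // => h _; case: ifP => // _; exact: U0.
have Uj h : U h ^+ (2 ^ j) <= 2 ^+ (2 ^ j) * Y%:R ^+ (2 ^ j - j - 1)
    * iter_diff_sum d Y j T (c * (d + j.+1) * h).
  have -> : U h = cabs (\sum_(x < Z - h) ee (pdiff h%:R P).[x%:R]).
    by congr cabs; apply: eq_bigr => x _; rewrite pdiffE -natrD.
  apply: IH.
  - exact: leq_trans (leq_subr _ _) ZY.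
  - exact: size_pdiff.
  - by rewrite coef_pdiff // cP -mulr_natr !natrM addnS; ring.
have pj : (0 < 2 ^ j)%N by rewrite expn_gt0.
rewrite expnS exprM.
apply: (@le_trans _ _ ((2 * \sum_(h < Y) U h) ^+ (2 ^ j))).
  by rewrite lerXn2r ?nnegrE ?exprn_ge0 ?cabs_ge0 ?mulr_ge0 ?sumr_ge0.
rewrite exprMn mulnC muln2 -addnn exprD -!mulrA ler_wpM2l ?exprn_ge0 //.
have := power_mean (2 ^ j).-1 U0; rewrite prednK // => h1.
apply: le_trans h1 _.
have : \sum_i U i ^+ (2 ^ j) <= 2 ^+ (2 ^ j) * Y%:R ^+ (2 ^ j - j - 1) *
     \sum_(h < Y) iter_diff_sum d Y j T (c * (d + j.+1) * h).
  by rewrite mulr_sumr; apply: ler_sum => h _; exact: Uj.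
move=> /(ler_wpM2l (exprn_ge0 (2 ^ j).-1 (ler0n R Y))) h2.
apply: le_trans h2 _; apply: le_of_eq.
have jj : (j < 2 ^ j)%N by exact: ltn_expl.
have -> : (2 ^ j + 2 ^ j - j.+1 - 1 = (2 ^ j).-1 + (2 ^ j - j - 1))%N.
  by move: (2 ^ j)%N pj jj => m m0 jm; lia.
by rewrite exprD /=; ring.
Qed.

End WeylDifferencing.

(** * Counting solutions of the cubic system by orthogonality *)

Section Orthogonality.
Variable R : realType.

Lemma ee_neq1 (t : R) : dist_int t != 0 -> ee t != 1.
Proof.
apply: contra_neq => e; have := cabs_ee_sub1 t; rewrite e subrr cabs0.
by have := dist_int_ge0 t; lra.
Qed.

Lemma orthogonality (M : nat) (s : int) : (`|s| < M)%N ->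
  \sum_(j < M) ee (j%:R * (s%:~R / M%:R) : R) = if s == 0 then M%:R else 0.
Proof.
move=> sM; case: eqP => [->|/eqP s0].
  under eq_bigr do rewrite mul0r mulr0 ee0.
  by rewrite sumr_const card_ord.
have M0 : 0 < M%:R :> R by rewrite ltr0n (leq_trans _ sM).
set t : R := _ / _.
have nt : dist_int t != 0.
  have [m ->] := dist_int_ex t; rewrite normr_eq0 subr_eq0; apply/eqP => e.
  have : s%:~R = m%:~R * M%:R :> R by rewrite -e /t divfK // gt_eqF.
  rewrite pmulrn -intrM => /eqP; rewrite eqr_int => /eqP es.
  move: sM; rewrite es abszM absz_nat -[X in (_ < X)%N]mul1n ltn_mul2r => /andP[_].
  rewrite ltnS leqn0 absz_eq0 => /eqP m0.
  by rewrite es m0 mul0r eqxx in s0.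
have h : (ee t - 1) * (\sum_(j < M) ee (j%:R * t)) = 0.
  under eq_bigr do rewrite mulr_natl ee_mulrn.
  rewrite -subrX1 -ee_mulrn -mulr_natl /t mulrCA divff ?gt_eqF // mulr1 ee_int subrr //.
by move/eqP: h; rewrite mulf_eq0 subr_eq0 (negbTE (ee_neq1 nt)) /= => /eqP.
Qed.

Lemma orthogonality_nat (M a b : nat) : (a < M)%N -> (b < M)%N ->
  \sum_(j < M) ee (j%:R * ((a%:R - b%:R) / M%:R) : R) = if a == b then M%:R else 0.
Proof.
move=> aM bM; have := @orthogonality M (a%:Z - b%:Z); rewrite intrD mulrNz => ->.
  by rewrite subr_eq0 eqz_nat.
by lia.
Qed.

End Orthogonality.

Section SolutionCounts.
Variable N : nat.
Implicit Types (f g : {ffun 'I_6 -> 'I_N}) (A B : 'I_6 -> {set 'I_N}).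

Definition power_sum (k : nat) f : nat := \sum_i (f i : nat) ^ k.

Definition vinogradov_system f g : bool :=
  [&& power_sum 1 f == power_sum 1 g, power_sum 2 f == power_sum 2 g & power_sum 3 f == power_sum 3 g].

Definition solution_set A B : {set {ffun 'I_6 -> 'I_N} * {ffun 'I_6 -> 'I_N}} :=
  [set u | [&& u.1 \in family (fun i => A i), u.2 \in family (fun i => B i) & vinogradov_system u.1 u.2]].

Definition solution_count A B : nat := #|solution_set A B|.

Lemma power_sum_lt k f : (power_sum k f < 6 * N ^ k + 1)%N.
Proof.
rewrite addn1 ltnS /power_sum.
have -> : (6 * N ^ k = \sum_(i < 6) N ^ k)%N by rewrite sum_nat_const card_ord.
by apply: leq_sum => i _; case: k => // k; rewrite leq_exp2r // ltnW.
Qed.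

Variables (R : realType) (M : nat).

Definition freq := ('I_M * 'I_M * 'I_M)%type.

Definition cubic_phase (w : freq) (x : nat) : R[i] :=
  ee (w.1.1%:R * (x%:R / M%:R)) * ee (w.1.2%:R * ((x ^ 2)%:R / M%:R))
  * ee (w.2%:R * ((x ^ 3)%:R / M%:R)).

Definition csum (w : freq) (S : {set 'I_N}) : R[i] := \sum_(x in S) cubic_phase w x.

Lemma prod_cubic_phase w f : \prod_i cubic_phase w (f i) =
  ee (w.1.1%:R * ((power_sum 1 f)%:R / M%:R)) * ee (w.1.2%:R * ((power_sum 2 f)%:R / M%:R))
  * ee (w.2%:R * ((power_sum 3 f)%:R / M%:R)).
Proof.
rewrite /cubic_phase !big_split /= -!ee_sum.
have h k (c : R) : \sum_i c * ((f i ^ k)%:R / M%:R) = c * ((power_sum k f)%:R / M%:R).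
  by rewrite -mulr_sumr -mulr_suml -natr_sum.
by rewrite -!h; congr (ee _ * _ * _); apply: eq_bigr => i _; rewrite expn1.
Qed.

Hypothesis MN : (6 * N ^ 3 < M)%N.

Lemma sum_cubic_phase f g : \sum_(w : freq) (\prod_i cubic_phase w (f i)) * (\prod_i ((cubic_phase w (g i))^*)%C) =
  if vinogradov_system f g then (M ^ 3)%:R else 0.
Proof.
have small k h : (0 < k <= 3)%N -> (power_sum k h < M)%N.
  move=> /andP[k0 k3]; case: (posnP N) => [N0|Np]; last first.
    apply: leq_trans (power_sum_lt k h) _.
    by apply: leq_trans MN; rewrite addn1 ltnS leq_mul2l /= leq_pexp2l.
  by have := h ord0; rewrite N0 => -[].
have h1 w : (\prod_i cubic_phase w (f i)) * (\prod_i ((cubic_phase w (g i))^*)%C) =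
   ee (w.1.1%:R * (((power_sum 1 f)%:R - (power_sum 1 g)%:R) / M%:R))
   * ee (w.1.2%:R * (((power_sum 2 f)%:R - (power_sum 2 g)%:R) / M%:R))
   * ee (w.2%:R * (((power_sum 3 f)%:R - (power_sum 3 g)%:R) / M%:R)).
  rewrite -conj_prod !prod_cubic_phase !conjM -!eeN -!eeD; congr ee.
  by rewrite !mulrBl !mulrBr; ring.
under eq_bigr do rewrite h1.
pose F k (j : 'I_M) : R[i] := ee (j%:R * (((power_sum k f)%:R - (power_sum k g)%:R) / M%:R)).
rewrite -(pair_bigA _ (fun w j => F 1%N w.1 * F 2%N w.2 * F 3%N j)) /=.
rewrite -(pair_bigA _ (fun w1 w2 => \sum_j F 1%N w1 * F 2%N w2 * F 3%N j)) /=.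
have -> : \sum_i \sum_j \sum_k F 1%N i * F 2%N j * F 3%N k =
   (\sum_i F 1%N i) * (\sum_i F 2%N i) * (\sum_i F 3%N i).
  rewrite !big_distrl /=; apply: eq_bigr => i _.
  rewrite [F 1%N i * _]big_distrr big_distrl /=; apply: eq_bigr => j _.
  by rewrite big_distrr.
rewrite /F !orthogonality_nat ?small // /vinogradov_system.
by do 3![case: (_ == _)]; rewrite /= ?mulr0 ?mul0r // !expnS expn0 muln1 !natrM mulrA.
Qed.

Lemma sum_csum A B :
  \sum_(w : freq) (\prod_i csum w (A i)) * (\prod_i ((csum w (B i))^*)%C) =
  (M ^ 3 * solution_count A B)%:R.
Proof.
have h w : (\prod_i csum w (A i)) * (\prod_i ((csum w (B i))^*)%C) =
  \sum_(f in family (fun i => A i)) \sum_(g in family (fun i => B i))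
    (\prod_i cubic_phase w (f i)) * (\prod_i ((cubic_phase w (g i))^*)%C).
  have -> : \prod_i ((csum w (B i))^*)%C = \prod_i \sum_(x in B i) ((cubic_phase w x)^*)%C.
    by apply: eq_bigr => i _; rewrite /csum conj_sum.
  rewrite /csum !bigA_distr_big_dep big_distrl /=; apply: eq_bigr => f _.
  by rewrite big_distrr.
under eq_bigr do rewrite h.
rewrite exchange_big /=; under eq_bigr => f _.
  rewrite exchange_big /=; under eq_bigr do rewrite sum_cubic_phase; over.
rewrite pair_big_dep /= -big_mkcondr /= sumr_const natrM mulr_natr; congr (_ *+ _).
rewrite /solution_count; apply: eq_card => u.
by rewrite [RHS]inE [LHS]unfold_in /= andbA.
Qed.

End SolutionCounts.

(** * Holder inequalities for mixed counts *)

Section Holder.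
Variable R : realType.

(** The tangent inequality at [b], divided by [b ^ m]. *)
Lemma weighted_amgm m (a b c : R) : 0 <= a -> 0 <= b -> 0 <= c ->
  c ^+ m.+1 <= a * b ^+ m -> m.+1%:R * c <= a + m%:R * b.
Proof.
move=> a0 b0 c0; case: m => [|m h]; first by rewrite expr0 expr1; lra.
have [be|bn] := eqVneq b 0.
  move: h; rewrite be expr0n mulr0 => h.
  have /eqP -> : c == 0 by have := expf_eq0 c m.+2; rewrite eq_le h exprn_ge0.
  by rewrite !mulr0 addr0.
have bm : 0 < b ^+ m.+1 by rewrite exprn_gt0 // lt_neqAle eq_sym bn.
rewrite -(ler_pM2r bm) mulrAC; apply: le_trans (tangent_pow _ b0 c0) _.
by rewrite mulrDl lerD // exprS mulrA.
Qed.

Lemma amgm_four (x y z t : R) : 4 * (x * y * z * t) <= x ^+ 4 + y ^+ 4 + z ^+ 4 + t ^+ 4.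
Proof.
have h (u v : R) : 2 * (u * v) <= u ^+ 2 + v ^+ 2.
  by have := sqr_ge0 (u - v); rewrite sqrrB; lra.
have := h (x * y) (z * t); have := h (x ^+ 2) (y ^+ 2); have := h (z ^+ 2) (t ^+ 2).
rewrite -!exprM !exprMn mulrA; lra.
Qed.

Lemma weighted_holder (I : finType) m (u v z : I -> R) (U V W : R) :
  (forall i, 0 <= u i) -> (forall i, 0 <= v i) -> (forall i, 0 <= z i) ->
  (forall i, z i ^+ m.+1 <= u i * v i ^+ m) -> 0 < U -> 0 < V -> 0 < W ->
  \sum_i u i <= U -> \sum_i v i <= V -> U * V ^+ m <= W ^+ m.+1 -> \sum_i z i <= W.
Proof.
move=> u0 v0 z0 zuv U0 V0 W0 hu hv hW.
have pt i : m.+1%:R * (z i / W) <= u i / U + m%:R * (v i / V).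
  apply: weighted_amgm; rewrite ?divr_ge0 ?u0 ?v0 ?z0 //; try exact: ltW.
  rewrite !expr_div_n mulrACA -invfM; apply: ler_pM; rewrite ?invr_ge0 ?exprn_ge0 ?(ltW W0) //.
  by rewrite lef_pV2 ?posrE ?mulr_gt0 ?exprn_gt0.
have : \sum_i m.+1%:R * (z i / W) <= \sum_i (u i / U + m%:R * (v i / V)) by apply: ler_sum.
rewrite big_split /= -!mulr_sumr -!mulr_suml.
have h1 : (\sum_i u i) / U <= 1 by rewrite ler_pdivrMr // mul1r.
have h2 : m%:R * ((\sum_i v i) / V) <= m%:R * 1.
  by rewrite ler_wpM2l // ler_pdivrMr // mul1r.
move=> h3; have : m.+1%:R * ((\sum_i z i) / W) <= m.+1%:R * 1.
  by apply: le_trans h3 _; rewrite -natr1; lra.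
by rewrite ler_pM2l // ler_pdivrMr // mul1r.
Qed.

End Holder.

Section MixedCounts.
Variables (N : nat) (R : realType) (M : nat).
Hypothesis MN : (6 * N ^ 3 < M)%N.
Implicit Types (X Y T : {set 'I_N}).

(** The first two slots are singled out because the congruencing argument
conditions at most two variables on each side of the system. *)
Definition slots X1 X2 T (i : 'I_6) : {set 'I_N} :=
  if i == 0 :> nat then X1 else if i == 1 :> nat then X2 else T.

(** With [Y1 = X1] and [Y2 = X2] this is the twelfth moment in which the sums
over [X1] and [X2] have exponent 2 and the sum over [T] exponent 8. *)
Definition mixed X1 X2 Y1 Y2 T : nat := solution_count (slots X1 X2 T) (slots Y1 Y2 T).

Definition cnorm (w : freq M) X : R := cabs (csum R w X).

Lemma cnorm_ge0 w X : 0 <= cnorm w X.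
Proof. exact: cabs_ge0. Qed.

Lemma prod_slots (F : {set 'I_N} -> R[i]) X1 X2 T :
  \prod_i F (slots X1 X2 T i) = F X1 * F X2 * F T ^+ 4.
Proof. by rewrite !big_ord_recl big_ord0 /slots /= !exprS expr0 !mulrA. Qed.

Lemma cabs_slots (x y z : R[i]) : cabs (x * y * z ^+ 4) = cabs x * cabs y * cabs z ^+ 4.
Proof. by rewrite (cabsM (x * y)) (cabsM x) cabsX. Qed.

Lemma mixed_le_sum X1 X2 Y1 Y2 T :
  (M%:R ^+ 3 * (mixed X1 X2 Y1 Y2 T)%:R : R) <=
    \sum_w cnorm w X1 * cnorm w X2 * cnorm w Y1 * cnorm w Y2 * cnorm w T ^+ 8.
Proof.
have := sum_csum R MN (slots X1 X2 T) (slots Y1 Y2 T).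
move=> /(congr1 cabs); rewrite -/(mixed _ _ _ _ _).
have -> : ((M ^ 3 * mixed X1 X2 Y1 Y2 T)%:R : R[i]) =
    ((M%:R ^+ 3 * (mixed X1 X2 Y1 Y2 T)%:R : R)%:C)%C.
  by rewrite natrM natrX rmorphM rmorphXn !rmorph_nat.
rewrite cabs_real ger0_norm ?mulr_ge0 ?exprn_ge0 // => <-.
apply: le_trans (cabs_sum _ _ _) _; apply: ler_sum => w _.
rewrite cabsM (prod_slots (csum R w)) (prod_slots (fun S => ((csum R w S)^*)%C)).
rewrite !cabs_slots !cabs_conj; apply: le_of_eq.
by rewrite -[8%N]/(4 + 4)%N exprD /cnorm; ring.
Qed.

(** The normalisation makes counts comparable through inequalities between
moments, as used in the lemmas below. *)
Lemma mixed_sum X1 X2 T :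
  (M%:R ^+ 3 * (mixed X1 X2 X1 X2 T)%:R : R) =
    \sum_w cnorm w X1 ^+ 2 * cnorm w X2 ^+ 2 * cnorm w T ^+ 8.
Proof.
apply: (@complexI R); rewrite rmorphM rmorphXn !rmorph_nat -natrX -natrM /=.
rewrite -(sum_csum R MN (slots X1 X2 T) (slots X1 X2 T)) rmorph_sum; apply: eq_bigr => w _.
rewrite (prod_slots (csum R w)) (prod_slots (fun S => ((csum R w S)^*)%C)).
have eM (a b : R) : ((a * b)%:C)%C = (a%:C)%C * (b%:C)%C := rmorphM (real_complex R) a b.
have eX (a : R) n : ((a ^+ n)%:C)%C = (a%:C)%C ^+ n := rmorphXn (real_complex R) n a.
rewrite -[RHS]/((cnorm w X1 ^+ 2 * cnorm w X2 ^+ 2 * cnorm w T ^+ 8)%:C)%C.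
rewrite -[8%N]/(2 * 4)%N exprM eM eM (eX (cnorm w T ^+ 2)) /cnorm !cabs_sqr.
by rewrite exprMn; ring.
Qed.

End MixedCounts.

Section MixedHolder.
Variables (N : nat) (R : realType).
Implicit Types (X Y T : {set 'I_N}).
Let M := (6 * N ^ 3).+1.
Let MN : (6 * N ^ 3 < M)%N := ltnSn _.

Let M0 : 0 < M%:R ^+ 3 :> R.
Proof. by rewrite exprn_gt0. Qed.

(** Reduces the four conditioned variables to a common class, by the
arithmetic-geometric mean inequality applied frequency by frequency. *)
Lemma mixed_amgm X1 X2 Y1 Y2 T (W : R) :
  (mixed X1 X1 X1 X1 T)%:R <= W -> (mixed X2 X2 X2 X2 T)%:R <= W ->
  (mixed Y1 Y1 Y1 Y1 T)%:R <= W -> (mixed Y2 Y2 Y2 Y2 T)%:R <= W ->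
  (mixed X1 X2 Y1 Y2 T)%:R <= W.
Proof.
rewrite -(ler_pM2l M0) => h1; rewrite -(ler_pM2l M0) => h2.
rewrite -(ler_pM2l M0) => h3; rewrite -(ler_pM2l M0) => h4; rewrite -(ler_pM2l M0).
apply: le_trans (mixed_le_sum R MN _ _ _ _ _) _.
rewrite !(mixed_sum R MN) in h1 h2 h3 h4.
suff : 4 * \sum_(w : freq M) cnorm R w X1 * cnorm R w X2 * cnorm R w Y1 * cnorm R w Y2 * cnorm R w T ^+ 8 <=
  \sum_(w : freq M) cnorm R w X1 ^+ 2 * cnorm R w X1 ^+ 2 * cnorm R w T ^+ 8 +
  \sum_(w : freq M) cnorm R w X2 ^+ 2 * cnorm R w X2 ^+ 2 * cnorm R w T ^+ 8 +
  \sum_(w : freq M) cnorm R w Y1 ^+ 2 * cnorm R w Y1 ^+ 2 * cnorm R w T ^+ 8 +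
  \sum_(w : freq M) cnorm R w Y2 ^+ 2 * cnorm R w Y2 ^+ 2 * cnorm R w T ^+ 8 by lra.
rewrite -!big_split /= mulr_sumr; apply: ler_sum => w _.
rewrite -!mulrDl mulrA ler_wpM2r ?exprn_ge0 ?cnorm_ge0 // -!expr2 -!exprM.
exact: amgm_four.
Qed.

Let scale (U V W : R) k : U * V ^+ k <= W ^+ k.+1 ->
  (M%:R ^+ 3 * U) * (M%:R ^+ 3 * V) ^+ k <= (M%:R ^+ 3 * W) ^+ k.+1.
Proof.
move=> h; move: (M%:R ^+ 3) M0 => m m0.
have -> : m * U * (m * V) ^+ k = m ^+ k.+1 * (U * V ^+ k) by rewrite exprMn exprS; ring.
by rewrite exprMn ler_wpM2l // exprn_ge0 // ltW.
Qed.

(** The weights are [1 / (m + 1)] and [m / (m + 1)]. *)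
Lemma mixed_holder m X1 X2 T Y1 Y2 (S Z1 Z2 V : {set 'I_N}) (A B C : R) : 0 < A -> 0 < B -> 0 < C ->
  (forall w : freq M,
    (cnorm R w Z1 ^+ 2 * cnorm R w Z2 ^+ 2 * cnorm R w V ^+ 8) ^+ m.+1 =
    cnorm R w X1 ^+ 2 * cnorm R w X2 ^+ 2 * cnorm R w T ^+ 8 *
    (cnorm R w Y1 ^+ 2 * cnorm R w Y2 ^+ 2 * cnorm R w S ^+ 8) ^+ m) ->
  (mixed X1 X2 X1 X2 T)%:R <= A -> (mixed Y1 Y2 Y1 Y2 S)%:R <= B ->
  A * B ^+ m <= C ^+ m.+1 -> (mixed Z1 Z2 Z1 Z2 V)%:R <= C.
Proof.
move=> A0 B0 C0 e; rewrite -(ler_pM2l M0) => h1; rewrite -(ler_pM2l M0) => h2 /scale h3.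
rewrite -(ler_pM2l M0); rewrite !(mixed_sum R MN) in h1 h2 *.
apply: (weighted_holder _ _ _ _ _ _ _ h1 h2 h3); rewrite ?mulr_gt0 // => w;
  rewrite ?mulr_ge0 ?exprn_ge0 ?cnorm_ge0 //.
by apply: le_of_eq; exact: e.
Qed.

(** Holder: [|f|^4 |g|^8] is the product of the powers [1 / 3] of
[|g|^4 |f|^8] and [2 / 3] of [|f|^2 |g|^10]. *)
Lemma mixed_holder_swap X Y (U V W : R) : 0 < U -> 0 < V -> 0 < W ->
  (mixed Y Y Y Y X)%:R <= U -> (mixed X Y X Y Y)%:R <= V -> U * V ^+ 2 <= W ^+ 3 ->
  (mixed X X X X Y)%:R <= W.
Proof. by move=> U0 V0 W0; apply: mixed_holder => // w; ring. Qed.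

(** Holder: [|f|^4 |g|^8] separates into twelfth powers. *)
Lemma mixed_holder_pure X Y (U V W : R) : 0 < U -> 0 < V -> 0 < W ->
  (mixed X X X X X)%:R <= U -> (mixed Y Y Y Y Y)%:R <= V -> U * V ^+ 2 <= W ^+ 3 ->
  (mixed X X X X Y)%:R <= W.
Proof. by move=> U0 V0 W0; apply: mixed_holder => // w; ring. Qed.

(** Holder: [|f|^2 |g|^10] is the product of the powers [1 / 4] of
[|g|^4 |f|^8] and [3 / 4] of [|g|^12]. *)
Lemma mixed_holder_two X Y (U V W : R) : 0 < U -> 0 < V -> 0 < W ->
  (mixed Y Y Y Y X)%:R <= U -> (mixed Y Y Y Y Y)%:R <= V -> U * V ^+ 3 <= W ^+ 4 ->
  (mixed X Y X Y Y)%:R <= W.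
Proof. by move=> U0 V0 W0; apply: mixed_holder => // w; ring. Qed.

End MixedHolder.

(** * Congruences satisfied by solutions *)

Section Congruences.
Variable p : nat.
Hypotheses (p_pr : prime p) (p6 : coprime p 6).
Implicit Types (u x y m : int).

Lemma Fp_intr_eq0 m : ((m%:~R : 'F_p) == 0) = (p %| m)%Z.
Proof.
rewrite dvdzE absz_nat; have nz (n : nat) : ((n%:R : 'F_p) == 0) = (p %| n)%N.
  by rewrite -(dvdn_pcharf (pchar_Fp p_pr)).
case: m => n; first by rewrite -pmulrn nz.
by rewrite NegzE mulrNz oppr_eq0 -pmulrn nz abszN absz_nat.
Qed.

Lemma coprime_exp_unit m e : ~~ (p %| m)%Z -> coprimez (p ^ e)%N m.
Proof.
move=> h; rewrite coprimezE absz_nat.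
by rewrite coprimeXl // prime_coprime // -dvdzE.
Qed.

Lemma Fp_6 : (2 : 'F_p) != 0 /\ (3 : 'F_p) != 0.
Proof.
have h n : (n %| 6)%N -> (1 < n)%N -> (n%:R : 'F_p) != 0.
  move=> n6 n1; rewrite pmulrn Fp_intr_eq0 dvdzE !absz_nat; apply/negP => pn.
  have := p6; rewrite /coprime => /eqP g.
  have : (p %| gcdn p 6)%N by rewrite dvdn_gcd dvdnn (dvdn_trans pn).
  by rewrite g dvdn1 => /eqP p1; have := prime_gt1 p_pr; rewrite p1.
by split; apply: h.
Qed.

(** Hensel: modulo [p] the cofactor [x ^ 2 + x * y + y ^ 2] is [3 * u ^ 2], a
unit. *)
Lemma cube_injective e u x y : ~~ (p %| u)%Z -> (p %| x - u)%Z -> (p %| y - u)%Z ->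
  ((p ^ e)%N %| x ^+ 3 - y ^+ 3)%Z -> ((p ^ e)%N %| x - y)%Z.
Proof.
move=> pu px py; have -> : x ^+ 3 - y ^+ 3 = (x - y) * (x ^+ 2 + x * y + y ^+ 2) by ring.
rewrite Gauss_dvdzl //; apply: coprime_exp_unit.
move: pu px py; rewrite -!Fp_intr_eq0 !intrD !mulrNz !subr_eq0 => u0 /eqP hx /eqP hy.
rewrite !rmorphXn !rmorphM /= hx hy; have [_ n3] := Fp_6.
have -> : u%:~R ^+ 2 + u%:~R * u%:~R + u%:~R ^+ 2 = 3 * u%:~R ^+ 2 :> 'F_p by ring.
by rewrite mulf_neq0 // expf_neq0.
Qed.

(** Hensel: modulo [p] the cofactor [x + y] is [2 * u], a unit. *)
Lemma square_injective e u x y : ~~ (p %| u)%Z -> (p %| x - u)%Z -> (p %| y - u)%Z ->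
  ((p ^ e)%N %| x ^+ 2 - y ^+ 2)%Z -> ((p ^ e)%N %| x - y)%Z.
Proof.
move=> pu px py; have -> : x ^+ 2 - y ^+ 2 = (x - y) * (x + y) by ring.
rewrite Gauss_dvdzl //; apply: coprime_exp_unit.
move: pu px py; rewrite -!Fp_intr_eq0 !intrD !mulrNz !subr_eq0 => u0 /eqP hx /eqP hy.
rewrite hx hy; have [n2 _] := Fp_6.
have -> : u%:~R + u%:~R = 2 * u%:~R :> 'F_p by ring.
by rewrite mulf_neq0.
Qed.

(** Eliminating [u3] from the two equations leaves a multiple of
[(u4 - u2) * (u1 - u4)]: its cofactor [v] is congruent to [12 * u ^ 3]
modulo [p], hence a unit.  Over a field this is the fact that two pairs with
equal sums of squares and of cubes coincide, unless degenerate. *)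
Lemma two_pairs_congruence e u (u1 u2 u3 u4 : int) :
  ~~ (p %| u)%Z ->
  (p %| u1 - u)%Z -> (p %| u2 - u)%Z -> (p %| u3 - u)%Z -> (p %| u4 - u)%Z ->
  ((p ^ e)%N %| u1 ^+ 2 + u2 ^+ 2 - u3 ^+ 2 - u4 ^+ 2)%Z ->
  ((p ^ e)%N %| u1 ^+ 3 + u2 ^+ 3 - u3 ^+ 3 - u4 ^+ 3)%Z ->
  ((p ^ e)%N %| (u4 - u2) * (u1 - u4))%Z.
Proof.
move=> pu p1 p2 p3 p4 h2 h3.
pose q := u4 ^+ 2 + u4 * u2 + u2 ^+ 2.
pose e1 := (u4 + u2) * (2 * u4 + u2 + (u1 - u4) + (u3 - u2)) - q.
pose e2 := (u4 + u2) * (2 * u2 + u4 + (u3 - u2)) - q.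
pose v := e1 * (u2 + u3) + e2 * (u1 + u4).
have : ((p ^ e)%N %| (u4 - u2) * (u1 - u4) * v)%Z.
  have -> : (u4 - u2) * (u1 - u4) * v =
    (u2 + u3) * (u1 + u3) * (u1 ^+ 3 + u2 ^+ 3 - u3 ^+ 3 - u4 ^+ 3) +
    ((u4 - u2) * e2 - (u2 + u3) * (u1 ^+ 2 + u1 * u3 + u3 ^+ 2)) *
      (u1 ^+ 2 + u2 ^+ 2 - u3 ^+ 2 - u4 ^+ 2) by rewrite /v /e1 /e2 /q; ring.
  by rewrite rpredD // dvdz_mull.
rewrite Gauss_dvdzl //; apply: coprime_exp_unit.
move: pu p1 p2 p3 p4.
rewrite -!Fp_intr_eq0 !intrD !mulrNz !subr_eq0 => u0 /eqP h1 /eqP {}h2 /eqP {}h3 /eqP h4.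
have -> : (e1 * (u2 + u3))%:~R + (e2 * (u1 + u4))%:~R = 2 * 2 * 3 * u%:~R ^+ 3 :> 'F_p.
  rewrite /e1 /e2 /q !(rmorphD, rmorphM, rmorphN, rmorphXn) /= h1 h2 h3 h4; ring.
by have [n2 n3] := Fp_6; rewrite !mulf_neq0 // expf_neq0.
Qed.

Lemma dvdz_prod_split c (B D : int) : ((p ^ c)%N %| B * D)%Z ->
  exists2 i : 'I_c.+1, ((p ^ i)%N %| B)%Z & ((p ^ (c - i))%N %| D)%Z.
Proof.
clear p6; rewrite !dvdzE abszM absz_nat => h.
case: (posnP `|B|%N) => [B0|Bp].
  by exists ord_max; rewrite dvdzE absz_nat ?B0 ?dvdn0 //= subnn expn0 dvd1n.
case: (posnP `|D|%N) => [D0|Dp].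
  by exists ord0; rewrite dvdzE absz_nat ?D0 ?dvdn0 //= expn0 dvd1n.
have im : (minn c (logn p `|B|) < c.+1)%N by rewrite ltnS geq_minl.
exists (Ordinal im); rewrite dvdzE absz_nat /= pfactor_dvdn //; first exact: geq_minr.
move: h; rewrite pfactor_dvdn ?muln_gt0 ?Bp // lognM // => h.
by move: (logn p `|B|) (logn p `|D|) h => s t; lia.
Qed.

End Congruences.

Section ResidueClasses.
Variables (p N : nat).
Hypotheses (p_pr : prime p) (p6 : coprime p 6).

Definition cl (a xi : nat) : {set 'I_N} := [set x : 'I_N | x == xi %[mod p ^ a]].

Let pgt0 a : (0 < p ^ a)%N.
Proof. by rewrite expn_gt0 prime_gt0. Qed.

Definition digit (a c : nat) (x : 'I_N) : 'I_(p ^ c) :=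
  Ordinal (ltn_pmod (x %/ p ^ a) (pgt0 c)).

Lemma cl_digit a c xi (x : 'I_N) : (xi < p ^ a)%N -> x \in cl a xi ->
  x \in cl (a + c) (xi + p ^ a * digit a c x).
Proof.
move=> xia; rewrite !inE (modn_small xia) => /eqP xm.
have e : (x = xi + p ^ a * digit a c x + (x %/ p ^ a %/ p ^ c) * p ^ (a + c) :> nat)%N.
  rewrite /= {1}(divn_eq x (p ^ a)) xm {1}(divn_eq (x %/ p ^ a) (p ^ c)) expnD; ring.
by rewrite {1}e addnC modnMDl.
Qed.

Lemma cl_int a xi (x : 'I_N) : x \in cl a xi -> ((p ^ a)%N %| x%:Z - xi%:Z)%Z.
Proof. by rewrite inE -eqz_mod_dvd => /eqP h; rewrite !modz_nat h. Qed.

Lemma card_partition_le (U V : finType) (A : {set U}) (h : U -> V) (B : V -> {set U}) :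
  (forall u, u \in A -> u \in B (h u)) -> (#|A| <= \sum_v #|B v|)%N.
Proof.
move=> AB; rewrite -sum1_card (partition_big h predT) //=; apply: leq_sum => v _.
rewrite sum1dep_card; apply: subset_leq_card; apply/fintype.subsetP => u; rewrite inE /=.
by move=> /andP[uA /eqP <-]; exact: AB.
Qed.

Lemma family_slotsP (f : {ffun 'I_6 -> 'I_N}) (X1 X2 T : {set 'I_N}) :
  reflect [/\ f ord0 \in X1, f (inord 1) \in X2 & forall i : 'I_6, (1 < i)%N -> f i \in T]
    (f \in family (fun i => slots X1 X2 T i)).
Proof.
apply: (iffP familyP) => [h|[h1 h2 h3] i].
  split; first exact: (h ord0).
    by have := h (inord 1); rewrite /slots inordK.
  by case=> [[|[|i]] hi] // _; exact: (h (Ordinal hi)).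
case: i => [[|[|i]] hi].
- by rewrite (_ : Ordinal hi = ord0) //; exact: ord_inj.
- rewrite /slots /=; have -> : Ordinal hi = inord 1 by apply: ord_inj; rewrite /= inordK.
  exact: h2.
- by rewrite /slots /=; exact: h3.
Qed.

Lemma mixed_split4 a c xi T : (xi < p ^ a)%N ->
  (mixed (cl a xi) (cl a xi) (cl a xi) (cl a xi) T <=
   \sum_(v : 'I_(p ^ c) * 'I_(p ^ c) * 'I_(p ^ c) * 'I_(p ^ c))
     mixed (cl (a + c) (xi + p ^ a * v.1.1.1)) (cl (a + c) (xi + p ^ a * v.1.1.2))
       (cl (a + c) (xi + p ^ a * v.1.2)) (cl (a + c) (xi + p ^ a * v.2)) T)%N.
Proof.
move=> xia; rewrite /mixed /solution_count.
pose h (u : {ffun 'I_6 -> 'I_N} * {ffun 'I_6 -> 'I_N}) :=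
  (digit a c (u.1 ord0), digit a c (u.1 (inord 1)), digit a c (u.2 ord0), digit a c (u.2 (inord 1))).
apply: (@card_partition_le _ _ _ h) => u; rewrite !inE.
case/and3P => /family_slotsP[f1 f2 f3] /family_slotsP[g1 g2 g3] sys.
by apply/and3P; split => //; apply/family_slotsP; split => //; exact: cl_digit.
Qed.

Lemma mixed_split2 a c xi T : (xi < p ^ a)%N ->
  (mixed (cl a xi) T (cl a xi) T T <=
   \sum_(v : 'I_(p ^ c) * 'I_(p ^ c))
     mixed (cl (a + c) (xi + p ^ a * v.1)) T (cl (a + c) (xi + p ^ a * v.2)) T T)%N.
Proof.
move=> xia; rewrite /mixed /solution_count.
pose h (u : {ffun 'I_6 -> 'I_N} * {ffun 'I_6 -> 'I_N}) :=
  (digit a c (u.1 ord0), digit a c (u.2 ord0)).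
apply: (@card_partition_le _ _ _ h) => u; rewrite !inE.
case/and3P => /family_slotsP[f1 f2 f3] /family_slotsP[g1 g2 g3] sys.
by apply/and3P; split => //; apply/family_slotsP; split => //; exact: cl_digit.
Qed.

(** The system is invariant under translations of the variables. *)
Lemma shifted_power_sum (f g : {ffun 'I_6 -> 'I_N}) (t : int) : vinogradov_system f g ->
  \sum_i ((f i)%:Z - t) ^+ 2 = \sum_i ((g i)%:Z - t) ^+ 2 /\
  \sum_i ((f i)%:Z - t) ^+ 3 = \sum_i ((g i)%:Z - t) ^+ 3.
Proof.
have ps k (h : {ffun 'I_6 -> 'I_N}) : (power_sum k h)%:Z = \sum_i (h i)%:Z ^+ k.
  rewrite /power_sum -[LHS]/((power_sum k h)%:Z) /power_sum (big_morph Posz PoszD (erefl _)).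
  by apply: eq_bigr => i _; rewrite -[LHS]natz natrX natz.
have c6 (c : int) : c *+ 6 = \sum_(i < 6) c by rewrite sumr_const card_ord.
have e2 (h : {ffun 'I_6 -> 'I_N}) : \sum_i ((h i)%:Z - t) ^+ 2 =
    (power_sum 2 h)%:Z - 2 * t * (power_sum 1 h)%:Z + t ^+ 2 *+ 6.
  rewrite !ps mulr_sumr -sumrB c6 -big_split /=.
  by apply: eq_bigr => i _; ring.
have e3 (h : {ffun 'I_6 -> 'I_N}) : \sum_i ((h i)%:Z - t) ^+ 3 =
    (power_sum 3 h)%:Z - 3 * t * (power_sum 2 h)%:Z + 3 * t ^+ 2 * (power_sum 1 h)%:Z - t ^+ 3 *+ 6.
  rewrite !ps !mulr_sumr -sumrB c6 -big_split -sumrB /=.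
  by apply: eq_bigr => i _; ring.
by move=> /and3P[/eqP h1 /eqP h2 /eqP h3]; rewrite !e2 !e3 h1 h2 h3.
Qed.

(** The unconditioned variables are congruent to [eta] modulo [p ^ b], so their
[k]-th powers, taken after translation by [eta], vanish modulo [p ^ (k * b)];
only the four conditioned variables remain in the congruences. *)
Lemma mixed_gt0 b eta X1 X2 Y1 Y2 : (0 < mixed X1 X2 Y1 Y2 (cl b eta))%N ->
  exists x1 x2 y1 y2 : 'I_N, [/\ x1 \in X1, x2 \in X2, y1 \in Y1, y2 \in Y2 &
    ((p ^ (2 * b))%N %| (x1%:Z - eta%:Z) ^+ 2 + (x2%:Z - eta%:Z) ^+ 2
       - (y1%:Z - eta%:Z) ^+ 2 - (y2%:Z - eta%:Z) ^+ 2)%Z /\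
    ((p ^ (3 * b))%N %| (x1%:Z - eta%:Z) ^+ 3 + (x2%:Z - eta%:Z) ^+ 3
       - (y1%:Z - eta%:Z) ^+ 3 - (y2%:Z - eta%:Z) ^+ 3)%Z].
Proof.
rewrite /mixed /solution_count card_gt0 => /set0Pn[[f g]]; rewrite !inE /=.
case/and3P => /family_slotsP[f1 f2 f3] /family_slotsP[g1 g2 g3] sys.
exists (f ord0), (f (inord 1)), (g ord0), (g (inord 1)); split=> //.
have gen k : \sum_i ((f i)%:Z - eta%:Z) ^+ k = \sum_i ((g i)%:Z - eta%:Z) ^+ k ->
  ((p ^ (k * b))%N %| ((f ord0)%:Z - eta%:Z) ^+ k + ((f (inord 1))%:Z - eta%:Z) ^+ k
     - ((g ord0)%:Z - eta%:Z) ^+ k - ((g (inord 1))%:Z - eta%:Z) ^+ k)%Z.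
  have i1 : lift ord0 ord0 = inord 1 :> 'I_6 by apply: ord_inj; rewrite /= inordK.
  have spl (h : {ffun 'I_6 -> 'I_N}) : \sum_i ((h i)%:Z - eta%:Z) ^+ k =
      ((h ord0)%:Z - eta%:Z) ^+ k + (((h (inord 1))%:Z - eta%:Z) ^+ k +
      \sum_(i < 4) ((h (lift ord0 (lift ord0 i)))%:Z - eta%:Z) ^+ k).
    by rewrite big_ord_recl big_ord_recl i1.
  rewrite !spl; set F := \sum_(i < 4) _; set G := \sum_(i < 4) _ => e.
  have -> : ((f ord0)%:Z - eta%:Z) ^+ k + ((f (inord 1))%:Z - eta%:Z) ^+ k
     - ((g ord0)%:Z - eta%:Z) ^+ k - ((g (inord 1))%:Z - eta%:Z) ^+ k = G - F.
    by move: e; set x := _ ^+ k; set y := _ ^+ k; set z := _ ^+ k; set w := _ ^+ k; clear pgt0 p_pr p6; lia.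
  have tail (h : {ffun 'I_6 -> 'I_N}) : (forall i : 'I_6, (1 < i)%N -> h i \in cl b eta) ->
     forall i : 'I_4, ((p ^ (k * b))%N %| ((h (lift ord0 (lift ord0 i)))%:Z - eta%:Z) ^+ k)%Z.
    move=> hh i; have /hh /cl_int : (1 < lift ord0 (lift ord0 i))%N by [].
    by rewrite !dvdzE abszX !absz_nat mulnC expnM; exact: dvdn_exp2r.
  by rewrite rpredB // rpred_sum // => i _; apply: tail.
by have [h2 h3] := shifted_power_sum eta%:Z sys; split; apply: gen.
Qed.

End ResidueClasses.

(** * Passing to finer residue classes *)

Section Conditioning.
Variables (p N : nat) (R : realType).
Hypotheses (p_pr : prime p) (p6 : coprime p 6).
Local Notation cl := (@cl p N).

Let pgt0 a : (0 < p ^ a)%N.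
Proof. by rewrite expn_gt0 prime_gt0. Qed.

Lemma dvdz_nat_mod (m x y : nat) : (m%:Z %| x%:Z - y%:Z)%Z = (x == y %[mod m]).
Proof. by rewrite -eqz_mod_dvd !modz_nat eqz_nat. Qed.

Lemma dvdz_expW a b (x : int) : (a <= b)%N -> ((p ^ b)%N %| x)%Z -> ((p ^ a)%N %| x)%Z.
Proof. by move=> ab; apply: dvdz_trans; rewrite dvdzE !absz_nat dvdn_exp2l. Qed.

Lemma child_lt a c xi (v : 'I_(p ^ c)) : (xi < p ^ a)%N -> (xi + p ^ a * v < p ^ (a + c))%N.
Proof.
move=> h; rewrite expnD; apply: (@leq_trans (p ^ a * v.+1)).
  by rewrite mulnS ltn_add2r.
by rewrite leq_mul2l ltn_ord orbT.
Qed.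

Lemma child_mod a xi (v : nat) : (0 < a)%N -> xi + p ^ a * v = xi %[mod p].
Proof. by case: a => // a _; rewrite expnS -mulnA addnC mulnC modnMDl. Qed.

Lemma cl_dvd a xi eta (x : 'I_N) : (0 < a)%N -> x \in cl a xi ->
  (p %| x%:Z - eta%:Z - (xi%:Z - eta%:Z))%Z.
Proof.
move=> a0 /cl_int h.
have -> : x%:Z - eta%:Z - (xi%:Z - eta%:Z) = x%:Z - xi%:Z by lia.
by rewrite -[p in (Posz p %| _)%Z]expn1; apply: dvdz_expW h.
Qed.

Lemma child_cong a m xi eta v (x : 'I_N) : (0 < a)%N -> (0 < m)%N ->
  x \in cl m (xi + p ^ a * v) -> (p %| x%:Z - eta%:Z - (xi%:Z - eta%:Z))%Z.
Proof.
move=> a0 m0 hx; have -> : x%:Z - eta%:Z - (xi%:Z - eta%:Z) =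
  (x%:Z - eta%:Z - ((xi + p ^ a * v)%N%:Z - eta%:Z)) + ((xi + p ^ a * v)%N%:Z - xi%:Z) by ring.
by rewrite rpredD ?(cl_dvd _ m0 hx) // dvdz_nat_mod child_mod.
Qed.

(** With one conditioned variable on each side, the cubic congruence modulo
[p ^ (3 * b)] forces both into the same class modulo [p ^ (3 * b)]: only the
diagonal pairs of subclasses contribute, [p ^ c] in number. *)
Lemma refine_two_classes a c b xi eta (W : R) : (a + c = 3 * b)%N -> (0 < a)%N ->
  (xi < p ^ a)%N -> xi != eta %[mod p] -> 0 <= W ->
  (forall z, (z < p ^ (3 * b))%N -> z != eta %[mod p] ->
    (mixed (cl (3 * b) z) (cl b eta) (cl (3 * b) z) (cl b eta) (cl b eta))%:R <= W) ->
  (mixed (cl a xi) (cl b eta) (cl a xi) (cl b eta) (cl b eta))%:R <= (p ^ c)%:R * W.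
Proof.
move=> acb a0 xia ne W0 hW; set T := cl b eta.
have := mixed_split2 p_pr c T xia; rewrite -(ler_nat R) => /le_trans; apply.
rewrite natr_sum.
have pu : ~~ (p %| xi%:Z - eta%:Z)%Z by rewrite dvdz_nat_mod.
pose F (i j : 'I_(p ^ c)) : R := if i == j then W else 0.
apply: (@le_trans _ _ (\sum_(v : 'I_(p ^ c) * 'I_(p ^ c)) F v.1 v.2)).
  apply: ler_sum => -[i j] _ /=; rewrite /F.
  have child_res (v : 'I_(p ^ c)) : xi + p ^ a * v = xi %[mod p] by exact: child_mod.
  case: eqP => [<-|/eqP ij].
    by rewrite acb; apply: hW; rewrite ?child_res // -acb child_lt.
  rewrite (_ : mixed _ _ _ _ _ = 0%N) //; apply/eqP; rewrite -leqn0 leqNgt.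
  apply: contraNN ij => /mixed_gt0[x1 [x2 [y1 [y2 []]]]] hx1 hx2 hy1 hy2 [_ h3].
  rewrite acb in hx1 hy1.
  have b3 : (0 < 3 * b)%N by rewrite -acb addn_gt0 a0.
  have T3 (x : 'I_N) : x \in T -> ((p ^ (3 * b))%N %| (x%:Z - eta%:Z) ^+ 3)%Z.
    by move=> /cl_int; rewrite !dvdzE abszX !absz_nat mulnC expnM; exact: dvdn_exp2r.
  have h3' : ((p ^ (3 * b))%N %| (x1%:Z - eta%:Z) ^+ 3 - (y1%:Z - eta%:Z) ^+ 3)%Z.
    have -> : (x1%:Z - eta%:Z) ^+ 3 - (y1%:Z - eta%:Z) ^+ 3 =
      ((x1%:Z - eta%:Z) ^+ 3 + (x2%:Z - eta%:Z) ^+ 3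
       - (y1%:Z - eta%:Z) ^+ 3 - (y2%:Z - eta%:Z) ^+ 3)
       - (x2%:Z - eta%:Z) ^+ 3 + (y2%:Z - eta%:Z) ^+ 3 by ring.
    by apply: rpredD; [apply: rpredB; [exact: h3 | exact: T3] | exact: T3].
  have cong v x := @child_cong a (3 * b) xi eta v x a0 b3.
  have := cube_injective p_pr p6 pu (cong _ _ hx1) (cong _ _ hy1) h3'.
  have -> : x1%:Z - eta%:Z - (y1%:Z - eta%:Z) = x1%:Z - y1%:Z by lia.
  rewrite dvdz_nat_mod; move: hx1 hy1; rewrite !inE => /eqP -> /eqP ->.
  rewrite !modn_small -?acb ?child_lt // eqn_add2l eqn_mul2l.
  by rewrite gtn_eqF //= => /eqP/ord_inj ->.
rewrite -(pair_bigA _ F) /=.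
have h (i : 'I_(p ^ c)) : \sum_j F i j = W.
  rewrite (bigD1 i) //= big1 ?addr0 /F ?eqxx // => j ji.
  by rewrite eq_sym (negbTE ji).
by under eq_bigr do rewrite h; rewrite sumr_const card_ord mulr_natl.
Qed.

(** The power of [p] dividing the product splits between the factors in [c + 1]
ways, and each split fixes [c] of the [3 * c] base [p] digits of a triple. *)
Lemma card_product_congruence (c : nat) (G : {set 'I_(p ^ c) * 'I_(p ^ c) * 'I_(p ^ c)}) :
  (forall t, t \in G -> ((p ^ c)%N %| (t.2%:Z - t.1.2%:Z) * (t.1.1%:Z - t.2%:Z))%Z) ->
  (#|G| <= c.+1 * (p ^ c) ^ 2)%N.
Proof.
move=> hG.
pose A (i : 'I_c.+1) := [set t : 'I_(p ^ c) * 'I_(p ^ c) * 'I_(p ^ c) |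
  (t.1.2 == t.2 %[mod p ^ i]) && (t.1.1 == t.2 %[mod p ^ (c - i)])].
pose h t : 'I_c.+1 := odflt ord0 [pick i | t \in A i].
have GA t : t \in G -> t \in A (h t).
  move=> /hG hB; have [i h1 h2] := dvdz_prod_split p_pr hB; rewrite /h; case: pickP => [j //|/(_ i)].
  by move: h1 h2; rewrite inE !dvdz_nat_mod eq_sym => -> ->.
apply: leq_trans (card_partition_le GA) _.
have -> : (c.+1 * (p ^ c) ^ 2 = \sum_(i < c.+1) (p ^ c) ^ 2)%N.
  by rewrite sum_nat_const card_ord.
apply: leq_sum => i _.
have ic : (i <= c)%N by rewrite -ltnS.
have split1 : (p ^ (c - i) * p ^ i = p ^ c)%N by rewrite -expnD subnK.
have lt1 (x : 'I_(p ^ c)) : (x %/ p ^ i < p ^ (c - i))%N by rewrite ltn_divLR // split1.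
have lt2 (x : 'I_(p ^ c)) : (x %/ p ^ (c - i) < p ^ i)%N by rewrite ltn_divLR // mulnC split1.
pose g (t : 'I_(p ^ c) * 'I_(p ^ c) * 'I_(p ^ c)) :=
  (t.2, Ordinal (lt1 t.1.2), Ordinal (lt2 t.1.1)).
have gi : {in A i &, injective g}.
  move=> [[t1 t2] t4] [[s1 s2] s4]; rewrite !inE /= => /andP[/eqP a1 /eqP a2].
  move=> /andP[/eqP b1 /eqP b2] [e4 e2 e1]; rewrite e4 in a1 a2 *.
  congr (_, _, _); apply: ord_inj.
    by rewrite (divn_eq t1 (p ^ (c - i))) (divn_eq s1 (p ^ (c - i))) e1 a2 b2.
  by rewrite (divn_eq t2 (p ^ i)) (divn_eq s2 (p ^ i)) e2 a1 b1.
rewrite -(card_in_imset gi); apply: leq_trans (max_card _) _.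
by rewrite !card_prod !card_ord -mulnA split1 mulnn.
Qed.

(** With two conditioned variables on each side, refine the modulus from
[p ^ a] to [p ^ (a + 2 * d)].  Of the [p ^ (8 * d)] quadruples of subclasses
only [(2 * d + 1) * p ^ (4 * d)] contribute: the third member is determined by
the quadratic congruence, and the others satisfy the product congruence of
[two_pairs_congruence]. *)
Lemma refine_four_classes a d xi eta (W : R) : (0 < a)%N ->
  (xi < p ^ a)%N -> xi != eta %[mod p] -> 0 <= W ->
  let T := cl (a + d) eta in
  (forall z, (z < p ^ (a + 2 * d))%N -> z != eta %[mod p] ->
    (mixed (cl (a + 2 * d) z) (cl (a + 2 * d) z) (cl (a + 2 * d) z) (cl (a + 2 * d) z) T)%:R <= W) ->
  (mixed (cl a xi) (cl a xi) (cl a xi) (cl a xi) T)%:R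
    <= (2 * d + 1)%:R * (p ^ (2 * d))%:R ^+ 2 * W.
Proof.
move=> a0 xia ne W0 T hW; set c := (2 * d)%N in hW *.
have := mixed_split4 p_pr c T xia; rewrite -(ler_nat R) => /le_trans; apply.
have pu : ~~ (p %| xi%:Z - eta%:Z)%Z by rewrite dvdz_nat_mod.
pose V := ('I_(p ^ c) * 'I_(p ^ c) * 'I_(p ^ c) * 'I_(p ^ c))%type.
pose F (v : V) := mixed (cl (a + c) (xi + p ^ a * v.1.1.1)) (cl (a + c) (xi + p ^ a * v.1.1.2))
       (cl (a + c) (xi + p ^ a * v.1.2)) (cl (a + c) (xi + p ^ a * v.2)) T.
pose G : {set V} := [set v | 0 < F v]%N.
have child_res (v : 'I_(p ^ c)) : xi + p ^ a * v = xi %[mod p] by exact: child_mod.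
have FW v : (F v)%:R <= W.
  by apply: mixed_amgm; apply: hW; rewrite ?child_res ?child_lt.
have -> : (\sum_v F v)%N = (\sum_(v in G) F v)%N.
  rewrite [RHS]big_mkcond /=; apply: eq_bigr => v _; rewrite inE.
  by case: posnP.
suff cardG : (#|G| <= c.+1 * (p ^ c) ^ 2)%N.
  rewrite natr_sum; apply: (@le_trans _ _ (\sum_(v in G) W)); first exact: ler_sum.
  rewrite sumr_const -[leLHS]mulr_natl ler_wpM2r //.
  by rewrite -natrX -natrM ler_nat addn1.
have ac0 : (0 < a + c)%N by rewrite addn_gt0 a0.
have cong v x := @child_cong a (a + c) xi eta v x a0 ac0.
have e2b : (2 * (a + d) = 2 * a + c)%N by rewrite mulnDr.
have w3 : (2 * (a + d) <= 3 * (a + d))%N by rewrite leq_mul2r orbT.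
pose f (v : V) := (v.1.1.1, v.1.1.2, v.2).
have fi : {in G &, injective f}.
  move=> [[[v1 v2] v3] v4] [[[w1 w2] w3'] w4]; rewrite !inE /F /=.
  move=> /mixed_gt0[x1 [x2 [x3 [x4 [hx1 hx2 hx3 hx4 [h2 _]]]]]].
  move=> /mixed_gt0[y1 [y2 [y3 [y4 [hy1 hy2 hy3 hy4 [k2 _]]]]]].
  move=> [e1 e2 e4]; rewrite -e1 -e2 -e4 in hy1 hy2 hy4.
  congr (_, _, _, _) => //.
  have lac : (a + c <= 2 * (a + d))%N by rewrite e2b leq_add2r leq_pmull.
  have {}h2 := dvdz_expW lac h2; have {}k2 := dvdz_expW lac k2.
  have same (v : 'I_(p ^ c)) (x y : 'I_N) : x \in cl (a + c) (xi + p ^ a * v) ->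
      y \in cl (a + c) (xi + p ^ a * v) ->
      ((p ^ (a + c))%N %| (x%:Z - eta%:Z) ^+ 2 - (y%:Z - eta%:Z) ^+ 2)%Z.
    rewrite !inE => /eqP hx /eqP hy.
    have -> : (x%:Z - eta%:Z) ^+ 2 - (y%:Z - eta%:Z) ^+ 2 =
      (x%:Z - y%:Z) * (x%:Z - eta%:Z + (y%:Z - eta%:Z)) by ring.
    by rewrite dvdz_mulr // dvdz_nat_mod hx hy.
  have : ((p ^ (a + c))%N %| (x3%:Z - eta%:Z) ^+ 2 - (y3%:Z - eta%:Z) ^+ 2)%Z.
    have -> : (x3%:Z - eta%:Z) ^+ 2 - (y3%:Z - eta%:Z) ^+ 2 =
      ((x1%:Z - eta%:Z) ^+ 2 - (y1%:Z - eta%:Z) ^+ 2) +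
      ((x2%:Z - eta%:Z) ^+ 2 - (y2%:Z - eta%:Z) ^+ 2) -
      ((x4%:Z - eta%:Z) ^+ 2 - (y4%:Z - eta%:Z) ^+ 2) -
      ((x1%:Z - eta%:Z) ^+ 2 + (x2%:Z - eta%:Z) ^+ 2
         - (x3%:Z - eta%:Z) ^+ 2 - (x4%:Z - eta%:Z) ^+ 2) +
      ((y1%:Z - eta%:Z) ^+ 2 + (y2%:Z - eta%:Z) ^+ 2
         - (y3%:Z - eta%:Z) ^+ 2 - (y4%:Z - eta%:Z) ^+ 2) by ring.
    apply: rpredD k2; apply: rpredB h2; apply: rpredB; last exact: same hx4 hy4.
    by apply: rpredD; [exact: same hx1 hy1 | exact: same hx2 hy2].
  move/(square_injective p_pr p6 pu (cong _ _ hx3) (cong _ _ hy3)).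
  have -> : x3%:Z - eta%:Z - (y3%:Z - eta%:Z) = x3%:Z - y3%:Z by ring.
  rewrite dvdz_nat_mod; move: hx3 hy3; rewrite !inE => /eqP -> /eqP ->.
  rewrite !modn_small ?child_lt // eqn_add2l eqn_mul2l.
  by rewrite gtn_eqF //= => /eqP/ord_inj ->.
rewrite -(card_in_imset fi); apply: card_product_congruence => t /imsetP[[[[v1 v2] v3] v4]].
rewrite inE /F /= => /mixed_gt0[x1 [x2 [x3 [x4 [hx1 hx2 hx3 hx4 [h2 h3]]]]]] ->.
rewrite /f /=.
have := two_pairs_congruence p_pr p6 pu (cong _ _ hx1) (cong _ _ hx2) (cong _ _ hx3)
  (cong _ _ hx4) h2 (dvdz_expW w3 h3).
rewrite e2b.
have rep (v : 'I_(p ^ c)) (x : 'I_N) : x \in cl (a + c) (xi + p ^ a * v) ->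
    exists k : int, x%:Z = xi%:Z + (p ^ a)%N%:Z * (v%:Z + (p ^ c)%N%:Z * k).
  move=> /cl_int/dvdzP[k]; rewrite expnD => e; exists k.
  by move: e; rewrite !PoszM PoszD PoszM => /eqP; rewrite subr_eq => /eqP ->; ring.
have [k1 e1] := rep _ _ hx1; have [k2 e2'] := rep _ _ hx2; have [k4 e4] := rep _ _ hx4.
set P := (p ^ a)%N%:Z in e1 e2' e4; set Q := (p ^ c)%N%:Z in e1 e2' e4 *.
have -> : (x4%:Z - eta%:Z - (x2%:Z - eta%:Z)) * (x1%:Z - eta%:Z - (x4%:Z - eta%:Z)) =
   (P * P) * ((v4%:Z - v2%:Z) * (v1%:Z - v4%:Z) + Q * ((v4%:Z - v2%:Z) * (k1 - k4)
      + (k4 - k2) * (v1%:Z - v4%:Z) + Q * (k4 - k2) * (k1 - k4))).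
  by rewrite e1 e2' e4; ring.
have -> : (p ^ (2 * a + c))%N%:Z = (P * P) * Q.
  by rewrite mul2n -addnn expnD expnD PoszM PoszM.
rewrite dvdz_mul2l ?mulf_neq0 // ?eqz_nat -?lt0n //.
by rewrite rpredDr // dvdz_mulr.
Qed.

End Conditioning.

(** * The congruencing iteration *)

(** The number of integer points with coordinates below [N] on the system
[x1^m + ... + x6^m = y1^m + ... + y6^m], [m = 1, 2, 3]. *)
Definition mean_count (N : nat) : nat := @solution_count N (fun=> [set: 'I_N]) (fun=> [set: 'I_N]).

Section Rescaling.
Variables (p N : nat).
Hypothesis (p_pr : prime p).

(** The affine substitution [x = eta + p ^ b * y] preserves the system, by
translation and dilation invariance. *)
Lemma mixed_le_rescaled b eta :
  (mixed (@cl p N b eta) (cl p N b eta) (cl p N b eta) (cl p N b eta) (cl p N b eta)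
    <= mean_count (N %/ p ^ b).+1)%N.
Proof.
set T := cl p N b eta; set m := (p ^ b)%N.
have m0 : (0 < m)%N by rewrite expn_gt0 prime_gt0.
have lt (x : 'I_N) : (x %/ m < (N %/ m).+1)%N by rewrite ltnS leq_div2r // ltnW.
pose q (f : {ffun 'I_6 -> 'I_N}) : {ffun 'I_6 -> 'I_(N %/ m).+1} := [ffun i => Ordinal (lt (f i))].
pose Q (u : {ffun 'I_6 -> 'I_N} * {ffun 'I_6 -> 'I_N}) := (q u.1, q u.2).
have inT (f : {ffun 'I_6 -> 'I_N}) : f \in family (fun i => slots T T T i) ->
    forall i, (f i = eta %% m + m * q f i :> nat)%N.
  move=> /familyP h i; have := h i.
  have -> : slots T T T i = T by rewrite /slots; do 2?case: ifP.
  rewrite inE => /eqP e; rewrite ffunE /= {1}(divn_eq (f i) m) e; ring.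
have qinj f g : f \in family (fun i => slots T T T i) -> g \in family (fun i => slots T T T i) ->
    q f = q g -> f = g.
  by move=> /inT hf /inT hg e; apply/ffunP => i; apply: ord_inj; rewrite hf hg e.
rewrite /mixed /solution_count -(@card_in_imset _ _ Q); last first.
  move=> [f1 f2] [g1 g2]; rewrite !inE => /and3P[a1 a2 _] /and3P[b1 b2 _] [e1 e2].
  by congr (_, _); [exact: (qinj _ _ a1 b1 e1) | exact: (qinj _ _ a2 b2 e2)].
apply: subset_leq_card; apply/fintype.subsetP => _ /imsetP[[f g] + ->].
rewrite !inE => /and3P[/inT hf /inT hg sys].
apply/and3P; split; try by apply/familyP => i; rewrite inE.
set t := (eta %% m)%N in hf hg.
have p1 (h : {ffun 'I_6 -> 'I_N}) : (forall i, (h i = t + m * q h i :> nat)%N) ->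
   [/\ power_sum 1 h = (6 * t + m * power_sum 1 (q h))%N,
       power_sum 2 h = (6 * t ^ 2 + 2 * t * m * power_sum 1 (q h) + m ^ 2 * power_sum 2 (q h))%N &
       power_sum 3 h = (6 * t ^ 3 + 3 * t ^ 2 * m * power_sum 1 (q h) + 3 * t * m ^ 2 * power_sum 2 (q h)
          + m ^ 3 * power_sum 3 (q h))%N].
  move=> hh; have c6 (c : nat) : (6 * c = \sum_(i < 6) c)%N by rewrite sum_nat_const card_ord.
  rewrite /power_sum; split; rewrite c6 !big_distrr -!big_split /=; apply: eq_bigr => i _;
    rewrite (hh i); ring.
have [f1 f2 f3] := p1 _ hf; have [g1 g2 g3] := p1 _ hg.
move: sys => /and3P[/eqP s1 /eqP s2 /eqP s3].
have m2 : (0 < m ^ 2)%N by rewrite expn_gt0 m0.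
have m3 : (0 < m ^ 3)%N by rewrite expn_gt0 m0.
move: s1; rewrite f1 g1 => /addnI /eqP; rewrite eqn_pmul2l // => /eqP s1.
move: s2; rewrite f2 g2 s1 => /addnI /eqP; rewrite eqn_pmul2l // => /eqP s2.
move: s3; rewrite f3 g3 s1 s2 => /addnI /eqP; rewrite eqn_pmul2l // => /eqP s3.
by apply/and3P; split; apply/eqP.
Qed.

End Rescaling.

Section Iteration.
Variables (p N : nat) (R : realType) (Q k L : R).
Hypotheses (p_pr : prime p) (p6 : coprime p 6).
Hypotheses (Q0 : 0 < Q) (k0 : 0 < k) (k1 : k <= 1) (L1 : 1 <= L).
Local Notation cl := (@cl p N).
Let P : R := p%:R^-1.
Local Notation mixed4 X T := (mixed X X X X T).

Hypothesis Hpure : forall b eta, (p ^ b <= N)%N ->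
  (mixed4 (cl b eta) (cl b eta))%:R <= Q * P ^+ (6 * b) * k ^+ (12 * b).

Let P0 : 0 < P.
Proof. by rewrite invr_gt0 ltr0n prime_gt0. Qed.

(** Bookkeeping for the Holder inequalities with weights [1] and [m]: they
hold with equality between monomials whose exponents are in the right
proportion. *)
Lemma monomial_eq (B : R) m i j i' j' i'' j'' :
  (i + m * i' = m.+1 * i'')%N -> (j + m * j' = m.+1 * j'')%N ->
  B * P ^+ i * k ^+ j * (B * P ^+ i' * k ^+ j') ^+ m = (B * P ^+ i'' * k ^+ j'') ^+ m.+1.
Proof.
move=> hi hj; rewrite !exprMn -!exprM [(i'' * _)%N]mulnC [(j'' * _)%N]mulnC -hi -hj.
by rewrite !exprD [(m * i')%N]mulnC [(m * j')%N]mulnC exprS; ring.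
Qed.

Lemma mono_gt0 (B : R) i j : 0 < B -> 0 < B * P ^+ i * k ^+ j.
Proof. by move=> B0; rewrite !mulr_gt0 ?exprn_gt0. Qed.

Lemma pexp_mul c i : (p ^ c)%:R * P ^+ (c + i) = P ^+ i.
Proof.
rewrite exprD mulrA /P exprVn natrX divff ?mul1r //.
by rewrite expf_neq0 // pnatr_eq0 -lt0n prime_gt0.
Qed.

Lemma pexp_monomial (B : R) c i j :
  (p ^ c)%:R * (B * P ^+ (c + i) * k ^+ j) = B * P ^+ i * k ^+ j.
Proof. by rewrite -[in RHS](pexp_mul c i); ring. Qed.

(** [Q] is the trivial bound for the whole system under a hypothetical exponent
[6 + s]; a class modulo [p ^ b] saves [P ^ (6 * b) * k ^ (12 * b)], where
[P = 1 / p] and [k = p ^ (- s / 12)].  Each round passes from classes modulo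
[p ^ a] and [p ^ (a + d)] to two pairs of finer classes through
[refine_four_classes], [mixed_holder_swap], [refine_two_classes] and
[mixed_holder_two].  The finest modulus is multiplied by at most 3, and the
bound gains [k ^ (4 * a + 6 * d)], at the cost of a factor [L]. *)
Lemma congruencing_iteration n : forall a d xi eta, (0 < a)%N ->
  (p ^ (3 ^ n * (a + d)) <= N)%N -> (2 * (3 ^ n * (a + d)) + 1)%:R <= L ->
  (xi < p ^ a)%N -> (eta < p ^ (a + d))%N -> xi != eta %[mod p] ->
  (mixed4 (cl a xi) (cl (a + d) eta))%:R
    <= L ^+ n * Q * P ^+ (6 * a + 4 * d) * k ^+ (2 * n * (2 * a + 3 * d)).
Proof.
have p1 : (1 < p)%N by exact: prime_gt1.
have pexp_le i j : (i <= j)%N -> (p ^ j <= N)%N -> (p ^ i <= N)%N.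
  by move=> ij; apply: leq_trans; rewrite leq_exp2l.
elim: n => [|n IH] a d xi eta a0 pN LL xia etab ne.
  rewrite expr0 mul1r mul1n muln0 mul0n in pN *.
  have pure c t : (c <= a + d)%N -> (mixed4 (cl c t) (cl c t))%:R <= Q * P ^+ (6 * c) * k ^+ 0.
    move=> ca; apply: le_trans (Hpure t (pexp_le _ _ ca pN)) _.
    rewrite expr0 mulr1 ler_piMr // ?exprn_ile1 ?(ltW k0) //.
    by rewrite mulr_ge0 ?exprn_ge0 ?ltW.
  apply: mixed_holder_pure (pure a xi (leq_addr _ _)) (pure _ eta (leqnn _)) _;
    rewrite ?mono_gt0 //.
  rewrite (@monomial_eq Q 2 _ _ _ _ (6 * a + 4 * d) 0) //.
  by ring.
set B := L ^+ n * Q; set b := (a + d)%N in pN LL etab *.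
have B0 : 0 < B by rewrite mulr_gt0 ?exprn_gt0 // (lt_le_trans _ L1).
have QB : Q <= B by apply: ler_peMl; [exact: ltW | exact: exprn_ege1].
have b0 : (0 < b)%N by rewrite addn_gt0 a0.
have n3 : (0 < 3 ^ n)%N by rewrite expn_gt0.
have nebis z : (z != eta %[mod p])%N -> (eta != z %[mod p])%N by rewrite eq_sym.
have sub i : (i <= 3 * b)%N -> (p ^ (3 ^ n * i) <= N)%N /\ (2 * (3 ^ n * i) + 1)%:R <= L.
  move=> ib; have le3 : (3 ^ n * i <= 3 ^ n.+1 * b)%N.
    by rewrite expnS [(3 * _)%N]mulnC -mulnA leq_mul2l ib orbT.
  split; first exact: pexp_le le3 pN.
  by apply: le_trans LL; rewrite ler_nat leq_add2r leq_mul2l le3 orbT.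
pose W := B * P ^+ (6 * a + 8 * d) * k ^+ (4 * n * a + 6 * n * d + 6 * a + 6 * d).
have W0 : 0 <= W by rewrite ltW // mono_gt0.
suff hW z : (z < p ^ (a + 2 * d))%N -> z != eta %[mod p] ->
    (mixed4 (cl (a + 2 * d) z) (cl b eta))%:R <= W.
  apply: le_trans (refine_four_classes p_pr p6 a0 xia ne W0 hW) _.
  have dL : (2 * d + 1)%:R <= L.
    apply: le_trans LL; rewrite ler_nat leq_add2r leq_mul2l /=.
    by rewrite (leq_trans (leq_addl a d)) // leq_pmull // expn_gt0.
  have -> : L ^+ n.+1 * Q * P ^+ (6 * a + 4 * d) * k ^+ (2 * n.+1 * (2 * a + 3 * d)) =
    L * (B * P ^+ (6 * a + 4 * d) * k ^+ (2 * n.+1 * (2 * a + 3 * d))).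
    by rewrite (exprS L) /B !mulrA.
  rewrite -[leLHS]mulrA.
  apply: ler_pM => //; first by rewrite mulr_ge0 // exprn_ge0.
  rewrite /W -natrX -expnM.
  have -> : (6 * a + 8 * d = (2 * d * 2) + (6 * a + 4 * d))%N by ring.
  rewrite pexp_monomial; apply: ler_wpM2l; first by apply: mulr_ge0; [exact: ltW | exact/exprn_ge0/ltW].
  apply: ler_wiXn2l; rewrite ?(ltW k0) //.
  have -> : (4 * n * a + 6 * n * d + 6 * a + 6 * d = 2 * n.+1 * (2 * a + 3 * d) + 2 * a)%N by ring.
  exact: leq_addr.
move=> za zne.
pose V' := B * P ^+ (8 * b) * k ^+ (4 * n * b + 9 * b).
have V'0 : 0 < V' by rewrite mono_gt0.
have hV' z' : (z' < p ^ (3 * b))%N -> z' != eta %[mod p] ->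
    (mixed (cl (3 * b) z') (cl b eta) (cl (3 * b) z') (cl b eta) (cl b eta))%:R <= V'.
  move=> z'b z'ne.
  have pure : (mixed4 (cl b eta) (cl b eta))%:R <= B * P ^+ (6 * b) * k ^+ (12 * b).
    have bN : (p ^ b <= N)%N by apply: pexp_le pN; rewrite leq_pmull // expn_gt0.
    apply: le_trans (Hpure eta bN) _.
    by rewrite !ler_wpM2r // exprn_ge0 // ltW.
  have e3 : (b + 2 * b = 3 * b)%N by ring.
  have [pN3 LL3] := sub (3 * b)%N (leqnn _).
  have := IH b (2 * b)%N eta z' b0; rewrite e3 => /(_ pN3 LL3 etab z'b (nebis _ z'ne)) hU.
  apply: mixed_holder_two hU pure _; rewrite ?mono_gt0 //.
  by rewrite (@monomial_eq B 3 _ _ _ _ (8 * b) (4 * n * b + 9 * b)) //; ring.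
have hV : (mixed (cl (a + 2 * d) z) (cl b eta) (cl (a + 2 * d) z) (cl b eta) (cl b eta))%:R
    <= B * P ^+ (6 * a + 7 * d) * k ^+ (4 * n * b + 9 * b).
  apply: le_trans (@refine_two_classes p N R p_pr p6 (a + 2 * d) (2 * a + d) b z eta V' _ _ za zne (ltW V'0) hV') _.
  - by rewrite /b; ring.
  - by rewrite addn_gt0 a0.
  rewrite /V' (_ : (8 * b = (2 * a + d) + (6 * a + 7 * d))%N); last by rewrite /b; ring.
  by rewrite pexp_monomial.
have e2 : (b + d = a + 2 * d)%N by rewrite /b; ring.
have [pN2 LL2] : (p ^ (3 ^ n * (a + 2 * d)) <= N)%N /\ (2 * (3 ^ n * (a + 2 * d)) + 1)%:R <= L.
  apply: sub; rewrite /b mulnDr leq_add // ?leq_pmull //.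
  by rewrite leq_mul2r orbT.
have := IH b d eta z b0; rewrite e2 => /(_ pN2 LL2 etab za (nebis _ zne)) hU.
apply: mixed_holder_swap hU hV _; rewrite ?mono_gt0 //.
rewrite (@monomial_eq B 2 _ _ _ _ (6 * a + 8 * d)
  (4 * n * a + 6 * n * d + 6 * a + 6 * d)) //; rewrite /b; ring.
Qed.

End Iteration.

(** * From all variables to two distinct residue classes *)

Section LargestTwo.
Variable R : realType.

(** Either the largest term dominates the sum, or the second largest does,
up to the factor [m]; in the latter case the fourth power of the second
largest times the eighth power of the largest is at least the twelfth power of
the second largest. *)
Lemma max_two_pow12 (m : nat) (F : 'I_m -> R) : (1 < m)%N -> (forall i, 0 <= F i) ->
  (\sum_i F i) ^+ 12 <= 2 ^+ 11 * \sum_i F i ^+ 12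
    + 2 ^+ 11 * m%:R ^+ 12 * \sum_i \sum_(j | j != i) F i ^+ 4 * F j ^+ 8.
Proof.
move=> m1 F0.
have x0 : 'I_m := Ordinal (ltnW m1).
pose i0 := [arg max_(i > x0) F i]%O.
have hi0 i : F i <= F i0.
  by rewrite /i0; case: Order.TotalTheory.arg_maxP => // k _ hk; apply: hk.
have [x1 hx1] : exists x1 : 'I_m, x1 != i0.
  case: (eqVneq (Ordinal m1) i0) => [e|ne]; last by exists (Ordinal m1).
  by exists (Ordinal (ltnW m1)); rewrite -e.
pose j0 := [arg max_(j > x1 | j != i0) F j]%O.
have [j0i hj0] : j0 != i0 /\ forall j, j != i0 -> F j <= F j0.
  by rewrite /j0; case: Order.TotalTheory.arg_maxP => // k k1 hk; split.
set x := F i0; set y := F j0.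
have S1 : \sum_i F i <= x + m%:R * y.
  rewrite (bigD1 i0) //= lerD2l; apply: (@le_trans _ _ (\sum_(i | i != i0) y)).
    by apply: ler_sum => i; exact: hj0.
  rewrite sumr_const -[leLHS]mulr_natl ler_wpM2r ?F0 // ler_nat.
  by apply: leq_trans (max_card _) _; rewrite card_ord.
have y0 : 0 <= m%:R * y by rewrite mulr_ge0 ?F0.
have S2 : (x + m%:R * y) ^+ 12 <= 2 ^+ 11 * (x ^+ 12 + (m%:R * y) ^+ 12).
  have := @power_mean R 2 11 (fun i => if i == ord0 then x else m%:R * y).
  rewrite !big_ord_recl !big_ord0 /= !addr0; apply => i.
  by case: ifP => _; rewrite ?F0.
apply: le_trans (le_trans _ S2) _; first by rewrite lerXn2r ?nnegrE ?sumr_ge0 ?addr_ge0 ?F0.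
rewrite mulrDr -[2 ^+ 11 * m%:R ^+ 12 * _]mulrA lerD // ler_pM2l ?exprn_gt0 //.
  by rewrite (bigD1 i0) //= lerDl sumr_ge0 // => i _; rewrite exprn_ge0.
rewrite exprMn ler_wpM2l ?exprn_ge0 //.
apply: (@le_trans _ _ (y ^+ 4 * x ^+ 8)).
  rewrite -[12%N]/(4 + 8)%N exprD ler_wpM2l ?exprn_ge0 ?F0 //.
  by rewrite lerXn2r ?nnegrE ?F0 ?hi0.
have pos i j : 0 <= F i ^+ 4 * F j ^+ 8 by rewrite mulr_ge0 ?exprn_ge0.
rewrite (bigD1 j0) //= (bigD1 i0) 1?eq_sym //= -addrA lerDl addr_ge0 //.
  by rewrite sumr_ge0.
by apply: sumr_ge0 => i _; apply: sumr_ge0.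
Qed.

End LargestTwo.

Section Descent.
Variables (p N : nat) (R : realType).
Hypothesis (p_pr : prime p).
Local Notation cl := (@cl p N).
Local Notation mixed4 X T := (mixed X X X X T).
Let M := (6 * N ^ 3).+1.
Let MN : (6 * N ^ 3 < M)%N := ltnSn _.
Let M0 : 0 < M%:R ^+ 3 :> R.
Proof. by rewrite exprn_gt0. Qed.

Lemma csum_split (w : freq M) a c xi : (xi < p ^ a)%N ->
  csum R w (cl a xi) = \sum_(v < p ^ c) csum R w (cl (a + c) (xi + p ^ a * v)).
Proof.
move=> xia; rewrite /csum (partition_big (digit p_pr a c) predT) //=.
apply: eq_bigr => v _; apply: eq_bigl => x; apply/andP/idP => [[xc /eqP <-]|xc].
  exact: cl_digit.
have xa : x \in cl a xi.
  move: xc; rewrite !inE => /eqP h.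
  have := congr1 (fun y => y %% p ^ a)%N h.
  by rewrite expnD !modn_dvdm ?dvdn_mulr // => ->; rewrite addnC mulnC modnMDl.
split => //; have := cl_digit p_pr c xia xa; move: xc; rewrite !inE => /eqP ->.
rewrite !modn_small ?child_lt // eqn_add2l eqn_mul2l gtn_eqF ?expn_gt0 ?prime_gt0 //=.
by move=> /eqP h; apply/eqP/ord_inj.
Qed.

Lemma cnorm_split_le (w : freq M) a c xi : (xi < p ^ a)%N ->
  cnorm R w (cl a xi) <= \sum_(v < p ^ c) cnorm R w (cl (a + c) (xi + p ^ a * v)).
Proof. by move=> xia; rewrite /cnorm (csum_split w c xia); exact: cabs_sum. Qed.

(** Splits the classes modulo [p] into classes modulo [p ^ (c + 1)]. *)
Lemma refine_mixed c xi eta (W : R) : (xi < p)%N -> (eta < p)%N -> xi != eta ->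
  (forall z y, (z < p ^ c.+1)%N -> (y < p ^ c.+1)%N -> z != y %[mod p] ->
     (mixed4 (cl c.+1 z) (cl c.+1 y))%:R <= W) ->
  (mixed4 (cl 1 xi) (cl 1 eta))%:R <= (p ^ c)%:R ^+ 12 * W.
Proof.
move=> xp ep ne hW; rewrite -(ler_pM2l M0) (mixed_sum R MN).
set q := (p ^ c)%N.
have lt1 x : (x < p)%N -> (x < p ^ 1)%N by rewrite expn1.
pose F (w : freq M) (v : 'I_q) := cnorm R w (cl c.+1 (xi + p ^ 1 * v)).
pose G (w : freq M) (v : 'I_q) := cnorm R w (cl c.+1 (eta + p ^ 1 * v)).
have F0 w v : 0 <= F w v by exact: cnorm_ge0.
have G0 w v : 0 <= G w v by exact: cnorm_ge0.
have hF w : cnorm R w (cl 1 xi) ^+ 4 <= q%:R ^+ 3 * \sum_v F w v ^+ 4.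
  apply: le_trans (power_mean 3 (F0 w)); rewrite lerXn2r ?nnegrE ?cnorm_ge0 ?sumr_ge0 //.
  exact: cnorm_split_le (lt1 _ xp).
have hG w : cnorm R w (cl 1 eta) ^+ 8 <= q%:R ^+ 7 * \sum_v G w v ^+ 8.
  apply: le_trans (power_mean 7 (G0 w)); rewrite lerXn2r ?nnegrE ?cnorm_ge0 ?sumr_ge0 //.
  exact: cnorm_split_le (lt1 _ ep).
apply: (@le_trans _ _ (\sum_w q%:R ^+ 10 * \sum_v \sum_u F w v ^+ 4 * G w u ^+ 8)).
  apply: ler_sum => w _; rewrite -exprD.
  have -> : \sum_v \sum_u F w v ^+ 4 * G w u ^+ 8 = (\sum_v F w v ^+ 4) * (\sum_u G w u ^+ 8).
    by rewrite mulr_suml; apply: eq_bigr => v _; rewrite mulr_sumr.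
  have -> : q%:R ^+ 10 * ((\sum_v F w v ^+ 4) * (\sum_u G w u ^+ 8)) =
     (q%:R ^+ 3 * (\sum_v F w v ^+ 4)) * (q%:R ^+ 7 * (\sum_u G w u ^+ 8)) :> R by ring.
  by apply: ler_pM; rewrite ?exprn_ge0 ?cnorm_ge0.
rewrite -mulr_sumr exchange_big /=; under eq_bigr do rewrite exchange_big /=.
have hm v u : \sum_w F w v ^+ 4 * G w u ^+ 8 <= M%:R ^+ 3 * W.
  have := hW (xi + p ^ 1 * v)%N (eta + p ^ 1 * u)%N.
  rewrite -[c.+1]add1n => /(_ (child_lt _ (lt1 _ xp)) (child_lt _ (lt1 _ ep))).
  rewrite !child_mod // !modn_small // => /(_ ne).
  rewrite -(ler_pM2l M0) (mixed_sum R MN) => h; apply: le_trans h.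
  by apply: ler_sum => w _; rewrite -exprD.
apply: (@le_trans _ _ (q%:R ^+ 10 * \sum_(v < q) \sum_(u < q) (M%:R ^+ 3 * W))).
  by rewrite ler_wpM2l ?exprn_ge0 //; apply: ler_sum => v _; apply: ler_sum => u _.
rewrite !sumr_const !card_ord -[X in X <= _](_ : q%:R ^+ 12 * (M%:R ^+ 3 * W) = _).
  by rewrite mulrCA.
by move: (M%:R ^+ 3 * W) => Y; rewrite -mulrnA -[Y *+ _]mulr_natl natrM; move: (q%:R) => x; ring.
Qed.

Lemma mean_count_mixed : mean_count N = mixed4 (cl 0 0) (cl 0 0).
Proof.
have e : cl 0 0 = [set: 'I_N] by apply/setP => x; rewrite !inE expn0 !modn1.
rewrite /mean_count /mixed e; congr (solution_count _ _); apply/funext => i;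
  by rewrite /slots; do 2?case: ifP.
Qed.

(** All variables in one class modulo [p], or two distinct classes; the
latter are refined to a modulus [p ^ (c + 1)] at which the congruencing
iteration starts. *)
Lemma mean_count_descent c (W J1 : R) :
  (forall xi, (xi < p)%N -> (mixed4 (cl 1 xi) (cl 1 xi))%:R <= J1) ->
  (forall z y, (z < p ^ c.+1)%N -> (y < p ^ c.+1)%N -> z != y %[mod p] ->
     (mixed4 (cl c.+1 z) (cl c.+1 y))%:R <= W) -> 0 <= W ->
  (mean_count N)%:R <= 2 ^+ 11 * (p%:R * J1)
     + 2 ^+ 11 * p%:R ^+ 12 * (p%:R ^+ 2 * ((p ^ c)%:R ^+ 12 * W)).
Proof.
move=> hJ hW W0; rewrite mean_count_mixed -(ler_pM2l M0) (mixed_sum R MN).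
pose F (w : freq M) (v : 'I_p) := cnorm R w (cl 1 v).
have F0 w v : 0 <= F w v by exact: cnorm_ge0.
have h1 w : cnorm R w (cl 0 0) <= \sum_v F w v.
  have := @cnorm_split_le w 0 1 0; rewrite expn0 => /(_ isT); rewrite expn1.
  by under eq_bigr do rewrite add0n mul1n add0n.
apply: (@le_trans _ _ (\sum_w (2 ^+ 11 * \sum_v F w v ^+ 12 +
   2 ^+ 11 * p%:R ^+ 12 * \sum_v \sum_(u | u != v) F w v ^+ 4 * F w u ^+ 8))).
  apply: ler_sum => w _; apply: le_trans (max_two_pow12 (prime_gt1 p_pr) (F0 w)).
  by rewrite -!exprD lerXn2r ?nnegrE ?cnorm_ge0 ?sumr_ge0.
rewrite big_split /= -!mulr_sumr [leRHS]mulrDr; apply: lerD.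
  rewrite mulrCA ler_pM2l ?exprn_gt0 // exchange_big /= mulrCA.
  have -> : p%:R * (M%:R ^+ 3 * J1) = \sum_(v < p) M%:R ^+ 3 * J1.
    by rewrite sumr_const card_ord mulr_natl.
  apply: ler_sum => v _.
  apply: le_trans (ler_wpM2l (ltW M0) (hJ v (ltn_ord v))); rewrite (mixed_sum R MN).
  by apply: ler_sum => w _; rewrite -!exprD.
rewrite [leRHS]mulrCA ler_pM2l ?mulr_gt0 ?exprn_gt0 ?ltr0n ?prime_gt0 //.
rewrite exchange_big /=.
set W' := _ * W; have W'0 : 0 <= W' by rewrite mulr_ge0 ?exprn_ge0.
apply: (@le_trans _ _ (\sum_(v < p) \sum_(u < p) M%:R ^+ 3 * W')).
  apply: ler_sum => v _; rewrite exchange_big /= [leLHS]big_mkcond; apply: ler_sum => u _.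
  case: ifP => [uv|_]; last by rewrite mulr_ge0 // ltW.
  have vu : v != u :> nat by rewrite eq_sym.
  have := ler_wpM2l (ltW M0) (refine_mixed (ltn_ord v) (ltn_ord u) vu hW).
  rewrite (mixed_sum R MN) => h; apply: le_trans h.
  by apply: ler_sum => w _; rewrite -exprD.
rewrite !sumr_const !card_ord [leRHS]mulrCA; move: (M%:R ^+ 3 * W') => Y.
by rewrite -mulrnA -[Y *+ _]mulr_natl natrM expr2.
Qed.

End Descent.

(** * The cubic mean value theorem *)

Lemma succ_div_lt (N : nat) : (17 <= N)%N -> ((N %/ 17).+1 < N)%N.
Proof. by move=> h; lia. Qed.

Section CubicMeanValue.
Variable R : realType.

Definition mean_value_exponent (s : R) := exists2 C : R, 0 < C &
  forall N, (0 < N)%N -> (mean_count N)%:R <= C * N%:R ^+ 6 * N%:R `^ s.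

Lemma mean_count_trivial N : (mean_count N <= N ^ 12)%N.
Proof.
rewrite /mean_count /solution_count; apply: leq_trans (max_card _) _.
by rewrite card_prod !card_ffun !card_ord -expnD.
Qed.

Lemma powR_ge1 (x r : R) : 1 <= x -> 0 <= r -> 1 <= x `^ r.
Proof. by move=> x1 r0; rewrite -[leLHS](powRr0 x) ler_powR. Qed.

Lemma mean_value_exponent6 : mean_value_exponent 6.
Proof.
exists 1 => // N N0; rewrite mul1r (powR_mulrn 6) // -exprD -natrX ler_nat.
exact: mean_count_trivial.
Qed.

Lemma poly_le_exp2 (n c : nat) : exists C, forall t, ((c * t + 1) ^ n <= C * 2 ^ t)%N.
Proof.
case: n => [|n]; first by exists 1%N => t; rewrite expn0 mul1n expn_gt0.
exists ((c * n.+1 + 1) ^ n.+1)%N => t.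
set m := (t %/ n.+1)%N.
have tm : (t <= n.+1 * m.+1)%N by rewrite mulnC ltnW // ltn_ceil.
have : (2 ^ (m * n.+1) <= 2 ^ t)%N by rewrite leq_exp2l // leq_trunc_div.
move=> /(leq_mul (leqnn ((c * n.+1 + 1) ^ n.+1))); apply: leq_trans.
rewrite expnM -expnMn leq_exp2r //.
have m2 : (m.+1 <= 2 ^ m)%N by rewrite ltn_expl.
apply: (@leq_trans ((c * n.+1 + 1) * m.+1)); last by rewrite leq_mul2l m2 orbT.
rewrite mulnDl mul1n leq_add // -mulnA leq_mul2l tm orbT //.
Qed.

(** Improves the exponent by [dl = 3 ^ - n].  Choose [t] maximal with
[p ^ (3 ^ n * t) <= N] and start the iteration with [a = t], [d = 0]: since
[24 <= n * s], the gain [k ^ (4 * n * t)] is at least [P ^ (8 * t)], whereas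
the descent loses [p ^ (12 * t)] against the saving [P ^ (6 * t)].  Of the
remaining [P ^ (2 * t)], one half absorbs the factor [L ^ n], polynomial in
[t], and the other half is at most [p * N ^ - dl].  Solutions in which all
variables lie in one class modulo [p] are handled by induction on [N]. *)
Lemma mean_value_step (n : nat) (s : R) : 24 <= n%:R * s -> (3 ^ n)%:R^-1 <= s ->
  mean_value_exponent s -> mean_value_exponent (s - (3 ^ n)%:R^-1).
Proof.
move=> ns ds [C C0 hC]; set dl := _^-1 in ds *.
have d0 : 0 < dl by rewrite invr_gt0 ltr0n expn_gt0.
have s0 : 0 <= s by lra.
(* Any prime with 2 ^ 18 <= p ^ 5 serves: this closes the induction over one class. *)
pose p := 17%N; have p_pr : prime p by [].
have p6 : coprime p 6 by [].
have p0 : 0 < p%:R :> R by rewrite ltr0n.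
pose P : R := p%:R^-1.
have P0 : 0 < P by rewrite invr_gt0.
pose N0 := (p ^ (3 ^ n))%N.
have N0gt1 : (1 < N0)%N by rewrite /N0 -[1%N](expn0 p) ltn_exp2l // expn_gt0.
have [C' hC'] := poly_le_exp2 n (2 * 3 ^ n).
pose k : R := p%:R `^ (- s / 12).
have k0 : 0 < k by rewrite powR_gt0.
have kE m : k ^+ m = p%:R `^ (- s / 12 * m%:R) by rewrite powRrM powR_mulrn // ltW.
have PE m : P ^+ m = p%:R `^ (- m%:R) by rewrite powRN powR_mulrn ?ltW // exprVn.
have k1 : k <= 1.
  by rewrite -[leRHS](powRr0 p%:R) ler_powR ?ler1n //; rewrite mulNr oppr_le0 divr_ge0.
have k8 : k ^+ (4 * n) <= P ^+ 8.
  rewrite kE PE ler_powR ?ler1n // natrM; lra.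
pose E : R := 2 ^+ 11 * p%:R ^+ 3 * C'%:R * (C * 2 ^+ 6 * 2 `^ s).
have E0 : 0 <= E by rewrite /E !mulr_ge0 ?exprn_ge0 ?powR_ge0 // ltW.
pose D : R := 2 * E + N0%:R ^+ 12.
have D0 : 0 < D.
  apply: ltr_wpDl; first by apply: mulr_ge0.
  by apply: exprn_gt0; rewrite ltr0n ltnW.
exists D => //; elim/ltn_ind => N IH Npos.
have x1 : 1 <= N%:R :> R by rewrite ler1n.
have xs0 : 0 <= N%:R `^ (s - dl) by rewrite powR_ge0.
have x60 : 0 <= N%:R ^+ 6 :> R by rewrite exprn_ge0.
have [small|large] := ltnP N N0.
  apply: (@le_trans _ _ (N0%:R ^+ 12)).
    rewrite -natrX ler_nat; apply: leq_trans (mean_count_trivial N) _.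
    by rewrite leq_exp2r // ltnW.
  apply: (@le_trans _ _ D); first by rewrite lerDr mulr_ge0.
  rewrite -mulrA ler_peMr ?(ltW D0) //; apply: mulr_ege1; first exact: exprn_ege1.
  by apply: powR_ge1 => //; lra.
pose t := trunc_log N0 N.
have t0 : (0 < t)%N by rewrite trunc_log_gt0 N0gt1 /= (leq_trans _ large) // prednK // ltnW.
have tN : (N0 ^ t <= N)%N by exact: trunc_logP.
have Nt : (N < N0 ^ t.+1)%N by exact: trunc_log_ltn.
pose Q : R := C * 2 ^+ 6 * 2 `^ s * N%:R ^+ 6 * N%:R `^ s.
have Q0 : 0 < Q by rewrite /Q !mulr_gt0 ?exprn_gt0 ?powR_gt0 // ltr0n.
have mle b : (p ^ b <= N)%N -> (N %/ p ^ b).+1%:R <= 2 * N%:R * P ^+ b :> R.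
  move=> bN; have pb : (0 < p ^ b)%N by rewrite expn_gt0.
  rewrite /P exprVn -natrX ler_pdivlMr ?ltr0n // -natrM -natrM ler_nat mulSn mul2n -addnn.
  by rewrite leq_add // leq_trunc_div.
have Hpure b eta : (p ^ b <= N)%N ->
    (mixed (cl p N b eta) (cl p N b eta) (cl p N b eta) (cl p N b eta) (cl p N b eta))%:R
      <= Q * P ^+ (6 * b) * k ^+ (12 * b).
  move=> bN; have := mixed_le_rescaled N p_pr b eta; rewrite -(ler_nat R) => /le_trans; apply.
  apply: le_trans (hC _ (ltn0Sn _)) _; have mN := mle _ bN.
  have mp : 0 <= 2 * N%:R * P ^+ b by apply: le_trans mN.
  have -> : Q * P ^+ (6 * b) * k ^+ (12 * b) =
      C * (2 * N%:R * P ^+ b) ^+ 6 * (2 * N%:R * P ^+ b) `^ s.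
    have Pbs : (P ^+ b) `^ s = k ^+ (12 * b).
      by rewrite PE -powRrM kE natrM; congr (_ `^ _); field.
    rewrite !powRM ?mulr_ge0 ?exprn_ge0 ?(ltW P0) // Pbs /Q !exprMn -(exprM P) [(b * 6)%N]mulnC.
    by ring.
  apply: ler_pM => //.
  - by apply: mulr_ge0; [exact: ltW | exact: exprn_ge0].
  - by rewrite ler_pM2l // lerXn2r // nnegrE.
  - by apply: ge0_ler_powR => //; rewrite nnegrE.
pose L : R := (2 * (3 ^ n * t) + 1)%:R.
have L1 : 1 <= L by rewrite ler1n addn1.
pose W := L ^+ n * Q * P ^+ (14 * t).
have L0 : 0 <= L by apply: le_trans L1.
have LQ0 : 0 <= L ^+ n * Q := mulr_ge0 (exprn_ge0 n L0) (ltW Q0).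
have Pge0 m : 0 <= P ^+ m := exprn_ge0 m (ltW P0).
have W0 : 0 <= W := mulr_ge0 LQ0 (Pge0 _).
have ptN : (p ^ (3 ^ n * (t + 0)) <= N)%N by rewrite addn0 expnM.
have hW z y : (z < p ^ t.-1.+1)%N -> (y < p ^ t.-1.+1)%N -> z != y %[mod p] ->
    (mixed (cl p N t.-1.+1 z) (cl p N t.-1.+1 z) (cl p N t.-1.+1 z) (cl p N t.-1.+1 z)
       (cl p N t.-1.+1 y))%:R <= W.
  rewrite prednK // => zt yt zy.
  have := @congruencing_iteration p N R Q k L p_pr p6 Q0 k0 k1 L1 Hpure n t 0 z y t0 ptN.
  rewrite addn0 -/L => /(_ (lexx _) zt yt zy) h; apply: le_trans h _.
  rewrite muln0 !addn0 /W -mulrA ler_wpM2l //.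
  have -> : (14 * t = 6 * t + 8 * t)%N by ring.
  rewrite exprD ler_wpM2l //.
  have -> : (2 * n * (2 * t) = 4 * n * t)%N by ring.
  rewrite (exprM k (4 * n)) (exprM P 8); apply: lerXn2r; rewrite ?nnegrE //.
  exact: exprn_ge0 (ltW k0).
have pN : (p ^ 1 <= N)%N by apply: leq_trans large; rewrite /N0 leq_exp2l // expn_gt0.
pose J1 := (mean_count (N %/ p ^ 1).+1)%:R : R.
have hJ xi : (xi < p)%N ->
  (mixed (cl p N 1 xi) (cl p N 1 xi) (cl p N 1 xi) (cl p N 1 xi) (cl p N 1 xi))%:R <= J1.
  by move=> _; rewrite ler_nat mixed_le_rescaled.
apply: le_trans (mean_count_descent p_pr hJ hW W0) _.
have bJ : J1 <= D * (64 * P ^+ 6 * N%:R ^+ 6) * N%:R `^ (s - dl).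
  have mlt : ((N %/ p ^ 1).+1 < N)%N.
    by move: pN; rewrite expn1; exact: succ_div_lt.
  apply: le_trans (IH _ mlt (ltn0Sn _)) _.
  have mN := mle _ pN; rewrite expr1 in mN.
  have mp : 0 <= 2 * N%:R * P by apply: le_trans mN.
  apply: ler_pM => //; rewrite ?powR_ge0 ?mulr_ge0 ?exprn_ge0 ?(ltW D0) //.
    rewrite ler_pM2l //.
    have -> : 64 * P ^+ 6 * N%:R ^+ 6 = (2 * N%:R * P) ^+ 6 by ring.
    by rewrite lerXn2r // nnegrE.
  by apply: ge0_ler_powR; rewrite ?nnegrE ?ler_nat ?(ltnW mlt) //; lra.
have pP : p%:R * P = 1 by rewrite divff // gt_eqF.
have t1 : 2 ^+ 11 * (p%:R * J1) <= D / 2 * N%:R ^+ 6 * N%:R `^ (s - dl).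
  apply: (@le_trans _ _ (2 ^+ 11 * (p%:R * (D * (64 * P ^+ 6 * N%:R ^+ 6) * N%:R `^ (s - dl))))).
    by rewrite ler_pM2l ?exprn_gt0 // ler_pM2l.
  have -> : 2 ^+ 11 * (p%:R * (D * (64 * P ^+ 6 * N%:R ^+ 6) * N%:R `^ (s - dl))) =
    (2 ^+ 11 * 64 * (p%:R * P) * P ^+ 5) * (D * N%:R ^+ 6 * N%:R `^ (s - dl)) by ring.
  have -> : D / 2 * N%:R ^+ 6 * N%:R `^ (s - dl) = 1 / 2 * (D * N%:R ^+ 6 * N%:R `^ (s - dl)) by field.
  rewrite ler_wpM2r ?mulr_ge0 ?(ltW D0) // pP mulr1 /P exprVn ler_pdivrMr ?exprn_gt0 //.
  by rewrite /p; lra.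
have t2 : 2 ^+ 11 * p%:R ^+ 12 * (p%:R ^+ 2 * ((p ^ t.-1)%:R ^+ 12 * W)) <=
   E * N%:R ^+ 6 * N%:R `^ (s - dl).
  have e1 : (p ^ t.-1)%:R * P ^+ t = P.
    rewrite -{2}(prednK t0) natrX exprS mulrCA -exprMn pP expr1n mulr1 //.
  have -> : 2 ^+ 11 * p%:R ^+ 12 * (p%:R ^+ 2 * ((p ^ t.-1)%:R ^+ 12 * W)) =
     2 ^+ 11 * p%:R ^+ 2 * (p%:R ^+ 12 * ((p ^ t.-1)%:R * P ^+ t) ^+ 12) *
     (L ^+ n * P ^+ t) * Q * P ^+ t.
    rewrite /W (_ : (14 * t = t * 12 + t + t)%N); last by ring.
    by rewrite !exprD !exprM !exprMn; ring.
  rewrite e1 -exprMn pP expr1n mulr1.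
  have LP : L ^+ n * P ^+ t <= C'%:R.
    rewrite /P exprVn ler_pdivrMr ?exprn_gt0 // /L -!natrX -natrM ler_nat mulnA.
    by apply: leq_trans (hC' t) _; rewrite leq_mul2l leq_exp2r ?orbT.
  have Pt : P ^+ t <= p%:R * N%:R `^ (- dl).
    have : N%:R `^ dl <= p%:R ^+ t.+1.
      apply: (@le_trans _ _ ((N0 ^ t.+1)%:R `^ dl)).
        by apply: ge0_ler_powR; rewrite ?nnegrE ?ler_nat ?(ltnW Nt) ?(ltW d0).
      rewrite /N0 -expnM mulnC expnM natrX -powR_mulrn // -powRrM.
      by rewrite /dl divff ?powRr1 -?natrX // pnatr_eq0 -lt0n expn_gt0.
    move=> h; rewrite powRN /P exprVn.
    have Nd : 0 < N%:R `^ dl :> R by rewrite powR_gt0 // ltr0n.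
    by rewrite ler_pdivlMr // mulrC ler_pdivrMr ?exprn_gt0 // -exprS.
  have -> : E * N%:R ^+ 6 * N%:R `^ (s - dl) =
     2 ^+ 11 * p%:R ^+ 2 * C'%:R * Q * (p%:R * N%:R `^ (- dl)).
    rewrite powRD; last by apply/implyP => _; rewrite pnatr_eq0 -lt0n.
    by rewrite /E /Q; ring.
  have c11 : 0 <= 2 ^+ 11 * p%:R ^+ 2 :> R.
    by apply: mulr_ge0; exact: exprn_ge0.
  apply: ler_pM => //.
    exact: mulr_ge0 (mulr_ge0 c11 (mulr_ge0 (exprn_ge0 n L0) (Pge0 t))) (ltW Q0).
  exact: ler_wpM2r (ltW Q0) _ _ (ler_wpM2l c11 LP).
apply: le_trans (lerD t1 t2) _.
have NN : 0 <= N%:R ^+ 6 * N%:R `^ (s - dl) by rewrite mulr_ge0.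
have ED : E <= D / 2.
  by rewrite /D; have : 0 <= N0%:R ^+ 12 :> R by [rewrite exprn_ge0|]; lra.
have -> : D / 2 * N%:R ^+ 6 * N%:R `^ (s - dl) + E * N%:R ^+ 6 * N%:R `^ (s - dl) =
  (D / 2 + E) * (N%:R ^+ 6 * N%:R `^ (s - dl)) by ring.
rewrite -(mulrA D); apply: ler_wpM2r => //; clear -ED; lra.
Qed.

(** Starting from the trivial exponent, [mean_value_step] applies with the same
[n], hence the same decrement, until the exponent is below [eps]. *)
Theorem cubic_vinogradov (eps : R) : 0 < eps -> mean_value_exponent eps.
Proof.
move=> e0.
have [n hn] : exists n : nat, 24 <= n%:R * eps.
  exists (Num.truncn (24 / eps)).+1; rewrite -ler_pdivrMr //.
  by have /andP[_ /ltW] := truncn_itv (ltW (divr_gt0 (ltr0n R 24) e0)).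
pose dl : R := (3 ^ n)%:R^-1.
have d0 : 0 < dl by rewrite invr_gt0 ltr0n expn_gt0.
have de : dl <= eps.
  have : n%:R <= (3 ^ n)%:R :> R by rewrite ler_nat ltnW // ltn_expl.
  have : 0 < (3 ^ n)%:R :> R by rewrite ltr0n expn_gt0.
  rewrite /dl; move: ((3 ^ n)%:R : R) => x x0 nx; rewrite -[x^-1]div1r ler_pdivrMr //; nra.
have weaken (s s' : R) : s <= s' -> mean_value_exponent s -> mean_value_exponent s'.
  move=> ss [C C0 hC]; exists C => // N N0; apply: le_trans (hC N N0) _.
  by rewrite ler_wpM2l ?mulr_ge0 ?exprn_ge0 ?(ltW C0) // ler_powR // ler1n.
have main (i : nat) : mean_value_exponent eps \/ mean_value_exponent (6 - i%:R * dl).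
  elim: i => [|i [IH|IH]]; first by right; rewrite mul0r subr0; exact: mean_value_exponent6.
    by left.
  have [le|gt] := leP (6 - i%:R * dl) eps; first by left; exact: weaken IH.
  right; have := @mean_value_step n (6 - i%:R * dl) _ _ IH.
  rewrite -[i.+1]addn1 natrD mulrDl mul1r opprD addrA; apply; last by rewrite -/dl; lra.
  by apply: le_trans hn _; rewrite ler_wpM2l // ltW.
have [i hi] : exists i : nat, 6 - i%:R * dl <= eps.
  exists (Num.truncn (6 / dl)).+1.
  have /andP[_ /ltW] := truncn_itv (ltW (divr_gt0 (ltr0n R 6) d0)).
  by rewrite ler_pdivrMr //; lra.
by case: (main i) => // h; exact: weaken h.
Qed.

End CubicMeanValue.

(** * The divisor bound and sums over products *)

Section DivisorBound.
Variable R : realType.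

Definition tau (n : nat) : nat := size (divisors n).

Lemma tau_mul m n : (0 < m)%N -> (0 < n)%N -> (tau (m * n) <= tau m * tau n)%N.
Proof.
move=> m0 n0; rewrite /tau -[X in (_ <= X)%N](size_allpairs muln).
apply: uniq_leq_size; first exact: divisors_uniq.
move=> d; rewrite -dvdn_divisors ?muln_gt0 ?m0 // => dmn.
have d0 : (0 < d)%N by apply: dvdn_gt0 dmn; rewrite muln_gt0 m0.
set g := gcdn d m; have g0 : (0 < g)%N by rewrite gcdn_gt0 d0.
apply/allpairsP; exists (g, d %/ g)%N; split => /=.
- by rewrite -dvdn_divisors // dvdn_gcdr.
- rewrite -dvdn_divisors // -(@Gauss_dvdr _ (m %/ g)); last first.
    rewrite /coprime -(eqn_pmul2r g0) muln_gcdl mul1n !divnK ?dvdn_gcdl ?dvdn_gcdr //.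
  by rewrite -(dvdn_pmul2r g0) divnK ?dvdn_gcdl // mulnAC divnK ?dvdn_gcdr.
by rewrite mulnC divnK // dvdn_gcdl.
Qed.

Lemma tau_pow p e : prime p -> (tau (p ^ e) <= e.+1)%N.
Proof.
move=> p_pr; rewrite /tau -[X in (_ <= X)%N](size_iota 0) -[X in (_ <= X)%N](size_map (expn p)).
apply: uniq_leq_size; first exact: divisors_uniq.
move=> d; rewrite -dvdn_divisors ?expn_gt0 ?prime_gt0 // => /(dvdn_pfactor _ _ p_pr)[i ie ->].
by apply: map_f; rewrite mem_iota.
Qed.

(** Bernoulli. *)
Lemma linear_le_pow (x : R) : 1 < x ->
  exists2 K : R, 1 <= K & forall e, e.+1%:R <= K * x ^+ e.
Proof.
move=> x1; exists (1 + (x - 1)^-1); first by rewrite lerDl invr_ge0; lra.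
have d0 : 0 < x - 1 by lra.
move=> e; rewrite mulrDl mul1r.
have b : 1 + e%:R * (x - 1) <= x ^+ e.
  case: e => [|e]; first by rewrite mul0r expr0 addr0.
  have := tangent_pow e ler01 (ltW (lt_trans ltr01 x1)).
  by rewrite !expr1n !mulr1 -[e.+1]addn1 natrD; lra.
have e0 : 0 <= e%:R * (x - 1) by rewrite mulr_ge0 // ltW.
have h1 : 1 <= x ^+ e by lra.
have h2 : e%:R <= (x - 1)^-1 * x ^+ e.
  by rewrite mulrC ler_pdivlMr //; lra.
by rewrite -addn1 natrD; lra.
Qed.

(** For a prime [p] with [2 <= p ^ eps] one has [e + 1 <= p ^ (e * eps)]; the
finitely many smaller primes cost a constant factor [K] each. *)
Lemma divisor_bound (eps : R) : 0 < eps ->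
  exists2 C : R, 0 < C & forall n, (0 < n)%N -> (tau n)%:R <= C * n%:R `^ eps.
Proof.
move=> e0.
have x1 : 1 < 2 `^ eps :> R.
  by have := @gt0_ltr_powR R eps e0 1 2; rewrite powR1; apply; rewrite ?nnegrE // ltr1n.
have [K K1 hK] := linear_le_pow x1.
pose P0 := (Num.truncn (2 `^ eps^-1 : R)).+1.
have bigp p : (P0 <= p)%N -> 2 <= p%:R `^ eps :> R.
  move=> pP.
  have e2 : 2 = (2 `^ eps^-1) `^ eps :> R by rewrite -powRrM mulVf ?gt_eqF // powRr1.
  rewrite [leLHS]e2; apply: ge0_ler_powR; rewrite ?nnegrE ?powR_ge0 ?(ltW e0) //.
  have /andP[_ /ltW h] := truncn_itv (powR_ge0 (2 : R) eps^-1); apply: le_trans h _.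
  by rewrite ler_nat.
pose c n := #|[set p : 'I_P0 | prime p && (p %| n)%N]|.
have cP n : (c n <= P0)%N by apply: leq_trans (max_card _) _; rewrite card_ord.
exists (K ^+ P0); first by rewrite exprn_gt0 // (lt_le_trans ltr01).
suff main n : (0 < n)%N -> (tau n)%:R <= K ^+ c n * n%:R `^ eps.
  move=> n n0; apply: le_trans (main n n0) _; rewrite ler_wpM2r ?powR_ge0 //.
  by rewrite ler_weXn2l.
elim/ltn_ind: n => n IH n0.
have [n1|n1] := leqP n 1.
  have -> : n = 1%N by apply/eqP; rewrite eqn_leq n1 n0.
  by rewrite powR1 mulr1 exprn_ege1.
set p := pdiv n; have p_pr : prime p by exact: pdiv_prime.
have pn : (p %| n)%N by exact: pdiv_dvd.
have [m cpm en] := pfactor_coprime p_pr n0; set e := logn p n in en.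
have e1 : (0 < e)%N by rewrite logn_gt0 mem_primes p_pr n0.
have m0 : (0 < m)%N by move: n0; rewrite en muln_gt0 => /andP[].
have mn : (m < n)%N by rewrite [X in (_ < X)%N]en ltn_Pmulr // -[1%N](expn0 p) ltn_exp2l // prime_gt1.
have pm : ~~ (p %| m)%N by rewrite -prime_coprime.
have pe : e.+1%:R <= K ^+ (p < P0)%N * (p%:R `^ eps) ^+ e.
  case: (ltnP p P0) => pP.
    rewrite expr1; apply: le_trans (hK e) _.
    rewrite ler_wpM2l ?(le_trans ler01) // lerXn2r ?nnegrE ?powR_ge0 //.
    by apply: ge0_ler_powR; rewrite ?nnegrE ?ler_nat ?prime_gt1 ?(ltW e0).
  rewrite expr0 mul1r; apply: (@le_trans _ _ (2 ^+ e)).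
    by rewrite -natrX ler_nat ltn_expl.
  by rewrite lerXn2r ?nnegrE ?powR_ge0 // bigp.
have cn : (c m + (p < P0) <= c n)%N.
  rewrite /c; case: (ltnP p P0) => pP; last first.
    rewrite addn0; apply: subset_leq_card; apply/fintype.subsetP => r; rewrite !inE.
    by move=> /andP[-> rm]; rewrite en dvdn_mulr.
  rewrite addn1; apply: proper_card; apply/fintype.properP; split.
    apply/fintype.subsetP => r; rewrite !inE => /andP[-> rm].
    by rewrite en dvdn_mulr.
  by exists (Ordinal pP); rewrite !inE /= ?p_pr ?pn // (negbTE pm) andbF.
have tn : (tau n <= tau m * e.+1)%N.
  rewrite [in leqLHS]en; apply: leq_trans (tau_mul m0 _) _; first by rewrite expn_gt0 prime_gt0.
  by rewrite leq_mul2l tau_pow ?orbT.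
apply: (@le_trans _ _ ((tau m)%:R * e.+1%:R)); first by rewrite -natrM ler_nat.
apply: (@le_trans _ _ (K ^+ c m * m%:R `^ eps * (K ^+ (p < P0)%N * (p%:R `^ eps) ^+ e))).
  by apply: ler_pM => //; exact: IH.
have -> : K ^+ c m * m%:R `^ eps * (K ^+ (p < P0)%N * (p%:R `^ eps) ^+ e) =
   K ^+ (c m + (p < P0)) * n%:R `^ eps.
  have pw : (p ^ e)%:R `^ eps = (p%:R `^ eps) ^+ e :> R.
    by rewrite natrX -(powR_mulrn e (ler0n R p)) powRAC powR_mulrn ?powR_ge0.
  have -> : n%:R `^ eps = m%:R `^ eps * (p%:R `^ eps) ^+ e by rewrite [in LHS]en natrM powRM // pw.
  by rewrite exprD mulrACA.
by rewrite ler_wpM2r ?powR_ge0 // ler_weXn2l.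
Qed.

End DivisorBound.

Section ProductSums.
Variable R : realType.
Implicit Types (F T : nat -> R).

(** Once the product [n] is known, so is the pair, from the divisor [h + 1] of
[n]. *)
Lemma sum_products_le (A B k : nat) (D : R) F : (0 < k)%N -> (forall n, 0 <= F n) ->
  (forall n, (0 < n <= A * k * B)%N -> (tau n)%:R <= D) ->
  \sum_(c < A) \sum_(h < B) F (c.+1 * k * h.+1)%N <= D * \sum_(n < A * k * B) F n.+1.
Proof.
move=> k0 F0 hD.
have lt (u : 'I_A * 'I_B) : ((u.1.+1 * k * u.2.+1).-1 < A * k * B)%N.
  rewrite prednK ?muln_gt0 ?k0 //; apply: leq_mul => //.
  by rewrite leq_mul2r ltn_ord orbT.
pose f (u : 'I_A * 'I_B) := Ordinal (lt u).
rewrite (pair_bigA _ (fun (c : 'I_A) (h : 'I_B) => F (c.+1 * k * h.+1)%N)) /=.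
rewrite (partition_big f predT) //= mulr_sumr; apply: ler_sum => n _.
apply: (@le_trans _ _ (\sum_(u | f u == n) F n.+1)).
  apply: ler_sum => u /eqP <-; rewrite /f /= prednK ?muln_gt0 ?k0 //.
rewrite sumr_const -[leLHS]mulr_natl ler_wpM2r //.
apply: le_trans (hD n.+1 _); last by rewrite /= ltn_ord.
rewrite ler_nat /tau.
pose g (u : 'I_A * 'I_B) := (u.2.+1).
rewrite cardE -(size_map g); apply: uniq_leq_size.
  rewrite map_inj_in_uniq ?enum_uniq // => u v; rewrite !mem_enum !unfold_in.
  move=> /eqnP /= fu /eqnP /= fv [] guv.
  have e : (u.1.+1 * k * u.2.+1 = v.1.+1 * k * v.2.+1)%N.
    by apply: (@succn_inj); rewrite -[in LHS](@prednK (u.1.+1 * _ * _)) ?muln_gt0 ?k0 // fu -fv prednK ?muln_gt0 ?k0.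
  move: e; rewrite guv => /eqP; rewrite !eqn_pmul2r // eqSS => /eqP e1.
  by case: u v e1 guv {fu fv} => [u1 u2] [v1 v2] /= /ord_inj -> /ord_inj ->.
move=> h /mapP[u]; rewrite mem_enum unfold_in => /eqnP /= fu ->.
rewrite -dvdn_divisors // -fu prednK ?muln_gt0 ?k0 // dvdn_mull //.
Qed.

(** The part of [iter_diff_sum] in which all the shifts are positive. *)
Fixpoint iter_prod_sum (d B j : nat) T (c : nat) : R :=
  if j is j'.+1 then \sum_(h < B) iter_prod_sum d B j' T (c * (d + j) * h.+1) else T c.

Lemma iter_diff_sum0 d Y j T : iter_diff_sum d Y j T 0 = Y%:R ^+ j * T 0%N.
Proof.
elim: j => [|j IH] /=; first by rewrite expr0 mul1r.
under eq_bigr do rewrite !mul0n IH.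
by rewrite sumr_const card_ord -[LHS]mulr_natl exprS mulrA.
Qed.

(** A vanishing shift makes the leading coefficient vanish; the sums where this
happens are bounded by the single value [T 0]. *)
Lemma iter_diff_sum_le d B j T c : 0 <= T 0%N ->
  iter_diff_sum d B.+1 j T c <= j%:R * B.+1%:R ^+ j.-1 * T 0%N + iter_prod_sum d B j T c.
Proof.
move=> T0; elim: j c => [|j IH] c; first by rewrite /= mul0r mul0r add0r.
rewrite /= big_ord_recl /= muln0 iter_diff_sum0.
have -> : j.+1%:R * B.+1%:R ^+ j * T 0%N = B.+1%:R ^+ j * T 0%N + j%:R * B.+1%:R ^+ j * T 0%N.
  by rewrite -[j.+1]addn1 natrD; ring.
rewrite -addrA lerD2l.
apply: (@le_trans _ _ (\sum_(h < B) (j%:R * B.+1%:R ^+ j.-1 * T 0%N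
     + iter_prod_sum d B j T (c * (d + j.+1) * h.+1)))).
  by apply: ler_sum => h _; apply: IH.
rewrite big_split /= lerD2r sumr_const card_ord -[leLHS]mulr_natl.
case: j {IH} => [|j]; first by rewrite !mul0r mulr0.
rewrite /= exprS.
have -> : j.+1%:R * (B.+1%:R * B.+1%:R ^+ j) * T 0%N = B.+1%:R * (j.+1%:R * B.+1%:R ^+ j * T 0%N).
  by rewrite !mulrA [j.+1%:R * B.+1%:R]mulrC.
by rewrite ler_wpM2r ?ler_nat // !mulr_ge0 ?exprn_ge0.
Qed.

Lemma iter_prod_sum_ge0 d B j T c : (forall n, 0 <= T n) -> 0 <= iter_prod_sum d B j T c.
Proof. by move=> T0; elim: j c => [|j IH] c //=; apply: sumr_ge0 => h _; apply: IH. Qed.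

Lemma sum_iter_prod_le (d B M : nat) (D : R) T : 0 <= D -> (forall n, 0 <= T n) ->
  (forall n, (0 < n <= M)%N -> (tau n)%:R <= D) ->
  forall j A, (A * ((d + j) * B) ^ j <= M)%N ->
  \sum_(c < A) iter_prod_sum d B j T c.+1 <= D ^+ j * \sum_(n < M) T n.+1.
Proof.
move=> D0 T0 hD; elim=> [|j IH] A AM.
  rewrite expr0 mul1r /=; move: AM; rewrite expn0 muln1 => AM.
  rewrite (big_ord_widen _ (fun n => T n.+1) AM) [leLHS]big_mkcond.
  by apply: ler_sum => i _; case: ifP.
have dj : (0 < d + j.+1)%N by rewrite addnS.
have [B0|Bp] := posnP B.
  rewrite /= B0 big1; last by move=> i _; rewrite big_ord0.
  by rewrite mulr_ge0 ?exprn_ge0 ?sumr_ge0.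
have le1 : (A * (d + j.+1) * B <= M)%N.
  apply: leq_trans AM; rewrite -mulnA leq_mul2l expnS leq_pmulr ?orbT //.
  by rewrite expn_gt0 muln_gt0 dj Bp.
rewrite /= ; apply: le_trans (@sum_products_le A B (d + j.+1) D (iter_prod_sum d B j T) dj _ _) _.
- by move=> n; exact: iter_prod_sum_ge0.
- by move=> n /andP[n0 nA]; apply: hD; rewrite n0 (leq_trans nA).
rewrite exprS -mulrA ler_wpM2l //; apply: IH.
apply: leq_trans AM; rewrite expnS -!(mulnA A) !leq_mul2l.
case: j {le1 dj} => [|j]; first by rewrite !expn0 !orbT.
by rewrite leq_exp2r // leq_mul2r addnS leqnSn !orbT.
Qed.

End ProductSums.

(** * Nonnegative trigonometric polynomials *)

Section TrigonometricPolynomials.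
Variable R : realType.
Implicit Types (f : R -> R[i]) (g : R -> R) (B M : nat).

Definition trig_poly B f : Prop :=
  exists (I : finType) (c : I -> R[i]) (n : I -> int),
    (forall i, (`|n i| <= B)%N) /\ forall t, f t = \sum_i c i * ee ((n i)%:~R * t).

Lemma eq_trig_poly B f f' : f =1 f' -> trig_poly B f -> trig_poly B f'.
Proof. by move=> e [I [c [n [hn hf]]]]; exists I, c, n; split=> // t; rewrite -e. Qed.

Lemma trig_poly_exp B (c : R[i]) (n : nat) : (n <= B)%N ->
  trig_poly B (fun t => c * ee (n%:R * t)).
Proof.
move=> nB; exists unit, (fun=> c), (fun=> n%:Z); split => // t.
by rewrite (big_pred1 tt) // => -[].
Qed.

Lemma trig_polyD B f f' : trig_poly B f -> trig_poly B f' ->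
  trig_poly B (fun t => f t + f' t).
Proof.
move=> [I [c [n [hn hf]]]] [I' [c' [n' [hn' hf']]]].
exists (I + I')%type, (fun i => match i with inl x => c x | inr x => c' x end),
  (fun i => match i with inl x => n x | inr x => n' x end).
by split=> [[]//|t]; rewrite big_sumType /= hf hf'.
Qed.

Lemma trig_poly_sum B (J : Type) (r : seq J) (f : J -> R -> R[i]) :
  (forall j, trig_poly B (f j)) -> trig_poly B (fun t => \sum_(j <- r) f j t).
Proof.
move=> h; elim: r => [|j r IH].
  apply: eq_trig_poly (trig_poly_exp 0 (leq0n B)) => t /=.
  by rewrite mul0r big_nil.
by apply: eq_trig_poly (trig_polyD (h j) IH) => t; rewrite big_cons.
Qed.

Lemma trig_polyM B B' f f' : trig_poly B f -> trig_poly B' f' ->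
  trig_poly (B + B') (fun t => f t * f' t).
Proof.
move=> [I [c [n [hn hf]]]] [I' [c' [n' [hn' hf']]]].
exists (I * I')%type, (fun i => c i.1 * c' i.2), (fun i => n i.1 + n' i.2).
split=> [i|t]; first by have := hn i.1; have := hn' i.2; lia.
rewrite hf hf' big_distrl -(pair_bigA _ (fun x y => c x * c' y * ee ((n x + n' y)%:~R * t))) /=.
apply: eq_bigr => x _; rewrite big_distrr; apply: eq_bigr => y _.
by rewrite intrD mulrDl eeD mulrACA.
Qed.

Lemma trig_polyX B f m : trig_poly B f -> trig_poly (m * B) (fun t => f t ^+ m).
Proof.
move=> h; elim: m => [|m IH].
  by apply: eq_trig_poly (trig_poly_exp 1 (leq0n 0)) => t; rewrite mul0r ee0 mulr1.
rewrite mulSn; apply: eq_trig_poly (trig_polyM h IH) => t; by rewrite exprS.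
Qed.

Lemma trig_poly_conj B f : trig_poly B f -> trig_poly B (fun t => ((f t)^*)%C).
Proof.
move=> [I [c [n [hn hf]]]]; exists I, (fun i => ((c i)^*)%C), (fun i => - n i).
split=> [i|t]; first by rewrite abszN.
by rewrite hf conj_sum; apply: eq_bigr => i _; rewrite conjM -eeN mulrNz mulNr.
Qed.

Lemma trig_poly_cabs12 B f : trig_poly B f ->
  trig_poly (12 * B) (fun t => ((cabs (f t) ^+ 12)%:C)%C).
Proof.
move=> h; have := trig_polyX 6 (trig_polyM h (trig_poly_conj h)).
rewrite addnn -mul2n mulnA; apply: eq_trig_poly => t.
by rewrite -cabs_sqr -(rmorphXn (real_complex R)) -exprM.
Qed.

(** For a trigonometric polynomial of degree below [M] this is the integral
over a period. *)
Definition grid_mean M g : R := M%:R^-1 * \sum_(j < M) g (j%:R / M%:R).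

Lemma grid_mean_ge0 M g : (forall t, 0 <= g t) -> 0 <= grid_mean M g.
Proof. by move=> h; rewrite mulr_ge0 ?invr_ge0 // sumr_ge0. Qed.

Lemma trig_poly_grid_mean B M (g : R -> R -> R) :
  (forall s, trig_poly B (fun t => ((g t s)%:C)%C)) ->
  trig_poly B (fun t => ((grid_mean M (g t))%:C)%C).
Proof.
move=> h.
have := trig_polyM (trig_poly_exp (((M%:R^-1 : R)%:C)%C) (leq0n 0))
  (trig_poly_sum (index_enum 'I_M) (fun j => h (j%:R / M%:R))).
apply: eq_trig_poly => t; rewrite mul0r ee0 mulr1 -(rmorph_sum (real_complex R)).
by rewrite -(rmorphM (real_complex R)).
Qed.

(** Only the constant coefficient survives on either side. *)
Lemma grid_mean_shift B M g t0 : (B < M)%N ->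
  trig_poly B (fun t => ((g t)%:C)%C) ->
  grid_mean M (fun t => g (t0 + t)) = grid_mean M g.
Proof.
move=> BM [I [c [n [hn hf]]]]; rewrite /grid_mean; congr (_ * _); apply: (@complexI R).
have h s : ((\sum_(j < M) g (s + j%:R / M%:R))%:C)%C =
   \sum_i c i * (if n i == 0 then M%:R else 0).
  rewrite (rmorph_sum (real_complex R)) /=; under eq_bigr do rewrite hf.
  rewrite exchange_big /=; apply: eq_bigr => i _; rewrite -big_distrr /=.
  congr (_ * _); under eq_bigr do rewrite mulrDr eeD mulrCA.
  rewrite -big_distrr /= orthogonality ?(leq_ltn_trans (hn i)) //.
  by case: eqP => [->|_]; rewrite ?mulr0 // mul0r ee0 mul1r.
by rewrite (h t0) -(h 0); under eq_bigr do rewrite add0r.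
Qed.

Lemma peak_sum_symmetric B H al : 0 <= H ->
  \sum_(k < (2 * B).+1) peak H ((k%:R - B%:R) * al) <= 2 * \sum_(k < B.+1) peak H (k%:R * al) :> R.
Proof.
move=> H0; rewrite mul2n -addnn -addnS big_split_ord /=.
have -> : \sum_(i < B) peak H ((i%:R - B%:R) * al) = \sum_(i < B) peak H (i.+1%:R * al).
  rewrite (reindex_inj rev_ord_inj) /=; apply: eq_bigr => i _.
  by rewrite natrB // addrAC subrr add0r mulNr peak_opp.
have -> : \sum_(i < B.+1) peak H (((B + i)%:R - B%:R) * al) = \sum_(i < B.+1) peak H (i%:R * al).
  by apply: eq_bigr => i _; rewrite natrD addrAC subrr add0r.
rewrite mulrDl mul1r lerD2r big_ord_recl /=.
by under eq_bigr do rewrite /bump; rewrite lerDr peak_ge0.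
Qed.

(** Interpolate [g] by its Fourier coefficients, which are at most its mean in
absolute value because [g] is nonnegative; each frequency then contributes a
geometric sum over the progression. *)
Lemma progression_sum_le B M g (Z : nat) (t0 al : R) :
  (2 * B < M)%N -> (0 < Z)%N -> (forall t, 0 <= g t) ->
  trig_poly B (fun t => ((g t)%:C)%C) ->
  \sum_(z < Z) g (t0 + z%:R * al) <=
    4 * grid_mean M g * \sum_(k < B.+1) peak Z%:R (k%:R * al).
Proof.
move=> BM Z0 g0 [I [c [n [hn hf]]]].
have M0 : (M%:R : R[i]) != 0 by rewrite pnatr_eq0 -lt0n (leq_ltn_trans _ BM).
pose fr (k : nat) : int := k%:Z - B%:Z.
pose G (k : nat) : R[i] := M%:R^-1 * \sum_(j < M) ((g (j%:R / M%:R))%:C)%C *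
   ee (- ((fr k)%:~R * (j%:R / M%:R))).
have interp t : ((g t)%:C)%C = \sum_(k < (2 * B).+1) G k * ee ((fr k)%:~R * t).
  have Ge (k : 'I_(2 * B).+1) : G k = \sum_i c i * (if n i == fr k then 1 else 0).
    rewrite /G; under eq_bigr do rewrite hf big_distrl.
    rewrite exchange_big big_distrr /=; apply: eq_bigr => i _.
    have e j : c i * ee ((n i)%:~R * (j%:R / M%:R)) * ee (- ((fr k)%:~R * (j%:R / M%:R)))
        = c i * ee (j%:R * ((n i - fr k)%:~R / M%:R)).
      by rewrite -mulrA -eeD -mulrBl mulrCA -mulrNz -intrD.
    under eq_bigr do rewrite e.
    rewrite -big_distrr /= orthogonality.
      by rewrite subr_eq0; case: eqP => _; rewrite ?mulr0 // mulrCA mulVf.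
    by apply: leq_ltn_trans BM; have := hn i; have := ltn_ord k; rewrite /fr; lia.
  rewrite hf; under [RHS]eq_bigr => k _ do rewrite Ge big_distrl.
  rewrite exchange_big /=; apply: eq_bigr => i _.
  have ib : (`|(n i + B%:Z)%R| < (2 * B).+1)%N by have := hn i; lia.
  have frn : fr (Ordinal ib) = n i by rewrite /fr /=; have := hn i; lia.
  rewrite (bigD1 (Ordinal ib)) //= big1 ?addr0 => [|k ki].
    by rewrite frn eqxx mulr1.
  case: eqP => [e|_]; last by rewrite mulr0 mul0r.
  case/eqP: ki; apply/ord_inj => /=; move: e; rewrite /fr; lia.
have Gle k : cabs (G k) <= grid_mean M g.
  rewrite /G cabsM.
  have -> : cabs (M%:R^-1 : R[i]) = M%:R^-1.
    by rewrite -(rmorph_nat (real_complex R)) -(fmorphV (real_complex R)) cabs_real ger0_norm ?invr_ge0.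
  rewrite ler_wpM2l ?invr_ge0 //; apply: le_trans (cabs_sum _ _ _) _.
  by apply: ler_sum => j _; rewrite cabsM cabs_ee mulr1 cabs_real ger0_norm.
have -> : \sum_(z < Z) g (t0 + z%:R * al) = cabs ((\sum_(z < Z) g (t0 + z%:R * al))%:C)%C.
  by rewrite cabs_real ger0_norm // sumr_ge0.
rewrite (rmorph_sum (real_complex R)) /=; under eq_bigr do rewrite interp.
rewrite exchange_big /=.
have ZR : 0 < Z%:R :> R by rewrite ltr0n.
apply: (@le_trans _ _ (\sum_(k < (2 * B).+1) grid_mean M g * (2 * peak Z%:R ((k%:R - B%:R) * al)))).
  apply: le_trans (cabs_sum _ _ _) _; apply: ler_sum => k _.
  rewrite -big_distrr /= cabsM ler_pM ?cabs_ge0 //.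
  have := geometric_bound ((fr k)%:~R * al) ((fr k)%:~R * t0) ZR (lexx _).
  have -> : (fr k)%:~R = k%:R - B%:R :> R by rewrite /fr intrD mulrNz.
  apply: le_trans; apply: le_of_eq; congr cabs.
  by apply: eq_bigr => z _; congr ee; ring.
rewrite -big_distrr -big_distrr /= mulrCA mulrA [X in X * _](_ : _ = 2 * grid_mean M g) //.
apply: le_trans (ler_wpM2l _ (peak_sum_symmetric B al (ltW ZR))) _.
  by rewrite mulr_ge0 ?grid_mean_ge0.
by apply: le_of_eq; ring.
Qed.

End TrigonometricPolynomials.

(** * Means of cubic exponential sums *)

Section CubicMeans.
Variables (R : realType) (N : nat).
Hypothesis N0 : (0 < N)%N.
Let M := (24 * N ^ 3).+1.

Let linear_degree_lt : (12 * N < M)%N.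
Proof. by rewrite ltnS leq_mul // -[leqLHS]expn1 leq_pexp2l. Qed.

Definition cubic_sum (al be th : R) : R[i] :=
  \sum_(x < N) ee (al * x%:R ^+ 3 + be * x%:R ^+ 2 + th * x%:R).

Definition mean_linear (al be : R) : R :=
  grid_mean M (fun th => cabs (cubic_sum al be th) ^+ 12).

Definition mean_quadratic (al : R) : R := grid_mean M (mean_linear al).

Let cubic_trig (d B : nat) (u : 'I_N -> R) : (forall x : 'I_N, (x ^ d <= B)%N) ->
  trig_poly B (fun t => \sum_(x < N) ee (u x) * ee ((x ^ d)%:R * t)).
Proof. by move=> h; apply: trig_poly_sum => x; exact: trig_poly_exp. Qed.

Lemma cubic_trig_linear al be :
  trig_poly (12 * N) (fun th => ((cabs (cubic_sum al be th) ^+ 12)%:C)%C).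
Proof.
apply: trig_poly_cabs12.
apply: eq_trig_poly (@cubic_trig 1 N (fun x => al * x%:R ^+ 3 + be * x%:R ^+ 2) _) => [t|x].
  by apply: eq_bigr => x _; rewrite -eeD expn1 [_ * t]mulrC.
by rewrite expn1 ltnW.
Qed.

Lemma cubic_trig_quadratic al :
  trig_poly (12 * N ^ 2) (fun be => ((mean_linear al be)%:C)%C).
Proof.
apply: (@trig_poly_grid_mean _ _ _ (fun be th => cabs (cubic_sum al be th) ^+ 12)) => th.
apply: trig_poly_cabs12.
apply: eq_trig_poly (@cubic_trig 2 _ (fun x => al * x%:R ^+ 3 + th * x%:R) _) => [t|x].
  by apply: eq_bigr => x _; rewrite -eeD natrX; congr ee; ring.
by rewrite leq_exp2r // ltnW.
Qed.

Lemma cubic_trig_cubic :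
  trig_poly (12 * N ^ 3) (fun al => ((mean_quadratic al)%:C)%C).
Proof.
apply: (@trig_poly_grid_mean _ _ _ mean_linear) => be.
apply: (@trig_poly_grid_mean _ _ _ (fun al th => cabs (cubic_sum al be th) ^+ 12)) => th.
apply: trig_poly_cabs12.
apply: eq_trig_poly (@cubic_trig 3 _ (fun x => be * x%:R ^+ 2 + th * x%:R) _) => [t|x].
  by apply: eq_bigr => x _; rewrite -eeD natrX; congr ee; ring.
by rewrite leq_exp2r // ltnW.
Qed.

Lemma mean_linear_ge0 al be : 0 <= mean_linear al be.
Proof. by apply: grid_mean_ge0 => th; rewrite exprn_ge0 ?cabs_ge0. Qed.

Lemma mean_quadratic_ge0 al : 0 <= mean_quadratic al.
Proof. by apply: grid_mean_ge0 => be; exact: mean_linear_ge0. Qed.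

(** Orthogonality in all three coefficients. *)
Lemma mean_cubic : grid_mean M mean_quadratic = (mean_count N)%:R.
Proof.
have MN : (6 * N ^ 3 < M)%N by rewrite ltnS leq_mul2r orbT.
have M0 : (M%:R : R[i]) != 0 by rewrite pnatr_eq0.
have := sum_csum R MN (fun=> [set: 'I_N]) (fun=> [set: 'I_N]).
have pe (w : freq M) : (\prod_(i < 6) csum R w [set: 'I_N]) *
    (\prod_(i < 6) ((csum R w [set: 'I_N])^*)%C) =
    ((cabs (cubic_sum (w.2%:R / M%:R) (w.1.2%:R / M%:R) (w.1.1%:R / M%:R)) ^+ 12)%:C)%C.
  rewrite !prodr_const card_ord -exprMn -cabs_sqr -(rmorphXn (real_complex R)) -exprM.
  congr ((cabs _ ^+ 12)%:C)%C; rewrite /csum; under eq_bigl do rewrite inE.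
  apply: eq_bigr => x _; rewrite /cubic_phase -!eeD !natrX; congr ee; ring.
under eq_bigr do rewrite pe.
rewrite -(rmorph_sum (real_complex R)) -(rmorph_nat (real_complex R)).
move=> /(@complexI R) /= h.
rewrite -/(mean_count N) natrM natrX in h.
have M0' : (M%:R : R) != 0 by rewrite pnatr_eq0.
apply: (mulfI (expf_neq0 3 M0')); rewrite -h.
rewrite /mean_quadratic /mean_linear /grid_mean.
rewrite -(pair_bigA _ (fun (w : 'I_M * 'I_M) (j : 'I_M) => cabs (cubic_sum (j%:R / M%:R) (w.2%:R / M%:R) (w.1%:R / M%:R)) ^+ 12)) /=.
have e3 : M%:R ^+ 3 / M%:R / M%:R / M%:R = 1 :> R.
  by move: (M%:R : R) M0' => m m0; field.
rewrite exchange_big /= mulrA mulr_sumr; apply: eq_bigr => i _.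
rewrite -(pair_bigA _ (fun w2 w3 : 'I_M =>
  cabs (cubic_sum (i%:R / M%:R) (w3%:R / M%:R) (w2%:R / M%:R)) ^+ 12)) /=.
rewrite exchange_big /= mulrA mulr_sumr; apply: eq_bigr => j _.
by rewrite mulrA e3 mul1r.
Qed.

(** Completion: the indicator of the subinterval is expanded in characters
modulo [M], each of which shifts the linear coefficient. *)
Lemma subinterval_expansion al be th z n : (z + n <= N)%N ->
  \sum_(y < n) ee (al * (z + y)%:R ^+ 3 + be * (z + y)%:R ^+ 2 + th * (z + y)%:R) =
  M%:R^-1 * \sum_(j < M) (\sum_(y < n) ee (y%:R * (- (j%:R / M%:R)) + z%:R * (- (j%:R / M%:R))))
    * cubic_sum al be (th + j%:R / M%:R).
Proof.
move=> zn; have M0 : (M%:R : R[i]) != 0 by rewrite pnatr_eq0.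
have NM : (N <= M)%N by apply: ltnW; apply: leq_ltn_trans linear_degree_lt; rewrite leq_pmull.
apply: (mulfI M0); rewrite mulrA divff // mul1r mulr_sumr.
under [RHS]eq_bigr do rewrite big_distrl.
rewrite exchange_big /=; apply: eq_bigr => y _.
have zy : (z + y < N)%N by rewrite (leq_trans _ zn) // ltn_add2l.
under [RHS]eq_bigr do rewrite /cubic_sum big_distrr.
rewrite exchange_big (bigD1 (Ordinal zy)) //= [X in _ = _ + X]big1 ?addr0 => [|x xy].
  rewrite (_ : M%:R = \sum_(j < M) 1); last by rewrite sumr_const card_ord.
  by rewrite mulr_suml; apply: eq_bigr => j _; rewrite mul1r -eeD natrD; congr ee; ring.
have e j : ee (y%:R * (- (j%:R / M%:R)) + z%:R * (- (j%:R / M%:R))) *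
   ee (al * x%:R ^+ 3 + be * x%:R ^+ 2 + (th + j%:R / M%:R) * x%:R) =
   ee (al * x%:R ^+ 3 + be * x%:R ^+ 2 + th * x%:R) *
   ee (j%:R * ((x%:R - (z + y)%:R) / M%:R)) :> R[i].
  by rewrite -!eeD natrD; congr ee; ring.
under eq_bigr do rewrite e.
rewrite -big_distrr /= orthogonality_nat ?(leq_trans _ NM) //.
case: eqP => [h|_]; last by rewrite mulr0.
by case/eqP: xy; apply/ord_inj.
Qed.

(** The kernel of the completion has total mass [O(log)] and is pointwise
[O(Y / M)]: Jensen converts the twelfth power into a mean over shifts of the
linear coefficient. *)
Lemma subinterval_bound (J Y : nat) al be th z n : (0 < Y)%N -> (n <= Y <= N)%N ->
  (z + n <= N)%N -> (M * Y <= J)%N ->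
  cabs (\sum_(y < n) ee (al * (z + y)%:R ^+ 3 + be * (z + y)%:R ^+ 2 + th * (z + y)%:R)) ^+ 12
   <= (256 * (1 + harm R J)) ^+ 11 * (2 * Y%:R) * mean_linear al be.
Proof.
move=> Y0 /andP[nY YN] zn MYJ; rewrite subinterval_expansion //.
have NM : (N <= M)%N by apply: ltnW; apply: leq_ltn_trans linear_degree_lt; rewrite leq_pmull.
have YR : 0 < Y%:R :> R by rewrite ltr0n.
have MR : 0 < M%:R :> R by rewrite ltr0n.
pose w (j : 'I_M) : R := 2 * peak Y%:R (j%:R * M%:R^-1 + 0) / M%:R.
pose F (j : 'I_M) : R := cabs (cubic_sum al be (th + j%:R / M%:R)).
have mm0 t : 0 <= peak Y%:R t :> R by rewrite peak_ge0.
have w0 j : 0 <= w j := divr_ge0 (mulr_ge0 (ler0n _ 2) (mm0 _)) (ltW MR).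
have F0 j : 0 <= F j by exact: cabs_ge0.
have hw : \sum_j w j <= 256 * (1 + harm R J).
  rewrite -mulr_suml -mulr_sumr ler_pdivrMr //.
  have := @sum_peak_rational R M J M%:R^-1 0 Y%:R M%:R 1 M (ltn0Sn _) (coprime1n _) YR.
  rewrite -natrM ler_nat => /(_ MYJ); rewrite divff ?gt_eqF // subrr normr0 mulr0 addr0.
  move=> /(_ erefl).
  rewrite (natrM R M Y) [M%:R * Y%:R]mulrC mulfK ?gt_eqF //.
  have YM : Y%:R <= M%:R :> R by rewrite ler_nat (leq_trans YN).
  move: (\sum_(_ < _) _) => S; have := harm_ge0 R J.
  move: (harm R J) (M%:R) (Y%:R) MR YR YM => h m y m0 y0 ym h0 hS.
  have : (1 + h) * (y + m + y + m) <= (1 + h) * (4 * m) by rewrite ler_wpM2l //; lra.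
  by lra.
apply: (@le_trans _ _ ((\sum_j w j * F j) ^+ 12)).
  rewrite lerXn2r ?nnegrE ?cabs_ge0 //; first by apply: sumr_ge0 => j _; rewrite mulr_ge0.
  rewrite cabsM -(rmorph_nat (real_complex R)) -(fmorphV (real_complex R)) cabs_real.
  rewrite ger0_norm ?invr_ge0 ?(ltW MR) // -ler_pdivlMl ?invr_gt0 // invrK.
  apply: le_trans (cabs_sum _ _ _) _; rewrite mulr_sumr; apply: ler_sum => j _.
  rewrite cabsM [leRHS]mulrA; apply: ler_pM; rewrite ?cabs_ge0 // [leRHS]mulrC /w divfK ?gt_eqF // addr0.
  rewrite -peak_opp; apply: geometric_bound => //; rewrite ler_nat //.
have W0 : 0 <= \sum_j w j := sumr_ge0 _ (fun j _ => w0 j).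
apply: le_trans (jensen_pow 11 w0 F0) _; rewrite -mulrA; apply: ler_pM.
- exact: exprn_ge0.
- by apply: sumr_ge0 => j _; rewrite mulr_ge0 ?exprn_ge0.
- move: (\sum_j w j) (256 * _) W0 hw => s t s0 st.
  by rewrite lerXn2r ?nnegrE // (le_trans s0).
rewrite /mean_linear -(@grid_mean_shift _ (12 * N) M _ th _ (cubic_trig_linear al be)).
  rewrite /grid_mean mulrA mulr_sumr; apply: ler_sum => j _.
  rewrite ler_wpM2r ?exprn_ge0 // /w ler_pM2r ?invr_gt0 // ler_pM2l //.
  by apply: peak_le; exact: ltW.
exact: linear_degree_lt.
Qed.

End CubicMeans.

(** * Individual cubic exponential sums *)

Section CubicWeyl.
Variables (R : realType) (Y : nat).
Hypothesis Y0 : (0 < Y)%N.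

Definition peak_sum (ga : R) : R := \sum_(n < (144 * Y ^ 2).+1) peak Y%:R (n%:R * ga).

(** Unlike the bound [lam ^ -2] coming from a Dirichlet approximation, which
depends on the choice of [b / r], this sum over all fractions can be averaged
over [ga] term by term. *)
Definition rational_majorant (ga : R) : R := \sum_(r < Y) \sum_(b < r.+1)
  r.+1%:R ^- 2 * Y%:R ^- 3 * peak (Y%:R ^+ 3) (ga - b%:R / r.+1%:R).

Lemma peak_sum_ge0 ga : 0 <= peak_sum ga.
Proof. by apply: sumr_ge0 => n _; rewrite peak_ge0. Qed.

Lemma cubic_horner (Q : {poly R}) x : (size Q <= 4)%N ->
  Q.[x] = Q`_0 + Q`_1 * x + Q`_2 * x ^+ 2 + Q`_3 * x ^+ 3.
Proof.
by move=> sQ; rewrite (horner_coef_wide _ sQ) !big_ord_recr big_ord0 /=; ring.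
Qed.

(** Writing the sum over [x] as a sum over [x + z] changes the quadratic
coefficient by [- 3 * z * ga].  Each [0 <= z < Y] gives a bound by
[mean_linear]; their average is a sum of a nonnegative trigonometric
polynomial along a progression, hence is controlled by its mean.  The factor 3
is absorbed by enlarging the range of frequencies in [peak_sum]. *)
Lemma cubic_vinogradov_bound (J : nat) (ga : R) (Q : {poly R}) Z :
  ((24 * (2 * Y) ^ 3).+1 * Y <= J)%N -> (Z <= Y)%N -> (size Q <= 4)%N -> Q`_3 = ga ->
  cabs (\sum_(x < Z) ee Q.[x%:R]) ^+ 12 <=
    (256 * (1 + harm R J)) ^+ 11 * (8 * mean_quadratic (2 * Y) ga * peak_sum ga).
Proof.
move=> hJ ZY sQ Q3; set S := cabs _.
have YR : 0 < Y%:R :> R by rewrite ltr0n.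
have N0 : (0 < 2 * Y)%N by rewrite muln_gt0.
have shift (z : 'I_Y) : S ^+ 12 <= (256 * (1 + harm R J)) ^+ 11 * (2 * Y%:R) *
    mean_linear (2 * Y) ga (Q`_2 + z%:R * (- (3 * ga))).
  have -> : S = cabs (\sum_(y < Z) ee (ga * (z + y)%:R ^+ 3
      + (Q`_2 + z%:R * (- (3 * ga))) * (z + y)%:R ^+ 2
      + (3 * ga * z%:R ^+ 2 - 2 * Q`_2 * z%:R + Q`_1) * (z + y)%:R)).
    pose c := Q`_0 - ga * z%:R ^+ 3 + Q`_2 * z%:R ^+ 2 - Q`_1 * z%:R.
    have ec u : cabs u = cabs (ee c * u) by rewrite cabsM cabs_ee mul1r.
    rewrite [RHS]ec mulr_sumr /S; congr cabs.
    apply: eq_bigr => y _; rewrite -eeD cubic_horner // Q3 natrD /c; congr ee; ring.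
  apply: subinterval_bound => //; first by rewrite ZY leq_pmull.
  by rewrite mul2n -addnn leq_add // ltnW.
have deg : (2 * (12 * (2 * Y) ^ 2) < (24 * (2 * Y) ^ 3).+1)%N.
  by rewrite ltnS mulnA leq_mul2l leq_pexp2l ?orbT.
have := progression_sum_le Q`_2 (- (3 * ga)) deg Y0 (mean_linear_ge0 (2 * Y) ga)
  (cubic_trig_quadratic (2 * Y) ga).
rewrite -/(mean_quadratic _ _) => tri.
rewrite -(ler_pM2l YR).
have -> : Y%:R * S ^+ 12 = \sum_(z < Y) S ^+ 12 by rewrite sumr_const card_ord mulr_natl.
apply: le_trans (ler_sum _ (fun z _ => shift z)) _.
rewrite -mulr_sumr.
have h0 : 0 <= (256 * (1 + harm R J)) ^+ 11.
  exact: exprn_ge0 (mulr_ge0 (ler0n _ _) (addr_ge0 ler01 (harm_ge0 R J))).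
move: ((256 * (1 + harm R J)) ^+ 11) h0 => C C0.
rewrite -[leLHS]mulrA [leRHS]mulrCA ler_wpM2l // [2 * _]mulrC -[leLHS]mulrA ler_pM2l //.
apply: (@le_trans _ _ (2 * (4 * mean_quadratic (2 * Y) ga * peak_sum ga))); last first.
  by apply: le_of_eq; ring.
rewrite ler_pM2l //; apply: le_trans tri _; rewrite ler_wpM2l //.
  by rewrite mulr_ge0 // mean_quadratic_ge0.
pose g (k : 'I_(12 * (2 * Y) ^ 2).+1) : 'I_(144 * Y ^ 2).+1 := inord (3 * k).
have gE k : g k = (3 * k)%N :> nat.
  rewrite inordK // ltnS (leq_trans (leq_mul (leqnn 3) (ltn_ord k : (k <= _)%N))) //.
  by rewrite expnMn !mulnA.
rewrite /peak_sum.
have gi : injective g.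
  by move=> i j /(congr1 val) /=; rewrite !gE => /eqP; rewrite eqn_mul2l /= => /eqP /ord_inj.
apply: le_trans (sum_inj_le gi (fun n => peak_ge0 (n%:R * ga) (ler0n R Y))).
apply: le_of_eq; apply: eq_bigr => k _.
by rewrite gE natrM mulrN peak_opp; congr peak; ring.
Qed.

(** Two differencing steps lead to linear phases, which are geometric sums;
the products of shifts collapse by the divisor bound. *)
Lemma cubic_weyl_bound (D : R) (ga : R) (Q : {poly R}) Z : 1 <= D ->
  (forall n, (0 < n <= 9 * Y ^ 2)%N -> (tau n)%:R <= D) ->
  (Z <= Y)%N -> (size Q <= 4)%N -> Q`_3 = ga ->
  cabs (\sum_(x < Z) ee Q.[x%:R]) ^+ 4 <= 64 * D ^+ 2 * Y%:R * (Y%:R ^+ 2 + peak_sum ga).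
Proof.
move=> D1 hD ZY sQ Q3.
have YR : 0 < Y%:R :> R by rewrite ltr0n.
pose T n : R := 2 * peak Y%:R (n%:R * ga).
have T0 n : 0 <= T n := mulr_ge0 (ler0n _ 2) (peak_ge0 _ (ler0n _ _)).
have hT n (P : {poly R}) X : (X <= Y)%N -> (size P <= 2)%N -> P`_1 = ga * n%:R ->
    cabs (\sum_(x < X) ee P.[x%:R]) <= T n.
  move=> XY sP P1.
  have -> : \sum_(x < X) ee P.[x%:R] = \sum_(x < X) ee (x%:R * (n%:R * ga) + P`_0).
    apply: eq_bigr => x _; congr ee; rewrite (horner_coef_wide _ sP) !big_ord_recr big_ord0 /=.
    by rewrite P1; ring.
  by apply: geometric_bound; rewrite // ler_nat.
have := @weyl_differencing R 1 Y T ga hT 2 1 Q Z ZY sQ.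
rewrite mulr1 => /(_ Q3) h; apply: le_trans h _.
have h1 := iter_diff_sum_le 1 Y.-1 2 1 (T0 0%N); rewrite prednK // in h1.
have h2 : iter_prod_sum 1 Y.-1 2 T 1 <= D ^+ 2 * \sum_(n < 9 * Y ^ 2) T n.+1.
  have := @sum_iter_prod_le R 1 Y.-1 (9 * Y ^ 2) D T (le_trans ler01 D1) T0 hD 2 1.
  by rewrite big_ord1 mul1n; apply; rewrite expnMn leq_mul // leq_exp2r // leq_pred.
have h3 : \sum_(n < 9 * Y ^ 2) T n.+1 <= 2 * \sum_(n < (144 * Y ^ 2).+1) peak Y%:R (n%:R * ga).
  rewrite -mulr_sumr ler_pM2l // [leRHS]big_ord_recl [leRHS]addrC -[leLHS]addr0 lerD ?peak_ge0 //.
  have le9 : (9 * Y ^ 2 <= 144 * Y ^ 2)%N by rewrite leq_mul2r orbT.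
  rewrite (big_ord_widen _ (fun n => peak Y%:R (n.+1%:R * ga)) le9) [leLHS]big_mkcond.
  by apply: ler_sum => n _; case: ifP => // _; rewrite peak_ge0.
have T00 : T 0%N <= 2 * Y%:R by rewrite ler_pM2l // peak_le.
have fin (y d t s S I X : R) : 0 < y -> 1 <= d -> t <= 2 * y -> X <= 2 * y * t + I ->
    I <= d * s -> s <= 2 * S -> 0 <= S -> 16 * y * X <= 64 * d * y * (y ^+ 2 + S).
  move=> y0 d1 ty hX hI hs S0.
  have -> : 64 * d * y * (y ^+ 2 + S) = 16 * y * (4 * (d * y ^+ 2) + 4 * (d * S)) by ring.
  rewrite ler_pM2l ?mulr_gt0 //.
  have a1 : d * s <= d * (2 * S) by rewrite ler_pM2l //; lra.
  have a2 : y * t <= y * (2 * y) by rewrite ler_pM2l.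
  have a3 : 1 * y ^+ 2 <= d * y ^+ 2 by rewrite ler_wpM2r ?sqr_ge0.
  have a4 : 0 <= d * S by rewrite mulr_ge0 //; lra.
  lra.
rewrite (_ : 2 ^+ (2 ^ 2) = 16 :> R); last by rewrite -natrX.
exact: (fin _ _ _ _ _ _ _ YR (exprn_ege1 2 D1) T00 h1 h2 h3 (peak_sum_ge0 ga)).
Qed.

Lemma peak_sum_le (J : nat) (ga : R) (b : int) (r : nat) :
  ((144 * Y ^ 2).+1 * Y <= J)%N -> (0 < r <= Y ^ 2)%N -> coprimez b r%:Z ->
  `|r%:R * ga - b%:~R| <= Y%:R ^- 2 ->
  peak_sum ga <= 2 ^+ 14 * (1 + harm R J) *
    (Y%:R ^+ 3 / (r%:R + Y%:R ^+ 3 * `|r%:R * ga - b%:~R|) + Y%:R ^+ 2).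
Proof.
move=> hJ /andP[r0 rY] cop hd.
have Y1 : 1 <= Y%:R :> R by rewrite ler1n.
have YR : 0 < Y%:R :> R by lra.
have := @sum_peak_rational R (144 * Y ^ 2).+1 J ga 0 Y%:R _ b r r0 cop YR.
rewrite -natrM ler_nat => /(_ _ hJ erefl).
under eq_bigr do rewrite addr0.
move=> h; apply: le_trans h _.
have KE : ((144 * Y ^ 2).+1 * Y)%:R = (144 * Y%:R ^+ 2 + 1) * Y%:R :> R.
  by rewrite natrM -addn1 natrD natrM natrX.
have K1E : (144 * Y ^ 2).+1%:R = 144 * Y%:R ^+ 2 + 1 :> R.
  by rewrite -addn1 natrD natrM natrX.
rewrite KE K1E.
have r0R : 1 <= r%:R :> R by rewrite ler1n.
have rYR : r%:R <= Y%:R ^+ 2 :> R by rewrite -natrX ler_nat.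
have d0 := normr_ge0 (r%:R * ga - b%:~R).
have l0 : 0 < 1 + harm R J by rewrite ltr_pwDl // harm_ge0.
clear - Y1 r0R rYR d0 hd l0.
move: (1 + _) (Y%:R) (r%:R) (`|_|) Y1 r0R rYR d0 hd l0 => l y q d y1 r1 ry d0 hd l0.
have y0 : 0 < y by lra.
have yy : y <= y ^+ 2 by rewrite expr2 ler_peMl // ltW.
have y3 : 0 <= y ^+ 3 by rewrite exprn_ge0 // ltW.
have y23 : y ^+ 2 * y = y ^+ 3 by ring.
have yy3 : y <= y ^+ 3 by rewrite -y23 ler_peMl ?(ltW y0) // -(expr1n _ 2) lerXn2r ?nnegrE ?(ltW y0).
have dy : y ^+ 3 * d <= y.
  have {2}-> : y = y ^+ 3 * y ^- 2 by field; rewrite gt_eqF.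
  by rewrite ler_wpM2l.
have lam0 : 0 < q + y ^+ 3 * d by rewrite ltr_pwDl ?mulr_ge0 //; lra.
have hK : (144 * y ^+ 2 + 1) * y = 144 * y ^+ 3 + y by ring.
have lamle : q + y ^+ 3 * d <= q + (144 * y ^+ 2 + 1) * y * d.
  by rewrite lerD2l ler_wpM2r // hK; lra.
have a1 : (144 * y ^+ 2 + 1) * y / (q + (144 * y ^+ 2 + 1) * y * d)
    <= 145 * (y ^+ 3 / (q + y ^+ 3 * d)).
  rewrite mulrA; apply: ler_pM; rewrite ?invr_ge0; try lra.
  by rewrite lef_pV2 ?posrE ?(lt_le_trans lam0 lamle).
have a2 : (144 * y ^+ 2 + 1) * y * d <= 145 * y.
  have yd : y * d <= y ^+ 3 * d by rewrite ler_wpM2r.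
  by rewrite hK mulrDl -mulrA; lra.
have q0 : 0 <= y ^+ 3 / (q + y ^+ 3 * d) by rewrite divr_ge0 // ltW.
rewrite ![_ * l * _]mulrAC ler_wpM2r ?(ltW l0) //.
have y2 : 1 <= y ^+ 2 by lra.
have -> : 2 ^+ 14 = 128 * 128 :> R by ring.
lra.
Qed.

(** The term of [b / r], the numerator being reduced modulo [r], suffices,
because [r <= lam]. *)
Lemma rational_majorant_ge (ga : R) (b : int) (r : nat) : (0 < r <= Y)%N ->
  (r%:R + Y%:R ^+ 3 * `|r%:R * ga - b%:~R|) ^- 2 <= rational_majorant ga.
Proof.
move=> /andP[r0 rY].
have rR : 0 < r%:R :> R by rewrite ltr0n.
have YR : 0 < Y%:R :> R by rewrite ltr0n.
have Y3 : 0 < Y%:R ^+ 3 :> R by rewrite exprn_gt0.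
have t0 (s c : nat) : 0 <= s.+1%:R ^- 2 * Y%:R ^- 3 * peak (Y%:R ^+ 3) (ga - c%:R / s.+1%:R) :> R.
  by rewrite mulr_ge0 ?peak_ge0 ?mulr_ge0 ?invr_ge0 ?exprn_ge0.
have rP : (r.-1 < Y)%N by rewrite prednK.
rewrite /rational_majorant (bigD1 (Ordinal rP)) //=.
have b'0 : (0 <= b %% r)%Z by rewrite modz_ge0 // -lt0n.
have b'r : (`|(b %% r)%Z| < r.-1.+1)%N.
  by rewrite prednK // -ltz_nat gez0_abs // ltz_pmod.
rewrite (bigD1 (Ordinal b'r)) //= -addrA ler_wpDr //.
  rewrite addr_ge0 ?sumr_ge0 // => s _; exact: sumr_ge0.
rewrite prednK //; set lam := _ + _ * `|_|.
have lamr : r%:R <= lam by rewrite lerDl mulr_ge0 // ltW.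
have lam0 : 0 < lam by exact: lt_le_trans lamr.
have -> : ga - `|(b %% r)%Z|%:R / r%:R = ga - b%:~R / r%:R + (b %/ r)%Z%:~R.
  have -> : `|(b %% r)%Z|%:R = (b %% r)%Z%:~R :> R by rewrite -{2}(gez0_abs b'0) -pmulrn.
  have -> : b%:~R = (b %/ r)%Z%:~R * r%:R + (b %% r)%Z%:~R :> R.
    by rewrite [LHS](congr1 intr (divz_eq b r)) rmorphD rmorphM.
  by field; exact: lt0r_neq0.
rewrite peak_addint.
have h : Y%:R ^+ 3 * r%:R / lam <= peak (Y%:R ^+ 3) (ga - b%:~R / r%:R).
  have -> : Y%:R ^+ 3 * r%:R / lam = Y%:R ^+ 3 / (1 + Y%:R ^+ 3 * `|ga - b%:~R / r%:R|).
    have -> : `|ga - b%:~R / r%:R| = `|r%:R * ga - b%:~R| / r%:R.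
      have -> : r%:R * ga - b%:~R = r%:R * (ga - b%:~R / r%:R) by field; exact: lt0r_neq0.
      by rewrite normrM ger0_norm // [r%:R * _]mulrC mulfK ?lt0r_neq0.
    rewrite /lam; field; rewrite !lt0r_neq0 //.
  rewrite /peak ler_pM2l // lef_pV2 ?posrE ?ltr_pwDl ?mulr_ge0 ?dist_int_ge0 ?(ltW Y3) //.
  by rewrite lerD2l ler_pM2l //; have := dist_int_le (ga - b%:~R / r%:R) 0; rewrite subr0.
apply: le_trans (ler_wpM2l _ h); last by rewrite mulr_ge0 ?invr_ge0 ?exprn_ge0.
have -> : r%:R ^- 2 * Y%:R ^- 3 * (Y%:R ^+ 3 * r%:R / lam) = r%:R^-1 / lam.
  by field; rewrite !lt0r_neq0.
by rewrite expr2 invfM ler_pM2r ?invr_gt0 // lef_pV2 ?posrE.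
Qed.

(** For a Dirichlet approximation of level [Y ^ 2], the frequency sum of
[peak_sum] is [O(Y ^ 2)] when [lam >= Y], and [O(Y ^ 3 / lam)] otherwise. *)
Lemma cubic_dichotomy (J : nat) (D ga : R) :
  ((24 * (2 * Y) ^ 3).+1 * Y <= J)%N -> ((144 * Y ^ 2).+1 * Y <= J)%N ->
  1 <= D -> (forall n, (0 < n <= 9 * Y ^ 2)%N -> (tau n)%:R <= D) ->
  forall (Q : {poly R}) Z, (Z <= Y)%N -> (size Q <= 4)%N -> Q`_3 = ga ->
  forall S : R, S = cabs (\sum_(x < Z) ee Q.[x%:R]) ->
  S ^+ 12 <= (256 * (1 + harm R J)) ^+ 11 *
    (8 * mean_quadratic (2 * Y) ga * (2 ^+ 15 * (1 + harm R J) * Y%:R ^+ 2)) \/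
  S ^+ 8 <= (64 * D ^+ 2 * (2 ^+ 16 * (1 + harm R J))) ^+ 2 * Y%:R ^+ 8 * rational_majorant ga.
Proof.
move=> hJ1 hJ2 D1 hD Q Z ZY sQ Q3 S SE.
have [|r [b [r0 cop hd]]] := @dirichlet R ga (Y ^ 2); first by rewrite expn_gt0 Y0.
rewrite natrX in hd.
have YR : 0 < Y%:R :> R by rewrite ltr0n.
have l1 : 1 <= 1 + harm R J by rewrite lerDl harm_ge0.
have := peak_sum_le hJ2 r0 cop hd; set lam := r%:R + _ => hS.
have rR : 1 <= r%:R :> R by case/andP: r0 => r0 _; rewrite ler1n.
have lam0 : 0 < lam by rewrite ltr_pwDl ?mulr_ge0 ?exprn_ge0 //; lra.
have [lamY|lamY] := leP Y%:R lam.
  left; rewrite SE; apply: le_trans (cubic_vinogradov_bound hJ1 ZY sQ Q3) _.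
  rewrite ler_wpM2l ?(exprn_ge0 _ (mulr_ge0 (ler0n _ _) (le_trans ler01 l1))) //.
  rewrite (ler_wpM2l (mulr_ge0 (ler0n _ 8) (mean_quadratic_ge0 _ _))) //.
  apply: le_trans hS _.
  have : Y%:R ^+ 3 / lam <= Y%:R ^+ 2.
    by rewrite ler_pdivrMr // exprSr ler_pM2l ?exprn_gt0.
  move: (Y%:R ^+ 3 / lam) (Y%:R ^+ 2) (1 + harm R J) l1 => u v l l1 uv.
  have -> : 2 ^+ 15 * l * v = 2 ^+ 14 * (l * (2 * v)) by ring.
  by rewrite -mulrA ler_pM2l ?exprn_gt0 // ler_pM2l; lra.
right.
have S4 := cubic_weyl_bound D1 hD ZY sQ Q3; rewrite -SE in S4.
have Y2 : Y%:R ^+ 2 <= Y%:R ^+ 3 / lam.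
  by rewrite ler_pdivlMr // (exprSr _ 2) ler_pM2l ?exprn_gt0 // ltW.
have {hS S4} S4 : S ^+ 4 <= 64 * D ^+ 2 * (2 ^+ 16 * (1 + harm R J)) * (Y%:R ^+ 4 / lam).
  apply: le_trans S4 _.
  have -> : 64 * D ^+ 2 * (2 ^+ 16 * (1 + harm R J)) * (Y%:R ^+ 4 / lam) =
    64 * D ^+ 2 * Y%:R * (2 ^+ 16 * (1 + harm R J) * (Y%:R ^+ 3 / lam)) by ring.
  rewrite (ler_wpM2l (mulr_ge0 (mulr_ge0 (ler0n _ 64) (sqr_ge0 D)) (ltW YR))) //.
  move: (Y%:R ^+ 3 / lam) (Y%:R ^+ 2) (peak_sum ga) (1 + harm R J) (exprn_gt0 2 YR) Y2 l1 hS.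
  move=> u v s l v0 vu l1 hs.
  have h1 : l * (u + v) <= l * (2 * u) by rewrite ler_pM2l; lra.
  have h2 : 1 * u <= l * u by rewrite ler_wpM2r //; lra.
  have -> : 2 ^+ 16 * l * u = 2 ^+ 14 * (l * (2 * u)) + 2 ^+ 14 * (2 * (l * u)) by ring.
  have h3 : v <= 2 ^+ 14 * (2 * (l * u)).
    apply: (@le_trans _ _ (2 * (l * u))); first lra.
    by rewrite ler_peMl ?exprn_ege1 ?ler1n //; lra.
  rewrite addrC lerD // (le_trans hs) // -mulrA ler_pM2l // exprn_gt0 //.
have rY : (0 < r <= Y)%N.
  case/andP: r0 => -> _ /=; rewrite -(ler_nat R); apply: le_trans (ltW lamY).
  by rewrite lerDl mulr_ge0 ?exprn_ge0.
rewrite -[8%N]/(4 * 2)%N !exprM.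
have S40 : 0 <= S ^+ 4 by rewrite exprn_ge0 // SE cabs_ge0.
move: (64 * _ * (2 ^+ 16 * _)) S4 => C S4.
apply: (@le_trans _ _ ((C * (Y%:R ^+ 4 / lam)) ^+ 2)).
  by rewrite lerXn2r ?nnegrE // (le_trans S40).
have -> : (C * (Y%:R ^+ 4 / lam)) ^+ 2 = C ^+ 2 * (Y%:R ^+ 4) ^+ 2 * lam ^- 2.
  by rewrite !exprMn exprVn mulrA.
apply: ler_wpM2l (mulr_ge0 (sqr_ge0 C) (sqr_ge0 _)) _ _ _.
exact: rational_majorant_ge.
Qed.

End CubicWeyl.

(** * Majorants summed over multiples *)

Section SumsOverMultiples.
Variables (R : realType) (al : R) (a : int) (q : nat).
Hypotheses (q0 : (0 < q)%N) (cop : coprimez a q%:Z).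

(** [mean_quadratic] is itself a nonnegative trigonometric polynomial in the
leading coefficient, with mean [mean_count N]. *)
Lemma sum_mean_quadratic_le (N n J : nat) (lam : R) : (0 < N)%N -> (0 < n)%N ->
  ((12 * N ^ 3).+1 * n <= J)%N ->
  lam = q%:R + (12 * N ^ 3).+1%:R * n%:R * `|q%:R * al - a%:~R| ->
  \sum_(m < n) mean_quadratic N (m.+1%:R * al) <= (mean_count N)%:R *
    (128 * (1 + harm R J) * ((12 * N ^ 3).+1%:R * n%:R / lam + (12 * N ^ 3).+1%:R + n%:R + lam)).
Proof.
move=> N0 n0 hJ lamE.
have deg : (2 * (12 * N ^ 3) < (24 * N ^ 3).+1)%N by rewrite ltnS mulnA.
have := progression_sum_le al al deg n0 (@mean_quadratic_ge0 R N) (cubic_trig_cubic R N).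
rewrite mean_cubic // => h.
have e : \sum_(z < n) mean_quadratic N (al + z%:R * al) =
   \sum_(m < n) mean_quadratic N (m.+1%:R * al).
  by apply: eq_bigr => z _; rewrite -natr1 mulrDl mul1r addrC.
rewrite e in h; apply: le_trans h _.
have nR : 0 < n%:R :> R by rewrite ltr0n.
have := @sum_peak_rational R (12 * N ^ 3).+1 J al 0 n%:R lam a q q0 cop nR.
rewrite -(natrM R (12 * N ^ 3).+1 n) ler_nat => /(_ hJ).
rewrite (natrM R (12 * N ^ 3).+1 n) => /(_ lamE).
under eq_bigr do rewrite addr0.
move=> h; rewrite [4 * _]mulrC -[leLHS]mulrA ler_wpM2l //.
by move: h; move: (\sum_(_ < _) _) (1 + _) (_ + lam) => S l v h; lra.
Qed.

Lemma sum_rational_majorant_le (Y n J : nat) (lam : R) : (0 < Y)%N ->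
  (n * Y ^ 3 <= J)%N -> lam = q%:R + n%:R * Y%:R ^+ 3 * `|q%:R * al - a%:~R| ->
  \sum_(m < n) rational_majorant Y (m.+1%:R * al) <= Y%:R ^- 3 * harm R Y *
    (32 * (1 + harm R J) * (n%:R * Y%:R ^+ 3 / lam + n%:R + Y%:R ^+ 3 + lam)).
Proof.
move=> Y0 hJ lamE; set W := 32 * _ * _.
have YR : 0 < Y%:R ^+ 3 :> R by rewrite exprn_gt0 // ltr0n.
have hW rho : \sum_(m < n) peak (Y%:R ^+ 3) (m%:R * al + rho) <= W.
  by apply: (@sum_peak_rational R n J al rho (Y%:R ^+ 3) lam a q); rewrite // -natrX -natrM ler_nat.
rewrite exchange_big /= /harm mulr_sumr mulr_suml; apply: ler_sum => r _.
rewrite exchange_big /=.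
have rR : 0 < r.+1%:R :> R by rewrite ltr0n.
apply: (@le_trans _ _ (\sum_(b < r.+1) r.+1%:R ^- 2 * Y%:R ^- 3 * W)).
  apply: ler_sum => b _; rewrite -mulr_sumr ler_wpM2l ?mulr_ge0 ?invr_ge0 ?exprn_ge0 //.
  apply: le_trans (hW (al - b%:R / r.+1%:R)); apply: le_of_eq.
  by apply: eq_bigr => m _; congr peak; rewrite -natr1; ring.
rewrite sumr_const card_ord -[leLHS]mulr_natl mulrA ler_wpM2r //.
  apply: le_trans (hW 0); apply: sumr_ge0 => m _; apply: peak_ge0; exact: ltW.
apply: le_of_eq; field.
by rewrite ?lt0r_neq0 ?ltr0n.
Qed.

End SumsOverMultiples.

(** * Reduction to cubic sums *)

Section Assembly.
Variable R : realType.

(** A linear bound from a bound for a power: either [s <= A], or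
[s <= s ^ (m + 1) / A ^ m].  It is sharp on average when [A ^ (m + 1)] is the
average of [W]. *)
Lemma le_from_power (s A W : R) (m : nat) : 0 <= s -> 0 < A -> 0 <= W ->
  s ^+ m.+1 <= W -> s <= A + W / A ^+ m.
Proof.
move=> s0 A0 W0 h; have Am : 0 < A ^+ m by rewrite exprn_gt0.
have [sA|As] := leP s A; first by rewrite ler_wpDr // divr_ge0 // ltW.
rewrite ler_wpDl ?(ltW A0) // ler_pdivlMr //; apply: le_trans h.
by rewrite exprS ler_wpM2l // lerXn2r ?nnegrE // ltW.
Qed.

(** Assembles differencing and the divisor bound.  The majorants [V8] and [V12]
enter through [le_from_power], with [A8] and [A12] calibrated to their
averages, which makes the sum over [n] linear in them. *)
Lemma cubic_reduction (Y j n : nat) (al D C8 C12 A8 A12 : R) (V8 V12 : R -> R) (P : {poly R}) (Z : nat) :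
  (0 < Y)%N -> (((3 + j) * Y) ^ j <= n)%N -> 1 <= D ->
  (forall m, (0 < m <= n)%N -> (tau m)%:R <= D) ->
  0 < A8 -> 0 < A12 -> 0 <= C8 -> 0 <= C12 ->
  (forall t, 0 <= V8 t) -> (forall t, 0 <= V12 t) ->
  (forall m (Q : {poly R}) X, (X <= Y)%N -> (size Q <= 4)%N -> Q`_3 = al * m.+1%:R ->
    forall S, S = cabs (\sum_(x < X) ee Q.[x%:R]) ->
    S ^+ 12 <= C12 * V12 (m.+1%:R * al) \/ S ^+ 8 <= C8 * V8 (m.+1%:R * al)) ->
  C8 * \sum_(m < n) V8 (m.+1%:R * al) <= n%:R * A8 ^+ 8 ->
  C12 * \sum_(m < n) V12 (m.+1%:R * al) <= n%:R * A12 ^+ 12 ->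
  (Z <= Y)%N -> (size P <= (3 + j).+1)%N -> P`_(3 + j) = al ->
  cabs (\sum_(x < Z) ee P.[x%:R]) ^+ (2 ^ j) <=
    2 ^+ (2 ^ j) * Y%:R ^+ (2 ^ j - j - 1) *
    (j%:R * Y%:R ^+ j + D ^+ j * (n%:R * (2 * (A8 + A12)))).
Proof.
move=> Y0 jn D1 hD A80 A120 C80 C120 V80 V120 hV S8 S12 ZY sP Pj.
pose T m : R := if m is m'.+1 then (A12 + C12 * V12 (m'.+1%:R * al) / A12 ^+ 11) +
   (A8 + C8 * V8 (m'.+1%:R * al) / A8 ^+ 7) else Y%:R.
have T120 m : 0 <= A12 + C12 * V12 (m.+1%:R * al) / A12 ^+ 11.
  exact: addr_ge0 (ltW A120) (divr_ge0 (mulr_ge0 C120 (V120 _)) (exprn_ge0 11 (ltW A120))).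
have T80 m : 0 <= A8 + C8 * V8 (m.+1%:R * al) / A8 ^+ 7.
  exact: addr_ge0 (ltW A80) (divr_ge0 (mulr_ge0 C80 (V80 _)) (exprn_ge0 7 (ltW A80))).
have T0 m : 0 <= T m by case: m => [|m] //=; exact: addr_ge0.
have hT m (Q : {poly R}) X : (X <= Y)%N -> (size Q <= 4)%N -> Q`_3 = al * m%:R ->
    cabs (\sum_(x < X) ee Q.[x%:R]) <= T m.
  move=> XY sQ Q3; case: m Q3 => [|m] Q3 /=.
    apply: le_trans (cabs_sum _ _ _) _; under eq_bigr do rewrite cabs_ee.
    by rewrite sumr_const card_ord ler_nat.
  have s0 := cabs_ge0 (\sum_(x < X) ee Q.[x%:R]).
  have [h|h] := hV _ _ _ XY sQ Q3 _ erefl.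
    apply: ler_wpDr => //; apply: le_from_power => //; exact: mulr_ge0.
  apply: ler_wpDl => //; apply: le_from_power => //; exact: mulr_ge0.
have := @weyl_differencing R 3 Y T al hT j 1 P Z ZY sP.
rewrite mulr1 => /(_ Pj) h; apply: le_trans h _.
rewrite ler_wpM2l ?mulr_ge0 ?exprn_ge0 //.
have h1 := iter_diff_sum_le 3 Y.-1 j 1 (T0 0%N); rewrite prednK // in h1.
apply: le_trans h1 _; apply: lerD.
  by rewrite /T; case: (j) => [|i]; rewrite ?mul0r // -mulrA -exprSr.
have h2 := @sum_iter_prod_le R 3 Y.-1 n D T (le_trans ler01 D1) T0 hD j 1.
rewrite big_ord1 mul1n in h2; apply: le_trans (h2 _) _.
  by apply: leq_trans jn; case: (j) => // i; rewrite leq_exp2r // leq_mul2l leq_pred orbT.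
rewrite ler_wpM2l ?exprn_ge0 ?(le_trans ler01 D1) //= !big_split /= !sumr_const card_ord.
rewrite -!mulr_suml -!mulr_sumr -[A12 *+ n]mulr_natl -[A8 *+ n]mulr_natl.
have a12 : (C12 * \sum_(i < n) V12 (i.+1%:R * al)) / A12 ^+ 11 <= n%:R * A12.
  by rewrite ler_pdivrMr ?exprn_gt0 // -mulrA -exprS.
have a8 : (C8 * \sum_(i < n) V8 (i.+1%:R * al)) / A8 ^+ 7 <= n%:R * A8.
  by rewrite ler_pdivrMr ?exprn_gt0 // -mulrA -exprS.
have := lerD a12 a8; lra.
Qed.

End Assembly.

(** * The bound with explicit constants *)

(** The elementary inequalities between the parameters: [n] is the range of the
multiples of [al] and [J] an upper bound for the length of all the reciprocal
sums.  The inequality [2 ^ (3 + j) <= (3 + j) ^ j], valid from [j = 3] on, lets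
[n * Y ^ 3] exceed [X ^ k] when [X <= 2 * Y]. *)
Lemma block_sizes (j Y n J : nat) : (3 <= j)%N -> (0 < Y)%N ->
  n = (((3 + j) * Y) ^ j)%N -> J = (193 * Y ^ 3 * n)%N ->
  [/\ (0 < n)%N, (Y ^ 3 <= n)%N, (9 * Y ^ 2 <= n)%N & ((2 * Y) ^ (3 + j) <= n * Y ^ 3)%N] /\
  [/\ (Y <= J)%N, (n * Y ^ 3 <= J)%N, ((24 * (2 * Y) ^ 3).+1 * Y <= J)%N,
     ((144 * Y ^ 2).+1 * Y <= J)%N & ((12 * (2 * Y) ^ 3).+1 * n <= J)%N].
Proof.
move=> j3 Y0 nE ->.
have h216 : (216 * Y ^ 3 <= n)%N.
  rewrite nE; apply: (@leq_trans (((3 + j) * Y) ^ 3)).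
    by rewrite -[216%N]/(6 ^ 3)%N -expnMn leq_exp2r // leq_mul2r -[6%N]/(3 + 3)%N leq_add2l j3 orbT.
  by rewrite leq_pexp2l // muln_gt0 Y0.
have Y3 : (0 < Y ^ 3)%N by rewrite expn_gt0 Y0.
have Y23 : (Y ^ 2 <= Y ^ 3)%N by rewrite leq_pexp2l.
have Y13 : (Y <= Y ^ 3)%N by rewrite -[X in (X <= _)%N]expn1 leq_pexp2l.
have Yn : (Y ^ 3 <= n)%N by apply: leq_trans h216; rewrite leq_pmull.
have n0 : (0 < n)%N by apply: leq_trans Yn.
have YJ m : (m <= 193 * Y ^ 3)%N -> (m * n <= 193 * Y ^ 3 * n)%N by move=> h; rewrite leq_mul2r h orbT.
have e24 : ((24 * (2 * Y) ^ 3).+1 <= 193 * Y ^ 3)%N.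
  by rewrite expnMn mulnA -[X in (_ <= X * _)%N]addn1 mulnDl mul1n -addn1 leq_add2l.
have e12 : ((12 * (2 * Y) ^ 3).+1 <= 193 * Y ^ 3)%N.
  by apply: leq_trans e24; rewrite ltnS leq_mul2r orbT.
have e144 : ((144 * Y ^ 2).+1 <= 193 * Y ^ 3)%N.
  apply: leq_trans (_ : 144 * Y ^ 3 + Y ^ 3 <= _)%N.
    by rewrite -addn1 leq_add // leq_mul2l.
  by rewrite -mulSnr leq_mul2r orbT.
have Yn1 := leq_trans Y13 Yn.
split; split=> //.
- apply: leq_trans h216; exact: leq_mul.
- rewrite nE !expnMn (expnD Y) [(Y ^ 3 * _)%N]mulnC mulnA leq_mul2r; apply/orP; right.
  rewrite leq_mul2r; apply/orP; right; apply: (@leq_trans (2 ^ (2 * j))).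
    by rewrite leq_pexp2l // mul2n -addnn leq_add2r.
  by rewrite expnM leq_exp2r ?(leq_trans _ j3) //; apply: leq_trans (leq_add (leqnn 3) j3) => //.
- by apply: (leq_trans Yn1); rewrite leq_pmull // muln_gt0.
- by rewrite mulnC leq_mul2r leq_pmull ?orbT.
- exact: leq_mul e24 Yn1.
- exact: leq_mul e144 Yn1.
- exact: YJ.
Qed.

Section ExplicitBound.
Variable R : realType.

(** Termwise comparison of the bound of [sum_peak_rational] with [Phi]: the
outer terms match because [lam] increases with [n * K] while [lam / (n * K)]
decreases, and the terms [n] and [K] are absorbed by [X ^- 3]. *)
Lemma spacing_le_Phi (k : nat) (X Y n K al : R) (a : int) (q : nat) :
  (0 < q)%N -> 0 < Y -> 0 < X -> X <= 2 * Y -> Y ^+ 3 <= n -> Y ^+ 3 <= K -> X ^+ k <= n * K ->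
  let lam := q%:R + n * K * `|q%:R * al - a%:~R| in
  n * K / lam + n + K + lam <= n * K * (16 * Phi k al X a q).
Proof.
move=> q0 Y0 X0 XY Yn YK XnK /=; rewrite /Phi.
have qR : 0 < q%:R :> R by rewrite ltr0n.
move: (q%:R) qR (`|_|) (normr_ge0 (q%:R * al - a%:~R)) => {q0}q' q0 d d0.
have Y3 : 0 < Y ^+ 3 by rewrite exprn_gt0.
have n0 : 0 < n by exact: lt_le_trans Yn.
have K0 : 0 < K by exact: lt_le_trans YK.
have nK0 : 0 < n * K by rewrite mulr_gt0.
have Xk : 0 < X ^+ k by rewrite exprn_gt0.
have X3 : 0 < X ^+ 3 by rewrite exprn_gt0.
set lam' := q' + X ^+ k * d; set lam := q' + _.
have l'0 : 0 < lam' by rewrite ltr_pwDl // mulr_ge0 // ltW.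
have ll : lam' <= lam by rewrite lerD2l ler_wpM2r.
have l0 : 0 < lam by exact: lt_le_trans ll.
have inv8 m : Y ^+ 3 <= m -> m^-1 <= 8 * X ^- 3.
  move=> Ym; have m0 : 0 < m by exact: lt_le_trans Ym.
  rewrite -[leLHS]mul1r ler_pdivrMr // mulrAC ler_pdivlMr // mul1r.
  apply: (@le_trans _ _ ((2 * Y) ^+ 3)); first by rewrite lerXn2r ?nnegrE ?mulr_ge0 ?(ltW X0) ?(ltW Y0).
  have -> : (2 * Y) ^+ 3 = 8 * Y ^+ 3 by ring.
  by rewrite ler_pM2l.
have e1 : n * K / lam <= n * K * lam'^-1 by rewrite ler_pM2l // lef_pV2 ?posrE.
have e2 : n <= n * K * (8 * X ^- 3).
  by rewrite -[leLHS]mulr1 -mulrA ler_pM2l // -ler_pdivrMl // mulr1 inv8.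
have e3 : K <= n * K * (8 * X ^- 3).
  by rewrite -[leLHS]mul1r mulrAC ler_pM2r // -ler_pdivrMl // mulr1 inv8.
have e4 : lam <= n * K * (lam' * X ^- k).
  rewrite mulrA ler_pdivlMr // /lam /lam' mulrDl mulrDr lerD //.
    by rewrite mulrC ler_pM2r.
  by apply: le_of_eq; ring.
have p1 : 0 <= n * K / lam' := divr_ge0 (ltW nK0) (ltW l'0).
have p2 : 0 <= n * K * (lam' / X ^+ k) := mulr_ge0 (ltW nK0) (divr_ge0 (ltW l'0) (ltW Xk)).
have -> : n * K * (16 * (lam'^-1 + X ^- 3 + lam' * X ^- k)) =
  16 * (n * K * lam'^-1) + 2 * (n * K * (8 * X ^- 3)) + 16 * (n * K * (lam' * X ^- k)) by ring.
lra.
Qed.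

(** All logarithmic, divisor and mean value losses are collected in one
parameter [L].  The choice [A8 = 2 ^ 7 * L * Y * phi8] and
[A12 = 2 ^ 11 * L ^ 2 * Y * phi12] makes the eighth and twelfth powers exceed
the averages of the two majorants. *)
Lemma explicit_weyl_bound (j Y : nat) (X al L phi8 phi12 : R) (a : int) (q : nat)
    (P : {poly R}) (Z : nat) :
  (3 <= j)%N -> (0 < Y)%N -> Y%:R <= X -> X <= 2 * Y%:R -> (0 < q)%N -> coprimez a q%:Z ->
  1 <= L -> 1 + harm R (193 * Y ^ 3 * ((3 + j) * Y) ^ j) <= L ->
  (forall m, (0 < m <= ((3 + j) * Y) ^ j)%N -> (tau m)%:R <= L) ->
  (mean_count (2 * Y))%:R <= L * Y%:R ^+ 6 ->
  0 < phi8 -> 0 < phi12 -> phi8 ^+ 8 = Phi (3 + j) al X a q ->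
  phi12 ^+ 12 = Phi (3 + j) al X a q / Y%:R ->
  (Z <= Y)%N -> (size P <= (3 + j).+1)%N -> P`_(3 + j) = al ->
  cabs (\sum_(x < Z) ee P.[x%:R]) ^+ (2 ^ j) <=
    (2 * Y%:R) ^+ (2 ^ j) * (2 ^+ 12 * (3 + j)%:R ^+ j * L ^+ (j + 2)
      * (Y%:R^-1 + phi8 + phi12)).
Proof.
move=> j3 Y0 YX X2Y q0 cop L1; set J := (193 * _ * _)%N; set n := (_ ^ j)%N => hJ hD hV p8 p12 e8 e12 ZY sP Pj.
have YR : 0 < Y%:R :> R by rewrite ltr0n.
have L0 : 0 < L by lra.
have X0 : 0 < X by exact: lt_le_trans YX.
have [[n0 Yn Y9 XnY'] [YJ nJ J1 J2 J3]] := block_sizes j3 Y0 (erefl n) (erefl J).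
have nR : 0 < n%:R :> R by rewrite ltr0n.
have YnR : Y%:R ^+ 3 <= n%:R :> R by rewrite -natrX ler_nat.
have XnY : X ^+ (3 + j) <= n%:R * Y%:R ^+ 3.
  apply: (@le_trans _ _ ((2 * Y%:R) ^+ (3 + j))).
    by rewrite lerXn2r ?nnegrE ?mulr_ge0 ?(ltW X0).
  by rewrite -(natrX R Y) -!natrM -natrX ler_nat.
set F := Phi _ _ _ _ _ in e8 e12.
have F0 : 0 < F by rewrite -e8 exprn_gt0.
have h0 : 0 <= harm R J := harm_ge0 R J.
have hY : harm R Y <= L by apply: le_trans (harm_mono R YJ) _; lra.
have S8 : \sum_(m < n) rational_majorant Y (m.+1%:R * al) <= n%:R * (2 ^+ 9 * L ^+ 2 * F).
  apply: le_trans (sum_rational_majorant_le q0 cop Y0 nJ erefl) _.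
  have := spacing_le_Phi al a q0 YR X0 X2Y YnR (lexx _) XnY; rewrite -/F /=.
  set W := _ + (_ + _ * `|_|) => hW.
  have -> : n%:R * (2 ^+ 9 * L ^+ 2 * F) =
      Y%:R ^- 3 * L * (32 * L * (n%:R * Y%:R ^+ 3 * (16 * F))) :> R.
    by field; rewrite lt0r_neq0.
  have W0 : 0 <= W.
    by rewrite !addr_ge0 ?divr_ge0 ?addr_ge0 ?mulr_ge0 ?exprn_ge0 ?(ltW nR) ?(ltW YR) ?normr_ge0.
  have Y30 : 0 <= Y%:R ^- 3 :> R by rewrite invr_ge0 exprn_ge0.
  have l0 : 0 <= 1 + harm R J by rewrite addr_ge0.
  apply: ler_pM; first exact: mulr_ge0 Y30 (harm_ge0 R Y).
  - exact: mulr_ge0 (mulr_ge0 (ler0n _ 32) l0) W0.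
  - exact: ler_wpM2l.
  - by apply: ler_pM => //; [exact: mulr_ge0 | exact: ler_wpM2l].
have S12 : \sum_(m < n) mean_quadratic (2 * Y) (m.+1%:R * al)
    <= n%:R * (2 ^+ 18 * L ^+ 2 * Y%:R ^+ 9 * F).
  have N0 : (0 < 2 * Y)%N by rewrite muln_gt0.
  apply: le_trans (sum_mean_quadratic_le q0 cop N0 n0 J3 erefl) _.
  set K := (12 * (2 * Y) ^ 3).+1%:R.
  have KE : K = 96 * Y%:R ^+ 3 + 1.
    by rewrite /K expnMn mulnA -addn1 natrD natrM natrX.
  have Y31 : 1 <= Y%:R ^+ 3 :> R by rewrite exprn_ege1 // ler1n.
  have YK : Y%:R ^+ 3 <= K by rewrite KE; lra.
  have XK : X ^+ (3 + j) <= K * n%:R.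
    by apply: le_trans XnY _; rewrite mulrC ler_wpM2r.
  have K0 : 0 < K by lra.
  have := spacing_le_Phi al a q0 YR X0 X2Y YK YnR XK; rewrite -/F /=.
  set W := _ + (_ + _ * `|_|) => hW.
  have W0 : 0 <= W.
    by rewrite !addr_ge0 ?divr_ge0 ?addr_ge0 ?mulr_ge0 ?exprn_ge0 ?(ltW nR) ?(ltW K0) ?normr_ge0.
  have -> : n%:R * (2 ^+ 18 * L ^+ 2 * Y%:R ^+ 9 * F) =
      L * Y%:R ^+ 6 * (128 * L * (128 * Y%:R ^+ 3 * n%:R * (16 * F))) :> R by ring.
  have l0 : 0 <= 1 + harm R J by rewrite addr_ge0.
  apply: ler_pM => //; first exact: mulr_ge0 (mulr_ge0 (ler0n _ 128) l0) W0.
  apply: ler_pM => //; first exact: mulr_ge0; first exact: ler_wpM2l.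
  apply: le_trans hW _; rewrite ler_wpM2r ?mulr_ge0 ?(ltW F0) // ler_wpM2r //.
  by rewrite KE; lra.
pose A8 : R := 2 ^+ 7 * L * Y%:R * phi8.
pose A12 : R := 2 ^+ 11 * L ^+ 2 * Y%:R * phi12.
pose C8 : R := (2 ^+ 6 * L ^+ 2 * (2 ^+ 16 * L)) ^+ 2 * Y%:R ^+ 8.
pose C12 : R := (2 ^+ 8 * L) ^+ 11 * (2 ^+ 3 * (2 ^+ 15 * L * Y%:R ^+ 2)).
have t0 : 0 < 2 :> R by [].
have A80 : 0 < A8 by rewrite !mulr_gt0 ?exprn_gt0.
have A120 : 0 < A12 by rewrite !mulr_gt0 ?exprn_gt0.
have C80 : 0 <= C8 := mulr_ge0 (sqr_ge0 _) (exprn_ge0 8 (ltW YR)).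
have C120 : 0 <= C12.
  apply: mulr_ge0; first exact: exprn_ge0 (mulr_ge0 (exprn_ge0 8 (ltW t0)) (ltW L0)).
  exact: mulr_ge0 (exprn_ge0 3 (ltW t0)) (mulr_ge0 (mulr_ge0 (exprn_ge0 15 (ltW t0)) (ltW L0)) (sqr_ge0 _)).
have V80 t : 0 <= rational_majorant Y t :> R.
  apply: sumr_ge0 => r _; apply: sumr_ge0 => b _.
  by rewrite mulr_ge0 ?peak_ge0 ?mulr_ge0 ?invr_ge0 ?exprn_ge0.
have V120 t : 0 <= mean_quadratic (2 * Y) t :> R by exact: mean_quadratic_ge0.
have lL : 1 + harm R J <= L by [].
have l0 : 0 <= 1 + harm R J by rewrite addr_ge0.
have c256 : 256 = 2 ^+ 8 :> R by rewrite -natrX.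
have c64 : 64 = 2 ^+ 6 :> R by rewrite -natrX.
have c8 : 8 = 2 ^+ 3 :> R by rewrite -natrX.
have hVV m (Q : {poly R}) X' : (X' <= Y)%N -> (size Q <= 4)%N -> Q`_3 = al * m.+1%:R ->
    forall S, S = cabs (\sum_(x < X') ee Q.[x%:R]) ->
    S ^+ 12 <= C12 * mean_quadratic (2 * Y) (m.+1%:R * al) \/
    S ^+ 8 <= C8 * rational_majorant Y (m.+1%:R * al).
  move=> XY sQ Q3 S SE.
  have hD9 i : (0 < i <= 9 * Y ^ 2)%N -> (tau i)%:R <= L.
    by move=> /andP[i0 i9]; apply: hD; rewrite i0 (leq_trans i9).
  rewrite mulrC in Q3.
  have [h|h] := cubic_dichotomy Y0 J1 J2 L1 hD9 XY sQ Q3 SE; [left|right].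
    apply: le_trans h _; rewrite /C12 c256 c8.
    move: (mean_quadratic _ _) (V120 (m.+1%:R * al)) => V V0.
    move: (1 + _) l0 lL (2 : R) t0 => l l0 lL t t0.
    have -> : (t ^+ 8 * L) ^+ 11 * (t ^+ 3 * (t ^+ 15 * L * Y%:R ^+ 2)) * V =
      (t ^+ 8 * L) ^+ 11 * (t ^+ 3 * V * (t ^+ 15 * L * Y%:R ^+ 2)) by ring.
    have t8 := exprn_ge0 8 (ltW t0); have t15 := exprn_ge0 15 (ltW t0).
    have t3V := mulr_ge0 (exprn_ge0 3 (ltW t0)) V0.
    have tl8 := mulr_ge0 t8 l0; have tl15 := mulr_ge0 t15 l0.
    apply: ler_pM.
    - exact: exprn_ge0.
    - exact: mulr_ge0 t3V (mulr_ge0 tl15 (sqr_ge0 _)).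
    - by rewrite lerXn2r ?nnegrE // ?(mulr_ge0 t8 (ltW L0)) // ler_wpM2l.
    - by apply: ler_wpM2l => //; apply: ler_wpM2r (sqr_ge0 _) _ _ _; exact: ler_wpM2l.
  apply: le_trans h _; rewrite /C8 c64.
  apply: ler_wpM2r (V80 _) _ _ _; apply: ler_wpM2r (exprn_ge0 8 (ltW YR)) _ _ _.
  move: (1 + _) l0 lL (2 : R) t0 => l l0 lL t t0.
  have u0 : 0 <= t ^+ 6 * L ^+ 2 := mulr_ge0 (exprn_ge0 6 (ltW t0)) (sqr_ge0 _).
  have t16 := exprn_ge0 16 (ltW t0).
  rewrite lerXn2r ?nnegrE ?(mulr_ge0 u0 (mulr_ge0 t16 l0)) ?(mulr_ge0 u0 (mulr_ge0 t16 (ltW L0))) //.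
  by apply: ler_wpM2l => //; exact: ler_wpM2l.
have S8' : C8 * \sum_(m < n) rational_majorant Y (m.+1%:R * al) <= n%:R * A8 ^+ 8.
  have a8 (t l y p m : R) : m * (t ^+ 7 * l * y * p) ^+ 8 =
      t ^+ 3 * ((t ^+ 6 * l ^+ 2 * (t ^+ 16 * l)) ^+ 2 * y ^+ 8 * (m * (t ^+ 9 * l ^+ 2 * p ^+ 8))).
    by ring.
  apply: le_trans (ler_wpM2l C80 S8) _; rewrite /A8 a8 e8 -/C8 ler_peMl ?exprn_ege1 ?ler1n //.
  exact: mulr_ge0 C80 (le_trans (sumr_ge0 _ (fun m _ => V80 _)) S8).
have S12' : C12 * \sum_(m < n) mean_quadratic (2 * Y) (m.+1%:R * al) <= n%:R * A12 ^+ 12.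
  have a12 (t l y p m : R) : m * (t ^+ 11 * l ^+ 2 * y * p) ^+ 12 =
      t ^+ 8 * l ^+ 10 * ((t ^+ 8 * l) ^+ 11 * (t ^+ 3 * (t ^+ 15 * l * y ^+ 2)) *
        (m * (t ^+ 18 * l ^+ 2 * y ^+ 9 * (p ^+ 12 * y)))) by ring.
  apply: le_trans (ler_wpM2l C120 S12) _; rewrite /A12 a12 e12 divfK ?lt0r_neq0 // -/C12.
  rewrite ler_peMl //; first exact: mulr_ge0 C120 (le_trans (sumr_ge0 _ (fun m _ => V120 _)) S12).
  by rewrite mulr_ege1 ?exprn_ege1 ?ler1n.
have := cubic_reduction Y0 (leqnn n) L1 hD A80 A120 C80 C120 V80 V120 hVV S8' S12' ZY sP Pj.
move=> h; apply: le_trans h _.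
have j2 : (j < 2 ^ j)%N by exact: ltn_expl.
have ej : (2 ^ j = (2 ^ j - j - 1) + j + 1)%N.
  by move: (2 ^ j)%N j2 => m; clear; lia.
rewrite exprMn -!mulrA ler_wpM2l ?exprn_ge0 // [in Y%:R ^+ (2 ^ j)]ej !exprD expr1 -!mulrA.
rewrite ler_wpM2l ?exprn_ge0 //.
have nE : n%:R = (3 + j)%:R ^+ j * Y%:R ^+ j :> R by rewrite -!natrX -natrM -expnMn.
have jk : j%:R <= (3 + j)%:R ^+ j :> R.
  rewrite -natrX ler_nat; apply: leq_trans (leq_addl 3 j) _.
  by rewrite -[X in (X <= _)%N]expn1 leq_exp2l ?(leq_trans _ j3) //.
have Lj : 1 <= L ^+ j by rewrite exprn_ege1.
rewrite nE /A8 /A12.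
have k0 : 0 <= (3 + j)%:R ^+ j :> R by rewrite exprn_ge0.
move: (Y%:R ^+ j) ((3 + j)%:R ^+ j) (L ^+ j) (exprn_ge0 j (ltW YR)) k0 jk Lj => y k l y0 k0 jk l1.
have pY8 : 0 < Y%:R * phi8 by exact: mulr_gt0.
have pY12 : 0 < Y%:R * phi12 by exact: mulr_gt0.
have ky0 : 0 <= k * y by exact: mulr_ge0.
have lL1 : 1 <= l * L by exact: mulr_ege1.
have lL2 : l * L <= l * L * L by rewrite ler_peMr // (le_trans ler01).
have h8 : l * L * (k * y * (Y%:R * phi8)) <= l * L * L * (k * y * (Y%:R * phi8)).
  by apply: ler_wpM2r => //; exact: mulr_ge0 ky0 (ltW pY8).
have h1 : 1 * (k * y) <= l * L * L * (k * y).
  by apply: ler_wpM2r => //; exact: le_trans lL1 lL2.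
have hj : j%:R * y <= k * y by exact: ler_wpM2r.
have hp8 : 0 <= l * L * L * (k * y * (Y%:R * phi8)).
  exact: mulr_ge0 (le_trans ler01 (le_trans lL1 lL2)) (mulr_ge0 ky0 (ltW pY8)).
rewrite [leRHS](_ : _ = 2 ^+ 12 * (l * L * L * (k * y)) + 2 ^+ 12 * (l * L * L * (k * y * (Y%:R * phi8)))
   + 2 ^+ 12 * (l * L * L * (k * y * (Y%:R * phi12)))); last by field; rewrite lt0r_neq0.
rewrite [leLHS](_ : _ = j%:R * y + 2 ^+ 8 * (l * L * (k * y * (Y%:R * phi8)))
   + 2 ^+ 12 * (l * L * L * (k * y * (Y%:R * phi12)))); last by ring.
rewrite lerD2r; apply: lerD.
  apply: le_trans hj _; rewrite -[leLHS]mul1r; apply: le_trans h1 _.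
  by rewrite ler_peMl ?exprn_ege1 ?ler1n //; exact: mulr_ge0 (le_trans ler01 (le_trans lL1 lL2)) ky0.
apply: le_trans (ler_wpM2l (exprn_ge0 8 (ltW t0)) h8) _; apply: ler_wpM2r => //.
by rewrite ler_weXn2l // ler1n.
Qed.

End ExplicitBound.

(** * Removal of the explicit parameters *)

Section Powers.
Variable R : realType.

(** Dyadic blocks each contribute at most 1. *)
Lemma harm_bound (eps : R) : 0 < eps ->
  exists2 C : R, 0 < C & forall n, (0 < n)%N -> 1 + harm R n <= C * n%:R `^ eps.
Proof.
move=> e0.
have x1 : 1 < 2 `^ eps :> R.
  by have := @gt0_ltr_powR R eps e0 1 2; rewrite powR1; apply; rewrite ?nnegrE // ltr1n.
have [K K1 hK] := linear_le_pow x1.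
have dyadic i : harm R (2 ^ i) <= i.+1%:R.
  elim: i => [|i IH]; first by rewrite /harm big_ord1 invr1.
  rewrite expnS mul2n -addnn /harm big_split_ord /= -natr1; apply: lerD => //.
  apply: (@le_trans _ _ (\sum_(s < 2 ^ i) (2 ^ i)%:R^-1)).
    apply: ler_sum => s _; rewrite lef_pV2 ?posrE ?ltr0n ?expn_gt0 // ler_nat.
    by rewrite -addnS leq_addr.
  by rewrite sumr_const card_ord -[leLHS]mulr_natl divff // pnatr_eq0 -lt0n expn_gt0.
exists (3 * K); first by rewrite mulr_gt0 // (lt_le_trans ltr01).
move=> n n0; have /andP[h1 h2] := trunc_log_bounds (isT : 1 < 2)%N n0.
set t := trunc_log 2 n in h1 h2.
apply: (@le_trans _ _ (3 * t.+1%:R)).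
  have := le_trans (harm_mono R (ltnW h2)) (dyadic t.+1).
  have t0 : 0 <= t%:R :> R by [].
  by rewrite -[t.+2%:R]natr1 -natr1; lra.
rewrite -mulrA ler_pM2l //; apply: le_trans (hK t) _.
rewrite ler_wpM2l ?(le_trans ler01 K1) //.
have -> : (2 `^ eps) ^+ t = (2 ^ t)%:R `^ eps :> R.
  by rewrite natrX -(powR_mulrn t (ler0n R 2)) powRAC powR_mulrn ?powR_ge0.
by apply: ge0_ler_powR; rewrite ?nnegrE ?ler_nat ?(ltW e0).
Qed.

Lemma powR_scale_le (c x r : R) : 1 <= c -> 0 <= x -> r <= 1 ->
  (c * x) `^ r <= c * x `^ r.
Proof.
move=> c1 x0 r1; rewrite powRM ?(le_trans ler01 c1) // ler_wpM2r ?powR_ge0 //.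
by rewrite -[leRHS]powRr1 ?(le_trans ler01 c1) // ler_powR.
Qed.

Lemma powR_add_le (x y r : R) : 0 <= x -> 0 <= y -> 0 <= r <= 1 ->
  (x + y) `^ r <= 2 * (x `^ r + y `^ r).
Proof.
move=> + + /andP[r0 r1]; wlog xy : x y / x <= y => [h|x0 y0].
  move=> x0 y0; have [|/ltW yx] := leP x y; first by move=> xy; exact: h.
  by rewrite addrC [X in _ <= 2 * X]addrC; exact: h.
apply: (@le_trans _ _ ((2 * y) `^ r)).
  by apply: ge0_ler_powR; rewrite ?nnegrE ?addr_ge0 ?mulr_ge0 //; lra.
apply: le_trans (powR_scale_le _ y0 r1) _; first lra.
by rewrite ler_pM2l // lerDr powR_ge0.
Qed.

Lemma root_bound (s y B : R) (m : nat) : (0 < m)%N -> 0 <= s -> 0 <= y -> 0 <= B ->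
  s ^+ m <= y ^+ m * B -> s <= y * B `^ (m%:R^-1).
Proof.
move=> m0 s0 y0 B0 h.
have mR : m%:R != 0 :> R by rewrite pnatr_eq0 -lt0n.
have rt x : 0 <= x -> (x ^+ m) `^ (m%:R^-1) = x :> R.
  by move=> x0; rewrite -powR_mulrn // -powRrM mulfV // powRr1.
rewrite -{1}(rt s s0) -{1}(rt y y0) -powRM ?exprn_ge0 //.
by apply: ge0_ler_powR; rewrite ?nnegrE ?mulr_ge0 ?exprn_ge0 ?invr_ge0.
Qed.

Lemma e_ee (t : R) : e (t%:C)%C = ee t.
Proof.
rewrite /e /ee /cexp.
have -> : (2 * pi%:C * 'i * t%:C)%C = (0 +i* (2 * pi * t))%C :> R[i].
  by apply/eqP; rewrite eq_complex /=; apply/andP; split; apply/eqP; ring.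
by rewrite /= expR0 mul1r.
Qed.

Lemma weyl_sum_poly (k : nat) (al X : R) :
  weyl_sum k al X = \sum_(x < Num.truncn X) ee (al *: ('X + 1%:P) ^+ k).[x%:R].
Proof.
rewrite /weyl_sum big_add1 big_mkord; apply: eq_bigr => x _.
by rewrite e_ee !hornerE -natr1.
Qed.

Lemma shifted_monomial (k : nat) (al : R) :
  (size (al *: ('X + 1%:P) ^+ k) <= k.+1)%N /\ (al *: ('X + 1%:P) ^+ k)`_k = al.
Proof.
have e : 'X + 1%:P = 'X - (-1)%:P :> {poly R} by rewrite polyCN opprK.
have s : size (('X + 1%:P : {poly R}) ^+ k) = k.+1 by rewrite e size_exp_XsubC.
split; first by rewrite (leq_trans (size_scale_leq _ _)) // s.
rewrite coefZ; have := monic_exp k (monicXsubC (-1 : R)); rewrite -e.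
by rewrite monicE lead_coefE s => /eqP ->; rewrite mulr1.
Qed.

End Powers.

Section Constants.
Variable R : realType.

(** Every loss is at most a constant times an arbitrarily small power of a
quantity of size [Y ^ (3 + j)]; taking this power to be [dl / (3 + j)] leaves
[Y ^ dl]. *)
Lemma uniform_constants (j : nat) (dl : R) : 0 < dl ->
  exists2 C : R, 1 <= C & forall Y : nat, (0 < Y)%N ->
    let n := (((3 + j) * Y) ^ j)%N in let L := C * Y%:R `^ dl in
    [/\ 1 <= L, 1 + harm R (193 * Y ^ 3 * n) <= L,
        forall m, (0 < m <= n)%N -> (tau m)%:R <= L &
        (mean_count (2 * Y))%:R <= L * Y%:R ^+ 6].
Proof.
move=> dl0; pose eta := dl / (3 + j)%:R.
have kR : 0 < (3 + j)%:R :> R by rewrite ltr0n.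
have eta0 : 0 < eta by rewrite divr_gt0.
have [C1 C10 h1] := harm_bound eta0.
have [C2 C20 h2] := divisor_bound eta0.
have [C3 C30 h3] := cubic_vinogradov eta0.
pose c := (193 * (3 + j) ^ j)%N.
have c1 : 1 <= c%:R `^ eta :> R.
  rewrite powR_ge1 ?(ltW eta0) // ler1n muln_gt0 expn_gt0 //.
pose C := (1 + C1 + C2 + 2 ^+ 6 * C3) * c%:R `^ eta.
have p6 : 0 < 2 ^+ 6 * C3 by rewrite mulr_gt0 ?exprn_gt0.
exists C; first by rewrite mulr_ege1 //; lra.
move=> Y Y0 n L.
have Y1 : 1 <= Y%:R :> R by rewrite ler1n.
pose J := (193 * Y ^ 3 * n)%N.
have JE : J = (c * Y ^ (3 + j))%N by rewrite /J /n /c expnMn expnD; lia.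
have nJ : (n <= J)%N by rewrite leq_pmull // muln_gt0 expn_gt0 Y0.
have n0 : (0 < n)%N by rewrite expn_gt0 muln_gt0 Y0.
have J0 : (0 < J)%N by exact: leq_trans nJ.
have YJ : (2 * Y <= J)%N.
  rewrite /J -mulnA leq_mul //; apply: (@leq_trans (Y ^ 3)).
    by rewrite -[X in (X <= _)%N]expn1 leq_pexp2l.
  by rewrite leq_pmulr.
have Jd : J%:R `^ eta = c%:R `^ eta * Y%:R `^ dl :> R.
  rewrite JE natrM powRM // natrX -powR_mulrn // -powRrM; congr (_ * _ `^ _).
  by rewrite /eta mulrC divfK ?gt_eqF.
have LE : L = (1 + C1 + C2 + 2 ^+ 6 * C3) * J%:R `^ eta by rewrite Jd /L /C mulrA.
have J1 : 1 <= J%:R `^ eta :> R by rewrite powR_ge1 ?(ltW eta0) // ler1n.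
have mono m : (m <= J)%N -> m%:R `^ eta <= J%:R `^ eta :> R.
  by move=> mJ; apply: ge0_ler_powR; rewrite ?nnegrE ?ler_nat ?(ltW eta0).
have CL D : D <= 1 + C1 + C2 + 2 ^+ 6 * C3 -> D * J%:R `^ eta <= L.
  by move=> h; rewrite LE ler_wpM2r ?powR_ge0.
split.
- by rewrite -[leLHS]mulr1; apply: le_trans (CL 1 _); rewrite ?mul1r //; lra.
- by apply: le_trans (h1 _ J0) (CL _ _); lra.
- move=> m /andP[m0 mn]; apply: le_trans (h2 _ m0) _.
  apply: le_trans (CL C2 _); last by lra.
  by apply: ler_wpM2l (ltW C20) _ _ (mono _ (leq_trans mn nJ)).
have Y20 : (0 < 2 * Y)%N by rewrite muln_gt0.
apply: le_trans (h3 _ Y20) _; rewrite natrM exprMn.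
apply: (@le_trans _ _ (2 ^+ 6 * C3 * J%:R `^ eta * Y%:R ^+ 6)); last first.
  by rewrite ler_wpM2r ?exprn_ge0 // CL //; lra.
have -> : C3 * (2 ^+ 6 * Y%:R ^+ 6) * (2 * Y%:R) `^ eta =
  2 ^+ 6 * C3 * (2 * Y%:R) `^ eta * Y%:R ^+ 6 by ring.
rewrite ler_wpM2r ?exprn_ge0 // ler_wpM2l ?(ltW p6) // -natrM.
exact: mono.
Qed.

End Constants.

(** * The Weyl sum estimate *)

Theorem corollary1p4 (R : realType) (k : nat) (k_ge6 : (6 <= k)%N)
    (eps : R) (eps_gt0 : 0 < eps) :
  exists2 C : R, 0 < C &
    forall (X alpha : R) (a : int) (q : nat),
      1 <= X -> (0 < q)%N -> coprimez a q%:Z ->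
      Normc.normc (weyl_sum k alpha X) <=
        C * (X `^ (1 + eps) * Phi k alpha X a q `^ (2 ^- k)
             + X `^ (1 + eps)
               * (Phi k alpha X a q / X) `^ (2 / 3 * 2 ^- k)).
Proof.
have [j j3 ->] : exists2 j, (3 <= j)%N & k = (3 + j)%N.
  by exists (k - 3)%N; rewrite ?subnKC ?(leq_trans _ k_ge6) // leq_subRL ?(leq_trans _ k_ge6).
have dl0 : 0 < eps / (j + 2)%:R by rewrite divr_gt0 // ltr0n addn2.
have [C0 C01 hC] := uniform_constants j dl0; set dl := eps / _ in dl0 hC.
pose G0 : R := 2 ^+ 12 * (3 + j)%:R ^+ j * C0 ^+ (j + 2).
have G01 : 1 <= G0.
  by rewrite !mulr_ege1 ?exprn_ege1 ?ler1n.
have G00 : 0 < G0 by exact: lt_le_trans G01.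
(* 2 from X <= 2 Y; 4 from splitting the root of a sum of three terms; 257 = 2 ^ 8 + 1
   from the term 1 / Y, whose eighth power is at most 2 ^ 8 Phi, and from phi8. *)
have Cpos : 0 < 2 * G0 * (4 * 257).
  by move: G0 G00 {G01} => g g0; rewrite !pmulr_lgt0 ?ltr0n.
exists (2 * G0 * (4 * 257)) => //.
move=> X al a q X1 q0 cop; set F := Phi _ _ _ _ _.
have X0 : 0 < X := lt_le_trans ltr01 X1.
pose Y := Num.truncn X.
have /andP[YX XY1] := truncn_itv (ltW X0); rewrite -/Y in YX XY1.
have Y0 : (0 < Y)%N.
  by rewrite lt0n; apply/eqP => Y0; move: XY1; rewrite Y0 ltNge X1.
have YR : 0 < Y%:R :> R by rewrite ltr0n.
have Y1 : 1 <= Y%:R :> R by rewrite ler1n.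
have X2Y : X <= 2 * Y%:R by move: XY1; rewrite -natr1; lra.
have D0 : 0 < q%:R + X ^+ (3 + j) * `|q%:R * al - a%:~R|.
  by rewrite ltr_pwDl ?ltr0n // mulr_ge0 ?exprn_ge0 // ltW.
have F3 : X ^- 3 <= F.
  rewrite /F /Phi -addrA addrCA lerDl addr_ge0 ?invr_ge0 ?(ltW D0) //.
  by rewrite mulr_ge0 ?(ltW D0) // invr_ge0 exprn_ge0 // ltW.
have F0 : 0 < F by apply: lt_le_trans F3; rewrite invr_gt0 exprn_gt0.
have [L1 hL1 hL2 hL3] := hC Y Y0.
have [sP cP] := @shifted_monomial R (3 + j) al.
have p8 : 0 < F `^ 8^-1 by rewrite powR_gt0.
have FY0 : 0 < F / Y%:R by rewrite divr_gt0.
have p12 : 0 < (F / Y%:R) `^ 12^-1 by rewrite powR_gt0.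
have root n x : (0 < n)%N -> 0 < x -> (x `^ (n%:R^-1)) ^+ n = x :> R.
  move=> n0 x0; rewrite -powR_mulrn ?powR_ge0 // -powRrM mulVf ?powRr1 ?(ltW x0) //.
  by rewrite pnatr_eq0 -lt0n.
have := explicit_weyl_bound j3 Y0 YX X2Y q0 cop L1 hL1 hL2 hL3 p8 p12
  (root 8%N F isT F0) (root 12%N _ isT FY0) (leqnn Y) sP cP.
rewrite -/Y -weyl_sum_poly -/F; set s := Normc.normc _.
set phi8 := F `^ 8^-1; set phi12 := (F / Y%:R) `^ 12^-1.
set L := C0 * _ => hs.
have s0 : 0 <= s by exact: cabs_ge0.
pose p : R := (2 ^ j)%:R^-1.
have p0 : 0 <= p by rewrite invr_ge0.
have p1 : p <= 1 by rewrite invf_le1 ?ltr0n ?ler1n expn_gt0.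
have LE : L ^+ (j + 2) = C0 ^+ (j + 2) * Y%:R `^ eps.
  rewrite /L exprMn; congr (_ * _).
  by rewrite -powR_mulrn ?powR_ge0 // -powRrM /dl divfK // pnatr_eq0 addn2.
pose W : R := Y%:R^-1 + phi8 + phi12.
have Yi0 : 0 <= Y%:R^-1 :> R by rewrite invr_ge0.
have W0 : 0 <= W by exact: addr_ge0 (addr_ge0 Yi0 (ltW p8)) (ltW p12).
have Ye1 : 1 <= Y%:R `^ eps by rewrite powR_ge1 ?(ltW eps_gt0).
have GY1 : 1 <= G0 * Y%:R `^ eps by exact: mulr_ege1.
have hs' : s ^+ (2 ^ j) <= (2 * Y%:R) ^+ (2 ^ j) * (G0 * Y%:R `^ eps * W).
  by apply: le_trans hs _; rewrite LE [_ * (C0 ^+ (j + 2) * _)]mulrA.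
have GYW0 : 0 <= G0 * Y%:R `^ eps * W by rewrite mulr_ge0 // (le_trans ler01).
have m0 : (0 < 2 ^ j)%N by rewrite expn_gt0.
have Y20 : 0 <= 2 * Y%:R :> R by rewrite mulr_ge0.
have s1 := root_bound m0 s0 Y20 GYW0 hs'; rewrite -/p in s1.
have s2 := powR_scale_le GY1 W0 p1.
set A := F `^ (2 ^- (3 + j)); set B := (F / X) `^ _.
have pE : p = 8 * 2 ^- (3 + j).
  by rewrite /p natrX exprD; field; rewrite expf_neq0.
have i1 : 2 ^- (3 + j) <= 1 :> R by rewrite invf_le1 ?exprn_gt0 // exprn_ege1 // ler1n.
have w8 : phi8 `^ p = A by rewrite /phi8 -powRrM pE mulrA mulVf // mul1r.
have w1 : Y%:R^-1 `^ p <= 2 ^+ 8 * A.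
  have -> : Y%:R^-1 `^ p = (Y%:R^-1 ^+ 8) `^ (2 ^- (3 + j)).
    by rewrite -powR_mulrn // -powRrM -pE.
  apply: le_trans (powR_scale_le _ (ltW F0) i1); last by rewrite exprn_ege1 // ler1n.
  have X8 : X^-1 ^+ 8 <= F.
    apply: le_trans F3; rewrite -exprVn -[8%N]/(5 + 3)%N exprD ler_piMl ?exprn_ge0 ?invr_ge0 ?(ltW X0) //.
    by rewrite exprn_ile1 ?invr_ge0 ?(ltW X0) // invf_le1.
  have Y8 : Y%:R^-1 ^+ 8 <= 2 ^+ 8 * F.
    apply: (@le_trans _ _ ((2 * X^-1) ^+ 8)); last by rewrite exprMn ler_pM2l ?exprn_gt0.
    rewrite lerXn2r ?nnegrE ?mulr_ge0 ?invr_ge0 ?(ltW X0) //.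
    by rewrite ler_pdivlMr // mulrC ler_pdivrMr.
  apply: ge0_ler_powR Y8; rewrite ?nnegrE ?invr_ge0 ?exprn_ge0 //.
  by apply: mulr_ge0 (ltW F0); rewrite exprn_ge0.
have w12 : phi12 `^ p <= 2 * B.
  have -> : phi12 `^ p = (F / Y%:R) `^ (2 / 3 * 2 ^- (3 + j)).
    by rewrite -powRrM pE; congr (_ `^ _); field; rewrite expf_neq0.
  have FX0 : 0 <= F / X by exact: divr_ge0 (ltW F0) (ltW X0).
  have r0 : 0 <= 2 / 3 * 2 ^- (3 + j) :> R by rewrite mulr_ge0 ?divr_ge0 ?invr_ge0 ?exprn_ge0.
  apply: (@le_trans _ _ ((2 * (F / X)) `^ (2 / 3 * 2 ^- (3 + j)))); last first.
    apply: powR_scale_le FX0 _; first by rewrite ler1n.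
    by rewrite mulr_ile1 ?divr_ge0 ?invr_ge0 ?exprn_ge0 // ler_pdivrMr // mul1r ler_nat.
  have FYX : F / Y%:R <= 2 * (F / X).
    rewrite mulrCA ler_pM2l // ler_pdivlMr // mulrC ler_pdivrMr //.
  have FX20 : 0 <= 2 * (F / X) by exact: mulr_ge0 FX0.
  by apply: ge0_ler_powR FYX; rewrite // nnegrE ?(ltW FY0).
have hW : W `^ p <= 4 * 257 * (A + B).
  have A0 : 0 <= A by exact: powR_ge0.
  have B0 : 0 <= B by exact: powR_ge0.
  have p01 : 0 <= p <= 1 by rewrite p0.
  have h1 := powR_add_le (addr_ge0 Yi0 (ltW p8)) (ltW p12) p01.
  have h2 := powR_add_le Yi0 (ltW p8) p01.
  have e8 : 2 ^+ 8 = 256 :> R by rewrite -natrX.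
  apply: le_trans h1 _; rewrite w8 in h2; rewrite e8 in w1.
  move: h2 w1 w12; move: (_ `^ p) (_ `^ p) (_ `^ p) => u v w h2 w1 w12.
  lra.
have hX : Y%:R * Y%:R `^ eps <= X `^ (1 + eps).
  have -> : X `^ (1 + eps) = X * X `^ eps.
    by rewrite powRD ?powRr1 ?(ltW X0) // (gt_eqF X0) implybT.
  apply: ler_pM => //.
  by apply: ge0_ler_powR; rewrite ?nnegrE ?(ltW eps_gt0) ?(ltW X0).
apply: le_trans s1 _.
apply: (@le_trans _ _ (2 * Y%:R * (G0 * Y%:R `^ eps * (4 * 257 * (A + B))))).
  apply: ler_wpM2l => //; apply: le_trans s2 _.
  by apply: ler_wpM2l => //; exact: le_trans ler01 GY1.
rewrite -mulrDr.
have -> : 2 * Y%:R * (G0 * Y%:R `^ eps * (4 * 257 * (A + B))) =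
  2 * G0 * (4 * 257) * (Y%:R * Y%:R `^ eps * (A + B)) by ring.
apply: ler_wpM2l (ltW Cpos) _ _ _; apply: ler_wpM2r hX.
exact: addr_ge0 (powR_ge0 _ _) (powR_ge0 _ _).
Qed.
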